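(* The following are equivalent: (1) ${\rm UP}={\rm coUP}$. (2) ${\rm CLU\#P_{free}}={\rm CLU\#P}$. (3) ${\rm CLU\#P_{free}}\subseteq{\rm CLU\#P_{circular}}$.
   Context: Alphabet $\Sigma=\{0,1\}$; NPTM = nondeterministic polynomial-time Turing machine. ${\rm UP}$: languages accepted by NPTMs with at most one accepting path on every input; ${\rm coUP}$: their complements. For a polynomial $p$, an NPTM $M$ is $p$-balanced if on every input $x$ its computation paths correspond exactly to the guess strings in $\{0,1\}^{p(|x|)}$; paths are identified with guess strings. $\mathrm{acc}_M(x)$ is the set of accepting paths, $\#\mathrm{acc}_M(x)$ its size. ${\rm FP}_{\rm t}$: total polynomial-time computable functions. For same-length strings, $a\prec_{\rm lex}b$ means $b$ is the immediate lexicographic successor of $a$; $\le_{\rm lex}$ is lexicographic order. ${\rm CLU\#P}$: total $f:\Sigma^*\to\mathbb{N}$ such that there exist a polynomial $p$, a $p$-balanced NPTM $M$, $b,t\in{\rm FP}_{\rm t}$ and a polynomial-time 3-argument predicate $\prec$ such that for every $x$ there is a bijection $h_x$ of $\Sigma^{p(|x|)}$ with: $|b(x)|=|t(x)|=p(|x|)$; $h_x(b(x))=0^{p(|x|)}$, $h_x(t(x))=1^{p(|x|)}$; (adjacency) for $y,z\in\{0,1\}^{p(|x|)}$, $\prec(x,y,z)$ iff $h_x(y)\prec_{\rm lex}h_x(z)$; (cluster) if $f(x)\neq0$ there exist $\ell,u$ with $\mathrm{acc}_M(x)=\{w\in\{0,1\}^{p(|x|)}: h_x(\ell)\le_{\rm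 lex}h_x(w)\le_{\rm lex}h_x(u)\}$; $f(x)=\#\mathrm{acc}_M(x)$. ${\rm CLU\#P_{free}}$: defined like ${\rm CLU\#P}$ but with no functions $b,t$ and no conditions on them. ${\rm CLU\#P_{circular}}$: defined like ${\rm CLU\#P_{free}}$ except that the adjacency condition is: $\prec(x,y,z)$ iff $h_x(y)\prec_{\rm lex}h_x(z)$ or ($h_x(y)=1^{p(|x|)}$ and $h_x(z)=0^{p(|x|)}$). *)

(* Defs.v *)
From mathcomp Require Import all_boot all_order all_algebra.
From mathcomp Require Import boolp classical_sets.

Set Implicit Arguments.
Unset Strict Implicit.
Unset Printing Implicit Defensive.

Local Open Scope classical_set_scope.

Definition word := seq bool.
Definition language := set word.

Definition peval (p : {poly nat}) (n : nat) : nat := (p.[n])%R.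

(* Nondeterministic multi-tape Turing machines with two-way infinite tapes.
   A cell is blank ([None]), holds an input letter ([Some (inl b)]) or holds
   one of finitely many auxiliary symbols ([Some (inr g)]).  In each situation
   the machine halts (with a verdict), makes one deterministic step, or guesses
   a bit and makes the step that belongs to it. *)
Inductive dir := Left | Stay | Right.

Definition cell (G : finType) : Type := option (bool + G)%type.

Definition action (k : nat) (G Q : finType) : Type :=
  (Q * {ffun 'I_k.+1 -> cell G * dir})%type.

Inductive instr (k : nat) (G Q : finType) :=
  | Halt of bool
  | Step of action k G Q
  | Guess of action k G Q & action k G Q.

Record tm := TM {
  (* there are [ntapes.+1] tapes, so at least one *)
  ntapes : nat;
  aux : finType;
  state : finType;
  start : state;
  delta : state -> {ffun 'I_ntapes.+1 -> cell aux} -> instr ntapes aux state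
}.

Definition deterministic (M : tm) : Prop :=
  forall (q : state M) s a0 a1, delta q s <> Guess a0 a1.

Section Tape.
Variable G : finType.

(* A pair (l, r): r is read from the head rightwards, l from the cell left of
   the head leftwards; all remaining cells are blank. *)
Definition tape : Type := (seq (cell G) * seq (cell G))%type.

Definition read (t : tape) : cell G := head None t.2.

Definition write (a : cell G) (t : tape) : tape := (t.1, a :: behead t.2).

Definition shift_head (d : dir) (t : tape) : tape :=
  match d with
  | Left => (behead t.1, head None t.1 :: t.2)
  | Stay => t
  | Right => (head None t.2 :: t.1, behead t.2)
  end.

Definition tape_of (x : word) : tape := ([::], [seq Some (inl b) | b <- x]).

Fixpoint leading_bits (r : seq (cell G)) : word :=
  if r is Some (inl b) :: r' then b :: leading_bits r' else [::].

End Tape.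

Section Run.
Variable M : tm.

Definition config : Type := (state M * {ffun 'I_(ntapes M).+1 -> tape (aux M)})%type.

(* The i-th argument is written on tape i, starting at the head; the other
   tapes are empty.  (Arguments beyond the last tape are lost.) *)
Definition init (args : seq word) : config :=
  (start M, [ffun i : 'I_(ntapes M).+1 => tape_of (aux M) (nth [::] args i)]).

Definition cur_instr (c : config) : instr (ntapes M) (aux M) (state M) :=
  delta c.1 [ffun i => read (c.2 i)].

Definition perform (a : action (ntapes M) (aux M) (state M)) (c : config) :
    config :=
  (a.1, [ffun i => shift_head (a.2 i).2 (write (a.2 i).1 (c.2 i))]).

(* The output is the maximal block of letters that starts at the head of
   tape 0. *)
Definition output (c : config) : word := leading_bits (c.2 ord0).2.

(* [computation c w v c'] : starting from c and guessing successively exactly the bits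
   of w, the machine halts in c' with verdict v. *)
Inductive computation : config -> word -> bool -> config -> Prop :=
  | computation_halt c v : cur_instr c = Halt _ _ _ v -> computation c [::] v c
  | computation_step c a w v c' : cur_instr c = Step a ->
      computation (perform a c) w v c' -> computation c w v c'
  | computation_guess c a0 a1 b w v c' : cur_instr c = Guess a0 a1 ->
      computation (perform (if b then a1 else a0) c) w v c' -> computation c (b :: w) v c'.

(* Whatever is guessed, the machine halts within n steps. *)
Fixpoint halts_within (n : nat) (c : config) : bool :=
  match cur_instr c, n with
  | Halt _, _ => true
  | _, 0 => false
  | Step a, n'.+1 => halts_within n' (perform a c)
  | Guess a0 a1, n'.+1 =>
      halts_within n' (perform a0 c) && halts_within n' (perform a1 c)
  end.

Definition complete_path (args : seq word) (w : word) : Prop :=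
  exists v c, computation (init args) w v c.

Definition accepting_path (args : seq word) (w : word) : Prop :=
  exists c, computation (init args) w true c.

Definition polytime (k : nat) : Prop :=
  exists q : {poly nat}, forall args : k.-tuple word,
    halts_within (peval q (\sum_(a <- args) size a)) (init args).

Definition NPTM : Prop := polytime 1.

Definition balanced (p : {poly nat}) : Prop :=
  forall x w, complete_path [:: x] w <-> size w = peval p (size x).

Definition acc (m : nat) (x : word) : {set m.-tuple bool} :=
  finset (fun w : m.-tuple bool => `[< accepting_path [:: x] w >]).

End Run.

Definition UP : set language :=
  [set A | exists M : tm, [/\ NPTM M,
    forall x w w', accepting_path M [:: x] w -> accepting_path M [:: x] w' ->
      w = w'
    & A = [set x | exists w, accepting_path M [:: x] w]]].

Definition coUP : set language := [set A | UP (~` A)].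

Definition FPt : set (word -> word) :=
  [set g | exists M : tm, [/\ deterministic M, polytime M 1
    & forall x, exists v c, computation (init M [:: x]) [::] v c /\ output c = g x]].

Definition polytime_pred3 : set (word -> word -> word -> Prop) :=
  [set R | exists M : tm, [/\ deterministic M, polytime M 3
    & forall x y z, R x y z <-> accepting_path M [:: x; y; z] [::]]].

(* The order on bool is false < true. *)
Definition lexle (m : nat) (a b : m.-tuple bool) : bool :=
  ((a : m.-tuplelexi bool) <= b)%O.

Definition lexlt (m : nat) (a b : m.-tuple bool) : bool :=
  ((a : m.-tuplelexi bool) < b)%O.

Definition lexsucc (m : nat) (a b : m.-tuple bool) : bool :=
  lexlt a b && [forall c : m.-tuple bool, ~~ (lexlt a c && lexlt c b)].

Definition zeros (m : nat) : m.-tuple bool := [tuple of nseq m false].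
Definition ones (m : nat) : m.-tuple bool := [tuple of nseq m true].

Definition circsucc (m : nat) (a b : m.-tuple bool) : bool :=
  lexsucc a b || ((a == ones m) && (b == zeros m)).

Definition adjacency (adj : forall m, rel (m.-tuple bool))
    (R : word -> word -> word -> Prop) (m : nat) (x : word)
    (h : m.-tuple bool -> m.-tuple bool) : Prop :=
  forall y z : m.-tuple bool, R x y z <-> adj m (h y) (h z).

Definition cluster (M : tm) (f : word -> nat) (m : nat) (x : word)
    (h : m.-tuple bool -> m.-tuple bool) : Prop :=
  f x <> 0 -> exists l u : m.-tuple bool,
    acc M m x = finset (fun w => lexle (h l) (h w) && lexle (h w) (h u)).

(* That B and T have type m.-tuple expresses |b x| = |t x| = m. *)
Definition endpoints (b t : word -> word) (m : nat) (x : word)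
    (h : m.-tuple bool -> m.-tuple bool) : Prop :=
  exists B T : m.-tuple bool,
    [/\ b x = B, t x = T, h B = zeros m & h T = ones m].

Definition CLU : set (word -> nat) :=
  [set f | exists (p : {poly nat}) (M : tm) (b t : word -> word)
                  (R : word -> word -> word -> Prop),
    [/\ NPTM M /\ balanced M p, FPt b, FPt t, polytime_pred3 R
    & forall x, let m := peval p (size x) in
        exists h : m.-tuple bool -> m.-tuple bool,
          [/\ bijective h, endpoints b t x h, adjacency lexsucc R x h,
              cluster M f x h & f x = #|acc M m x| ]]].

Definition CLU_with (adj : forall m, rel (m.-tuple bool)) : set (word -> nat) :=
  [set f | exists (p : {poly nat}) (M : tm) (R : word -> word -> word -> Prop),
    [/\ NPTM M, balanced M p, polytime_pred3 R
    & forall x, let m := peval p (size x) in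
        exists h : m.-tuple bool -> m.-tuple bool,
          [/\ bijective h, adjacency adj R x h,
              cluster M f x h & f x = #|acc M m x| ]]].

Definition CLU_free : set (word -> nat) := CLU_with lexsucc.
Definition CLU_circular : set (word -> nat) := CLU_with circsucc.

(* Main.v *)
(** (2) => (3): given the ends [b x] and [t x], closing the order into a circle costs two
    equality tests, so CLU#P is always contained in the circular class.

    (3) => (1): for a set [A] in UP, the function [1 + [x in A]] is in the free class: order all
    strings that do not encode an accepting path lexicographically, let the last of them count
    as accepting, and put the accepting path, if there is one, behind it.  A circular order for
    the same function yields unique certificates for the complement of [A]: an accepting string
    together with both its neighbours, neither of which is accepting.

    (1) => (2): if UP = coUP, then the statement that a string has no predecessor (no successor)
    in a free order has a unique certificate.  Attach to every string [y] the certified bottom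
    and top of the old order.  The strings that carry correct certificates are chained in the
    old order; this chain is inserted just before the last of all other strings, which are
    ordered lexicographically.  The certificates make the two junctions recognizable, and the
    ends of the new order are fixed strings.

    Turing machines are handled by showing that the polynomial-time functions of several words
    are closed under composition and contain a few transductions, unary multiplication and the
    simulation of a nondeterministic machine along a given guess string. *)

Require Import Defs.
From mathcomp Require Import all_boot all_order all_algebra.
From mathcomp Require Import boolp classical_sets zify.
Import GRing.Theory.
Set Implicit Arguments.
Unset Strict Implicit.
Unset Printing Implicit Defensive.

(** * Machines with functional tapes *)

(** What a free order lacks is evidence for an absent neighbour: being the bottom or the top is a
    universal statement. In a circle every string has two neighbours, so a lone accepting string can
    always be exhibited together with them; the summand 1 in [1 + [x in A]] supplies this string for
    x outside A and keeps the value nonzero, so that the cluster condition is in force. Conversely,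
    predecessors and successors are unique when they exist, so having one is a UP property, and UP =
    coUP turns its negation into a certificate. That the certificates are unique, and not merely
    short, preserves the number of accepting strings: each old string has exactly one valid
    extension. All other strings of the new length must still occur in the order; as fillers they
    are arranged so that their adjacency is decided without search. Tapes are indexed by arbitrary
    finite types, so that machines are combined by sums of index types; tapes get numbers only when
    a Turing machine in the sense of the definitions is produced. *)

Inductive minstr (A : Type) := MHalt of bool | MStep of A | MGuess of (bool -> A).
Arguments MHalt {A}.

Section Tapes.
Variable G : finType.
Local Open Scope ring_scope.

(* Position [0] is the head.  Functions identify the representations of a tape that differ in
   trailing blanks. *)
Definition atape := int -> cell G.

Definition blank : atape := fun _ => None.

Definition shift (k : int) (t : atape) : atape := fun i => t (i + k).

Definition offset (d : dir) : int :=
  match d with Left => -1 | Stay => 0 | Right => 1 end.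

(** Coordinates are relative to the new head position, where the cell just written has index
    [- offset a.2]. *)
Definition act (a : cell G * dir) (t : atape) : atape :=
  fun i => if i + offset a.2 == 0 then a.1 else t (i + offset a.2).

Definition atape_of (t : tape G) : atape := fun i =>
  match i with Posz n => nth None t.2 n | Negz n => nth None t.1 n end.

Definition wtape (w : word) : atape := atape_of (tape_of G w).

Lemma atape_of_act a d t :
  atape_of (shift_head d (write a t)) = act (a, d) (atape_of t).
Proof.
apply/funext => i; rewrite /act [in RHS]/offset [(a, d).1]/= [(a, d).2]/=.
case: t => l r; case: d.
- case: i => [[|n]|n].
  + by rewrite add0r /=; case: l.
  + have -> : (n.+1%:Z + -1 = n)%R by lia.
    by case: n => [|n] //=; rewrite nth_behead.
  + have -> : (Negz n + -1 = Negz n.+1)%R by lia.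
    by rewrite /= nth_behead.
- by rewrite addr0; case: i => [[|n]|n] //=; rewrite nth_behead.
- case: i => [n|[|n]] //.
  + have -> : (n%:Z + 1 = n.+1)%R by lia.
    by rewrite /= nth_behead.
  + have -> : (Negz n.+1 + 1 = Negz n)%R by lia.
    by [].
Qed.

Lemma atape_of0 t : atape_of t 0 = read t.
Proof. by case: t => l []. Qed.

Lemma act_id t : act (t 0, Stay) t = t.
Proof. by apply/funext => i; rewrite /act /= addr0; case: eqP => [->|]. Qed.

Lemma act_shift (k : int) d t :
  act (t k, d) (shift k t) = shift (k + offset d) t.
Proof.
apply/funext => i; rewrite /act /shift /=.
by case: eqP => [ei|_]; congr t; lia.
Qed.

Arguments wtape : simpl never.

Lemma wtapeE w (n : nat) :
  wtape w n = if (n < size w)%N then Some (inl (nth false w n)) else None.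
Proof.
rewrite /wtape /=; case: ltnP => h; first by rewrite (nth_map false).
by rewrite nth_default // size_map.
Qed.

Lemma wtapeN w (n : nat) : wtape w (Negz n) = None.
Proof. by rewrite /wtape /= nth_nil. Qed.

Lemma wtape_nil : wtape [::] = blank.
Proof.
by apply/funext => -[n|n]; rewrite ?wtapeN ?wtapeE.
Qed.

Lemma shift0 t : shift 0 t = t.
Proof. by apply/funext => i; rewrite /shift addr0. Qed.

Definition is_bit (c : cell G) : bool := if c is Some (inl _) then true else false.

(** Nothing is asked of the cells left of the head or beyond the one that ends the word, so a
    subroutine may leave scratch work there. The ending cell may hold an auxiliary symbol, as for
    [leading_bits]. *)
Definition shows (t : atape) (w : word) : Prop :=
  (forall j : nat, (j < size w)%N -> t j = Some (inl (nth false w j))) /\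
  ~~ is_bit (t (size w)).

Lemma shows_wtape w : shows (wtape w) w.
Proof.
split=> [j jw|]; first by rewrite wtapeE jw.
by rewrite wtapeE ltnn.
Qed.

Lemma shows_leading_bits t : shows (atape_of t) (leading_bits t.2).
Proof.
case: t => l r; rewrite /shows /=; elim: r => [|[[b|g]|] r [IH1 IH2]] //=.
by split=> // -[|j] //=; apply: IH1.
Qed.

Lemma shows_unique t w w' : shows t w -> shows t w' -> w = w'.
Proof.
move=> [h1 h2] [h1' h2'].
have es : size w = size w'.
  case: (ltngtP (size w) (size w')) => // h.
  - by move: h2; rewrite h1'.
  - by move: h2'; rewrite h1.
apply: (@eq_from_nth _ false) => // i iw.
by have := h1 i iw; rewrite h1' -?es // => -[].
Qed.

End Tapes.

Arguments blank {G}.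

(** * Machines over an arbitrary finite set of tapes *)

Section Mach.
Variables I G : finType.

Record mach := Mach {
  mstate : finType;
  mstart : mstate;
  mdelta : mstate -> (I -> cell G) -> minstr (mstate * (I -> cell G * dir))
}.

Definition tapes := I -> atape G.

Definition heads (t : tapes) : I -> cell G := fun i => t i 0%R.

Definition mperform (M : mach) (a : mstate M * (I -> cell G * dir)) (t : tapes) :=
  (a.1, fun i => act (a.2 i) (t i)).

Inductive reach (M : mach) : nat -> mstate M * tapes -> word -> mstate M * tapes -> Prop :=
  | reach_refl c : reach 0 c [::] c
  | reach_step n c a w c' : mdelta c.1 (heads c.2) = MStep a ->
      reach n (mperform a c.2) w c' -> reach n.+1 c w c'
  | reach_guess n c a b w c' : mdelta c.1 (heads c.2) = MGuess a ->
      reach n (mperform (a b) c.2) w c' -> reach n.+1 c (b :: w) c'.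

Definition runs (M : mach) n (t : tapes) w v (t' : tapes) : Prop :=
  exists2 q, @reach M n (mstart M, t) w (q, t') & mdelta q (heads t') = MHalt v.

Definition mdet (M : mach) : Prop := forall (q : mstate M) r a, mdelta q r <> MGuess a.

Lemma reach_cat (M : mach) n1 n2 (c1 c2 c3 : mstate M * tapes) w1 w2 :
  reach n1 c1 w1 c2 -> reach n2 c2 w2 c3 -> reach (n1 + n2) c1 (w1 ++ w2) c3.
Proof.
elim=> [c|n c a w c' e _ IH|n c a b w c' e _ IH] // /IH h.
- by rewrite addSn; apply: reach_step e h.
- by rewrite addSn; apply: reach_guess e h.
Qed.

Lemma reach_cat0 (M : mach) n1 n2 (c1 c2 c3 : mstate M * tapes) w2 :
  reach n1 c1 [::] c2 -> reach n2 c2 w2 c3 -> reach (n1 + n2) c1 w2 c3.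
Proof. exact: reach_cat. Qed.

Lemma reach1 (M : mach) (c : mstate M * tapes) a :
  mdelta c.1 (heads c.2) = MStep a -> reach 1 c [::] (mperform a c.2).
Proof. by move=> e; apply: reach_step e (reach_refl _). Qed.

(** That the last configuration halts excludes the empty run whenever the first one does not
    halt. *)
Lemma reach_inv (M : mach) n (c c' : mstate M * tapes) w v :
  reach n c w c' -> mdelta c'.1 (heads c'.2) = MHalt v ->
  match mdelta c.1 (heads c.2) with
  | MHalt _ => True
  | MStep a => exists2 k, n = k.+1 & reach k (mperform a c.2) w c'
  | MGuess a => exists k b u, [/\ n = k.+1, w = b :: u & reach k (mperform (a b) c.2) u c']
  end.
Proof.
case=> [d -> //|k d a u d' e r _|k d a b u d' e r _]; rewrite e; first by exists k.
by exists k, b, u.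
Qed.

(** The verdict of [M1] is discarded. Control passes in one extra step, which writes back what the
    heads read. *)
Definition mseq (M1 M2 : mach) : mach :=
  @Mach (mstate M1 + mstate M2)%type (inl (mstart M1)) (fun q r =>
    match q with
    | inl q1 => match mdelta q1 r with
        | MHalt _ => MStep (inr (mstart M2), fun i => (r i, Stay))
        | MStep a => MStep (inl a.1, a.2)
        | MGuess a => MGuess (fun b => (inl (a b).1, (a b).2))
        end
    | inr q2 => match mdelta q2 r with
        | MHalt v => MHalt v
        | MStep a => MStep (inr a.1, a.2)
        | MGuess a => MGuess (fun b => (inr (a b).1, (a b).2))
        end
    end).

Lemma reach_mseql M1 M2 n c w c' : @reach M1 n c w c' ->
  @reach (mseq M1 M2) n (inl c.1, c.2) w (inl c'.1, c'.2).
Proof.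
elim=> [{}c|{}n {}c a {}w {}c' e _ IH|{}n {}c a b {}w {}c' e _ IH].
- exact: reach_refl.
- refine (@reach_step (mseq M1 M2) n (inl c.1, c.2) (inl a.1, a.2) w _ _ IH).
  by rewrite /= e.
- refine (@reach_guess (mseq M1 M2) n (inl c.1, c.2)
    (fun b => (inl (a b).1, (a b).2)) b w _ _ IH).
  by rewrite /= e.
Qed.

Lemma reach_mseqr M1 M2 n c w c' : @reach M2 n c w c' ->
  @reach (mseq M1 M2) n (inr c.1, c.2) w (inr c'.1, c'.2).
Proof.
elim=> [{}c|{}n {}c a {}w {}c' e _ IH|{}n {}c a b {}w {}c' e _ IH].
- exact: reach_refl.
- refine (@reach_step (mseq M1 M2) n (inr c.1, c.2) (inr a.1, a.2) w _ _ IH).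
  by rewrite /= e.
- refine (@reach_guess (mseq M1 M2) n (inr c.1, c.2)
    (fun b => (inr (a b).1, (a b).2)) b w _ _ IH).
  by rewrite /= e.
Qed.

Lemma runs_mseq M1 M2 n1 n2 t1 t2 t3 w1 w2 v1 v2 :
  runs M1 n1 t1 w1 v1 t2 -> runs M2 n2 t2 w2 v2 t3 ->
  runs (mseq M1 M2) (n1 + n2.+1) t1 (w1 ++ w2) v2 t3.
Proof.
move=> [q1 r1 h1] [q2 r2 h2]; exists (inr q2); last by rewrite /= h2.
apply: reach_cat (reach_mseql M2 r1) _.
refine (@reach_step (mseq M1 M2) n2 (inl q1, t2)
  (inr (mstart M2), fun i => (heads t2 i, Stay)) w2 (inr q2, t3) _ _).
  by rewrite /= h1.
have := reach_mseqr M1 r2; congr reach; rewrite /mperform /=; congr pair.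
by apply/funext => i; rewrite act_id.
Qed.

Lemma mdet_mseq M1 M2 : mdet M1 -> mdet M2 -> mdet (mseq M1 M2).
Proof.
move=> d1 d2 [q|q] r a /=.
- by case e: (mdelta q r) => // _; case: (d1 _ _ _ e).
- by case e: (mdelta q r) => // _; case: (d2 _ _ _ e).
Qed.

End Mach.

(** * Running a machine on part of the tapes and symbols of a larger one *)

Section Lift.
Variables (I J G H : finType) (e : J -> I) (g : H -> G).
Hypotheses (einj : injective e) (ginj : injective g).

Definition lift_cell (c : cell H) : cell G :=
  match c with
  | Some (inr h) => Some (inr (g h))
  | Some (inl b) => Some (inl b)
  | None => None
  end.

(** A symbol outside the image of [g] is read as a blank; on the tapes that [put] fills such symbols
    never occur. *)
Definition unlift_cell (c : cell G) : cell H :=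
  match c with
  | Some (inr x) => if [pick h | g h == x] is Some h then Some (inr h) else None
  | Some (inl b) => Some (inl b)
  | None => None
  end.

Lemma lift_cellK : cancel lift_cell unlift_cell.
Proof.
case=> [[b|h]|] //=; case: pickP => [h' /eqP/ginj -> //|].
by move/(_ h); rewrite eqxx.
Qed.

Definition unindex (i : I) : option J := [pick j | e j == i].

Lemma indexK j : unindex (e j) = Some j.
Proof.
rewrite /unindex; case: pickP => [j' /eqP/einj -> //|].
by move/(_ j); rewrite eqxx.
Qed.

Lemma unindexP i : (exists2 j, i = e j & unindex i = Some j) \/
  ((forall j, i <> e j) /\ unindex i = None).
Proof.
rewrite /unindex; case: pickP => [j /eqP <-|h]; first by left; exists j.
by right; split=> // j ej; have := h j; rewrite ej eqxx.
Qed.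

Definition put (T : tapes I G) (t : tapes J H) : tapes I G := fun i =>
  if unindex i is Some j then fun k => lift_cell (t j k) else T i.

Lemma put_in T t j : put T t (e j) = fun k => lift_cell (t j k).
Proof. by rewrite /put indexK. Qed.

Lemma put_out T t i : (forall j, i <> e j) -> put T t i = T i.
Proof. by rewrite /put; case: (unindexP i) => [[j -> _ /(_ j)]|[_ ->]]. Qed.

Definition lift_action (r : I -> cell G) (a : J -> cell H * dir) (i : I) : cell G * dir :=
  if unindex i is Some j then (lift_cell (a j).1, (a j).2) else (r i, Stay).

Definition lift (M : mach J H) : mach I G :=
  @Mach I G (mstate M) (mstart M) (fun q r =>
    match mdelta q (fun j => unlift_cell (r (e j))) with
    | MHalt v => MHalt v
    | MStep a => MStep (a.1, lift_action r a.2)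
    | MGuess a => MGuess (fun b => ((a b).1, lift_action r (a b).2))
    end).

Lemma heads_put T t : (fun j => unlift_cell (heads (put T t) (e j))) = heads t.
Proof. by apply/funext => j; rewrite /heads put_in lift_cellK. Qed.

Lemma act_put T t (a : J -> cell H * dir) :
  (fun i => act (lift_action (heads (put T t)) a i) (put T t i)) =
  put T (fun j => act (a j) (t j)).
Proof.
apply/funext => i; rewrite /lift_action /heads /put.
case: (unindexP i) => [[j _ ->]|[_ ->]]; last by rewrite act_id.
by apply/funext => k; rewrite /act /=; case: eqP.
Qed.

Lemma reach_lift M T n c w c' : @reach J H M n c w c' ->
  @reach I G (lift M) n (c.1, put T c.2) w (c'.1, put T c'.2).
Proof.
elim=> [{}c|{}n {}c a {}w {}c' ea _ IH|{}n {}c a b {}w {}c' ea _ IH].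
- exact: reach_refl.
- refine (@reach_step I G (lift M) n (c.1, put T c.2)
    (a.1, lift_action (heads (put T c.2)) a.2) w _ _ _).
    by rewrite /= heads_put ea.
  by rewrite /mperform /= act_put.
- refine (@reach_guess I G (lift M) n (c.1, put T c.2)
    (fun b => ((a b).1, lift_action (heads (put T c.2)) (a b).2)) b w _ _ _).
    by rewrite /= heads_put ea.
  by rewrite /mperform /= act_put.
Qed.

Lemma runs_lift M T n t w v t' :
  runs M n t w v t' -> runs (lift M) n (put T t) w v (put T t').
Proof.
case=> q r h; exists (q : mstate (lift M)); last by rewrite /= heads_put h.
exact: (reach_lift T r).
Qed.

Lemma mdet_lift M : mdet M -> mdet (lift M).
Proof. by move=> d q r a /=; case ed: mdelta => // _; case: (d _ _ _ ed). Qed.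

Lemma shows_lift t w : shows t w -> shows (fun k => lift_cell (t k)) w.
Proof.
case=> h1 h2; split=> [j /h1 -> //|].
by move: h2; case: (t _) => [[]|].
Qed.

Lemma lift_wtape w : (fun k => lift_cell (wtape H w k)) = wtape G w.
Proof.
by apply/funext => -[n|n]; rewrite ?wtapeN // !wtapeE; case: ifP.
Qed.

End Lift.

(** * Polynomial bounds *)

Section Poly.
Local Open Scope ring_scope.
Lemma pevalD (p q : {poly nat}) n : peval (p + q) n = (peval p n + peval q n)%N.
Proof. exact: hornerD. Qed.

Lemma pevalM (p q : {poly nat}) n : peval (p * q) n = (peval p n * peval q n)%N.
Proof. exact: hornerM. Qed.

Lemma peval_comp (p q : {poly nat}) n : peval (p \Po q) n = peval p (peval q n).
Proof. exact: horner_comp. Qed.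

Lemma pevalX n : peval 'X n = n.
Proof. exact: hornerX. Qed.

Lemma pevalC c n : peval c%:P n = c.
Proof. exact: hornerC. Qed.

Lemma peval_MXaddC (p : {poly nat}) c n :
  peval (p * 'X + c%:P) n = (peval p n * n + c)%N.
Proof. by rewrite pevalD pevalM pevalX pevalC. Qed.

(** Natural coefficients make every polynomial monotone, so a length may be replaced by any upper
    bound for it. *)
Lemma leq_peval (p : {poly nat}) m n :
  (m <= n)%N -> (peval p m <= peval p n)%N.
Proof.
move=> mn; elim/poly_ind: p => [|p c IH]; first by rewrite /peval !horner0.
by rewrite !peval_MXaddC leq_add2r leq_mul.
Qed.
End Poly.

(** * Copying a word between tapes *)

Section Copy.
Variables I G : finType.
Implicit Types t : tapes I G.

Definition mhalt : mach I G := @Mach I G unit tt (fun _ _ => MHalt true).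

Lemma runs_mhalt t : runs mhalt 0 t [::] true t.
Proof. by exists tt => //; apply: reach_refl. Qed.

Definition mset t i (u : atape G) : tapes I G := fun j => if j == i then u else t j.

Definition aset (u : atape G) (k : int) c : atape G := fun j => if j == k then c else u j.

(** Trades head-relative coordinates for absolute ones: the head stands at [k], one cell of a fixed
    tape changes, and only the shift moves. Loop invariants are stated in this form. *)
Lemma act_shiftE (k : int) a (u : atape G) :
  act a (shift k u) = shift (k + offset a.2)%R (aset u k a.1).
Proof.
apply/funext => i; rewrite /act /shift /aset.
have -> : (i + offset a.2 == 0)%R = (i + (k + offset a.2) == k)%R by lia.
by case: eqP => // _; congr u; lia.
Qed.

Lemma aset_id (u : atape G) k : aset u k (u k) = u.
Proof. by apply/funext => i; rewrite /aset; case: eqP => [->|]. Qed.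

Variables src dst : I.

(* [Some true]: copying; [Some false]: rewinding; [None]: done *)
Definition mcopy : mach I G :=
  @Mach I G (option bool) (Some true) (fun q r =>
    let go c d := fun i => if i == dst then (c, d) else
                           if i == src then (r src, d) else (r i, Stay) in
    match q with
    | Some true => if is_bit (r src) then MStep (Some true, go (r src) Right)
                   else MStep (Some false, go None Left)
    | Some false => if is_bit (r dst) then MStep (Some false, go (r dst) Left)
                    else MStep (None, go (r dst) Right)
    | None => MHalt true
    end).

Lemma mdet_mcopy : mdet mcopy.
Proof. by move=> [[]|] r a //=; case: ifP. Qed.

(** The effect of a copy onto a tape that is already in use: the blank after [w] cuts off the
    remains of the old content. This matters when an output replaces the input on tape 0. *)
Definition overwrite (w : word) (u : atape G) : atape G := fun i =>
  match i with
  | Posz n => if n < size w then Some (inl (nth false w n)) else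
              if n == size w then None else u n
  | Negz n => u (Negz n)
  end.

Lemma overwrite_blank w : overwrite w blank = wtape G w.
Proof.
apply/funext => -[n|n]; last by rewrite wtapeN.
by rewrite wtapeE /=; case: ltnP => //; case: eqP.
Qed.

Lemma shows_overwrite w u : shows (overwrite w u) w.
Proof.
split=> [j jw|] /=; first by rewrite jw.
by rewrite ltnn eqxx.
Qed.

Hypothesis sd : src != dst.

Definition moved k (T : tapes I G) : tapes I G := fun i =>
  if (i == src) || (i == dst) then shift k (T i) else T i.

Lemma moved_dst k T : moved k T dst = shift k (T dst).
Proof. by rewrite /moved eqxx orbT. Qed.

Lemma moved_src k T : moved k T src = shift k (T src).
Proof. by rewrite /moved eqxx. Qed.

Lemma moved0 T : moved 0 T = T.
Proof. by apply/funext => i; rewrite /moved shift0; case: ifP. Qed.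

Lemma act_moved (k : int) T c d :
  (fun i => act (if i == dst then (c, d) else
                if i == src then (heads (moved k T) src, d)
                else (heads (moved k T) i, Stay)) (moved k T i)) =
  moved (k + offset d)%R (mset T dst (aset (T dst) k c)).
Proof.
apply/funext => i; case: (altP (i =P dst)) => [->|nd].
  by rewrite !moved_dst act_shiftE /mset eqxx.
case: (altP (i =P src)) => [->|ns]; last first.
  by rewrite act_id /moved /mset (negbTE ns) (negbTE nd).
by rewrite /heads !moved_src act_shiftE /shift /= add0r aset_id /mset (negbTE sd).
Qed.

(** No marker is set at the start of [dst]; the rewinding loop stops because the cell to its left,
    at index [Negz 0], holds no letter. Each direction takes [size w] steps, and there is one step
    for each turn. *)
Lemma runs_mcopy t w : shows (t src) w -> ~~ is_bit (t dst (Negz 0)) ->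
  runs mcopy (2 * size w + 2) t [::] true (mset t dst (overwrite w (t dst))).
Proof.
move=> [ws we] dN.
pose mid k : tapes I G := mset t dst (fun i => match i with
  | Posz n => if n < k then Some (inl (nth false w n)) else t dst n
  | Negz n => t dst (Negz n) end).
pose fin : tapes I G := mset t dst (overwrite w (t dst)).
have srcE T u : mset T dst u src = T src by rewrite /mset (negbTE sd).
have dstE T u : mset T dst u dst = u by rewrite /mset eqxx.
(* Copying loop: after [k] steps both heads stand at position [k]. *)
have forth k : k <= size w ->
    @reach I G mcopy k (Some true, t) [::] (Some true, moved k (mid k)).
  elim: k => [_|k IH kw].
    have -> : mid 0 = t.
      apply/funext => i; rewrite /mid /mset; case: eqP => // ->.
      by apply/funext => -[n|n].
    rewrite moved0; exact: reach_refl.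
  rewrite -addn1; apply: reach_cat0 (IH (ltnW kw)) _.
  have hs : heads (moved k (mid k)) src = Some (inl (nth false w k)).
    by rewrite /heads moved_src /mid srcE /shift add0r ws.
  have := @reach1 I G mcopy (Some true, moved k (mid k)) _ _.
  rewrite /= hs /= => /(_ _ erefl); rewrite /mperform /=.
  have := act_moved k (mid k) (Some (inl (nth false w k))) Right; rewrite hs => ->.
  congr reach; congr pair; rewrite addn1; congr moved; first by rewrite /=; lia.
  apply/funext => i; rewrite /mid /mset eqxx; case: (i == dst) => //.
  apply/funext => -[n|n]; rewrite /aset //.
  rewrite ltnS.
  have -> : (Posz n == Posz k) = (n == k) by [].
  by case: (ltngtP n k) => [||->].
(* Rewinding loop: both heads go back together and overshoot to [-1], where the missing letter is
   noticed. *)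
have back k : k <= size w ->
    @reach I G mcopy k (Some false, moved (k%:Z - 1)%R fin) [::]
      (Some false, moved (-1)%R fin).
  elim: k => [_|k IH kw]; first by rewrite sub0r; exact: reach_refl.
  rewrite -add1n; apply: reach_cat0 (IH (ltnW kw)).
  have hd : heads (moved (k.+1%:Z - 1)%R fin) dst = Some (inl (nth false w k)).
    rewrite /heads moved_dst /fin dstE /shift add0r.
    have -> : (k.+1%:Z - 1 = k)%R by lia.
    by rewrite /= kw.
  have := @reach1 I G mcopy (Some false, moved (k.+1%:Z - 1)%R fin) _ _.
  rewrite [mdelta _ _]/= hd [is_bit _]/= => /(_ _ erefl).
  rewrite /mperform.
  have := act_moved (k.+1%:Z - 1)%R fin (Some (inl (nth false w k))) Left.
  rewrite [X in _ -> X]/= => ->.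
  congr reach; congr pair; congr moved; first by rewrite /=; lia.
  apply/funext => i; rewrite /fin /mset eqxx; case: (i == dst) => //.
  have -> : (k.+1%:Z - 1 = k)%R by lia.
  have <- : overwrite w (t dst) k = Some (inl (nth false w k)) by rewrite /= kw.
  by rewrite aset_id.
have turn : @reach I G mcopy 1 (Some true, moved (size w) (mid (size w))) [::]
    (Some false, moved ((size w)%:Z - 1)%R fin).
  have hs : is_bit (heads (moved (size w) (mid (size w))) src) = false.
    by rewrite /heads moved_src /mid srcE /shift add0r (negbTE we).
  have := @reach1 I G mcopy (Some true, moved (size w) (mid (size w))) _ _.
  rewrite [mdelta _ _]/= hs => /(_ _ erefl); rewrite /mperform.
  have := act_moved (size w) (mid (size w)) None Left.
  rewrite [X in _ -> X]/= => ->.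
  congr reach; congr pair; congr moved.
  apply/funext => i; rewrite /fin /mid /mset eqxx; case: (i == dst) => //.
  apply/funext => -[n|n]; rewrite /aset //=.
  have -> : (Posz n == Posz (size w)) = (n == size w) by [].
  by case: ltngtP.
have stop : @reach I G mcopy 1 (Some false, moved (-1)%R fin) [::] (None, fin).
  have hd : heads (moved (-1)%R fin) dst = t dst (Negz 0).
    by rewrite /heads moved_dst /fin dstE /shift add0r.
  have := @reach1 I G mcopy (Some false, moved (-1)%R fin) _ _.
  rewrite [mdelta _ _]/= hd (negbTE dN) => /(_ _ erefl); rewrite /mperform.
  have := act_moved (-1)%R fin (t dst (Negz 0)) Right.
  rewrite [X in _ -> X]/= => ->.
  congr reach; congr pair; rewrite -[RHS]moved0; congr moved.
  apply/funext => i; rewrite /fin /mset eqxx; case: (i == dst) => //.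
  by apply/funext => -[n|[|n]].
exists (None : mstate mcopy) => //.
have := reach_cat0 (forth _ (leqnn _)) (reach_cat0 turn (reach_cat0 (back _ (leqnn _)) stop)).
by congr reach; lia.
Qed.

End Copy.

(** * Polynomial-time functions of several words *)

Definition total (a : seq word) : nat := \sum_(w <- a) size w.

Lemma total_cons w a : total (w :: a) = size w + total a.
Proof. by rewrite /total big_cons. Qed.

Lemma size_nth_total a i : size (nth [::] a i) <= total a.
Proof.
elim: a i => [|w a IH] [|i] //=; rewrite total_cons ?leq_addr //.
exact: leq_trans (IH i) (leq_addl _ _).
Qed.

Lemma total_le a B : (forall w, w \in a -> size w <= B) -> total a <= size a * B.
Proof.
elim: a => [|w a IH] h; first by rewrite /total big_nil.
rewrite total_cons mulSn leq_add ?h ?mem_head ?IH // => v va.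
by rewrite h // inE va orbT.
Qed.

Definition load k (J G : finType) (a : seq word) : tapes ('I_k + J)%type G := fun i =>
  match i with inl j => wtape G (nth [::] a j) | inr _ => blank end.

Arguments load {k J G} a.

Definition computes k (J G : finType) (M : mach ('I_k + J)%type G) (q : {poly nat})
    (a : seq word) (P : bool -> tapes ('I_k + J)%type G -> Prop) : Prop :=
  exists n v t, [/\ n <= peval q (total a), runs M n (@load k J G a) [::] v t & P v t].

(** Only argument lists of length [k] matter. The bound on the length of the value is a separate
    clause because a composition needs it to bound the time of the next call. *)
Definition FP k (F : seq word -> word) : Prop :=
  exists (J G : finType) (M : mach ('I_k + J)%type G) (out : 'I_k + J) (q : {poly nat}),
  mdet M /\ forall a, size a = k ->
    size (F a) <= peval q (total a) /\ computes M q a (fun _ t => shows (t out) (F a)).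

(** After one run, [N] words can be read on tapes at the same time. This is the invariant for
    evaluating several inner functions one after another without losing earlier values. *)
Definition env k N (rs : seq word -> nat -> word) : Prop :=
  exists (J G : finType) (M : mach ('I_k + J)%type G) (reg : nat -> 'I_k + J) (q : {poly nat}),
  mdet M /\ forall a, size a = k ->
    (forall j, j < N -> size (rs a j) <= peval q (total a)) /\
    computes M q a (fun _ t => forall j, j < N -> shows (t (reg j)) (rs a j)).

Lemma FP_ext k F F' : (forall a, size a = k -> F a = F' a) -> FP k F -> FP k F'.
Proof.
move=> e [J [G [M [out [q [d h]]]]]]; exists J, G, M, out, q; split=> // a ak.
by rewrite -e //; apply: h.
Qed.

Lemma env_ext k N rs rs' : (forall a j, size a = k -> j < N -> rs a j = rs' a j) ->
  env k N rs -> env k N rs'.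
Proof.
move=> e [J [G [M [reg [q [d h]]]]]]; exists J, G, M, reg, q; split=> // a ak.
have [h1 [n [v [t [h2 h3 h4]]]]] := h a ak.
split=> [j jN|]; first by rewrite -e //; apply: h1.
by exists n, v, t; split=> // j jN; rewrite -e //; apply: h4.
Qed.

Lemma FP_of_env k N rs j : j < N -> env k N rs -> FP k (fun a => rs a j).
Proof.
move=> jN [J [G [M [reg [q [d h]]]]]]; exists J, G, M, (reg j), q; split=> // a ak.
have [h1 [n [v [t [h2 h3 h4]]]]] := h a ak; split; first exact: h1.
by exists n, v, t; split=> //; apply: h4.
Qed.

Lemma env_args k : env k k (nth [::]).
Proof.
exists unit, void, (mhalt _ _), (fun j => if insub j is Some i then inl i else inr tt), 'X%R.
split=> // a ak; split=> [j jk|]; first by rewrite pevalX size_nth_total.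
exists 0, true, (@load k _ _ a); split=> //; first exact: runs_mhalt.
by move=> j jk; rewrite insubT /=; apply: shows_wtape.
Qed.

Section Copies.
Variables I G : finType.

Fixpoint mcopies (l : seq (I * I)) : mach I G :=
  if l is p :: l' then mseq (mcopy G p.1 p.2) (mcopies l') else mhalt I G.

Lemma mdet_mcopies l : mdet (mcopies l).
Proof. by elim: l => [|p l IH] //; apply: mdet_mseq => //; apply: mdet_mcopy. Qed.

(** Each copy costs at most [2 * B + 2] steps and one more for the transition in [mseq].
    Distinctness of the tapes ensures that no copy disturbs another. *)
Lemma runs_mcopies (src dst : nat -> I) (w : nat -> word) B s n (t : tapes I G) :
    (forall i j, s <= i < s + n -> s <= j < s + n -> dst i = dst j -> i = j) ->
    (forall i j, s <= i < s + n -> s <= j < s + n -> src i != dst j) ->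
    (forall i, s <= i < s + n -> shows (t (src i)) (w i)) ->
    (forall i, s <= i < s + n -> t (dst i) = blank) ->
    (forall i, s <= i < s + n -> size (w i) <= B) ->
  exists m t', [/\ m <= n * (2 * B + 3),
    runs (mcopies [seq (src i, dst i) | i <- iota s n]) m t [::] true t',
    (forall i, s <= i < s + n -> t' (dst i) = wtape G (w i)) &
    (forall x, (forall i, s <= i < s + n -> x <> dst i) -> t' x = t x)].
Proof.
elim: n s t => [|n IH] s t dinj sd tw tb wB.
  exists 0, t; split=> //; first exact: runs_mhalt.
  by move=> i; lia.
have s_in : s <= s < s + n.+1 by lia.
pose t1 := mset t (dst s) (wtape G (w s)).
have r1 : runs (mcopy G (src s) (dst s)) (2 * size (w s) + 2) t [::] true t1.
  have := @runs_mcopy I G (src s) (dst s) (sd _ _ s_in s_in) t (w s) (tw s s_in).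
  by rewrite (tb _ s_in) overwrite_blank; apply.
have up i : s.+1 <= i < s.+1 + n -> s <= i < s + n.+1 by lia.
have t1E x : x <> dst s -> t1 x = t x by rewrite /t1 /mset => /eqP/negbTE ->.
have ne i : s.+1 <= i < s.+1 + n -> dst i <> dst s.
  by move=> hi /(dinj _ _ (up _ hi) s_in); lia.
have [|||||m [t2 [hm r2 h1 h2]]] := IH s.+1 t1.
- by move=> i j /up hi /up hj; apply: dinj.
- by move=> i j /up hi /up hj; apply: sd.
- move=> i /up hi; rewrite t1E; first exact: tw.
  by apply/eqP; apply: sd.
- by move=> i hi; rewrite t1E; [apply/tb/up | apply: ne].
- by move=> i /up; apply: wB.
exists (2 * size (w s) + 2 + m.+1), t2; split.
- by have := wB s s_in; rewrite mulSn; lia.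
- exact: (runs_mseq r1 r2).
- move=> i hi; have [si|si] : s < i \/ i = s by lia.
    by apply: h1; lia.
  rewrite {}si h2; first by rewrite /t1 /mset eqxx.
  by move=> j hj e; case: (ne j hj).
- move=> x hx; rewrite h2; first by rewrite t1E //; apply: hx.
  by move=> i /up; apply: hx.
Qed.

End Copies.

Lemma inl_injective (A B : Type) : injective (@inl A B).
Proof. by move=> x y []. Qed.

Lemma inr_injective (A B : Type) : injective (@inr A B).
Proof. by move=> x y []. Qed.

(** * Subroutine calls *)

Section Call.
Variables (k n : nat) (J JF G GF : finType).
Let I := ('I_k + (J + ('I_n + JF)))%type.

Definition old_tape (i : 'I_k + J) : I :=
  match i with inl j => inl j | inr x => inr (inl x) end.

Definition new_tape (i : 'I_n + JF) : I := inr (inr i).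

Lemma old_tape_inj : injective old_tape.
Proof. by move=> [x|x] [y|y] //= [->]. Qed.

Lemma new_tape_inj : injective new_tape.
Proof. by move=> x y []. Qed.

Variables (M : mach ('I_k + J)%type G) (MF : mach ('I_n + JF)%type GF).
Variable src : nat -> 'I_k + J.

Definition arg_tape (i : nat) : I :=
  if insub i is Some j then new_tape (inl j) else old_tape (src i).

Definition call : mach I (G + GF)%type :=
  mseq (lift old_tape inl M)
    (mseq (mcopies _ [seq (old_tape (src i), arg_tape i) | i <- iota 0 n])
          (lift new_tape inr MF)).

Lemma mdet_call : mdet M -> mdet MF -> mdet call.
Proof.
move=> d dF; apply: mdet_mseq; first exact: mdet_lift.
by apply: mdet_mseq; [apply: mdet_mcopies | apply: mdet_lift].
Qed.

(** The callee owns fresh tapes. They are still blank when its arguments arrive, so it starts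
    exactly from [load], and whatever the caller had computed survives. The final [2] counts the two
    transitions in [mseq]. *)
Lemma runs_call a m v t (w : nat -> word) B mF vF tF :
  runs M m (@load k J G a) [::] v t ->
  (forall i, i < n -> shows (t (src i)) (w i)) ->
  (forall i, i < n -> size (w i) <= B) ->
  runs MF mF (@load n JF GF (mkseq w n)) [::] vF tF ->
  exists m' t', [/\ m' <= m + n * (2 * B + 3) + mF + 2,
    runs call m' (@load k _ _ a) [::] vF t',
    forall i u, shows (t i) u -> shows (t' (old_tape i)) u &
    forall i u, shows (tF i) u -> shows (t' (new_tape i)) u].
Proof.
move=> r1 tw wB rF.
have r1' := runs_lift old_tape_inj (@inl_injective G GF) (fun _ => blank) r1.
set t0 := put _ _ _ t in r1'.
have t0_new i : t0 (new_tape i) = blank by rewrite /t0 put_out // => -[].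
have argE i (h : i < n) : arg_tape i = new_tape (inl (Ordinal h)) by rewrite /arg_tape insubT.
have [|||||m2 [t2 [hm2 r2 h1 h2]]] := @runs_mcopies I (G + GF)%type
    (old_tape \o src) arg_tape w B 0 n t0.
- by move=> i j /= hi hj; rewrite !argE => -[].
- by move=> i j /= hi hj; rewrite !argE; case: (src i).
- move=> i /= hi; rewrite /t0 put_in; last exact: old_tape_inj.
  exact/shows_lift/tw.
- by move=> i /= hi; rewrite argE t0_new.
- exact: wB.
have r3 := runs_lift new_tape_inj (@inr_injective G GF) t2 rF.
set t3 := put _ _ _ tF in r3.
(* The copies have produced the callee's start configuration, so putting it there changes
   nothing. *)
have et2 : put new_tape inr t2 (@load n JF GF (mkseq w n)) = t2.
  apply/funext => i; case: (unindexP new_tape i) => [[j -> _]|[ni _]]; last first.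
    by rewrite put_out.
  rewrite put_in; last exact: new_tape_inj.
  case: j => [j|j] /=.
    have jn := ltn_ord j.
    have -> : new_tape (inl j) = arg_tape j by rewrite argE; congr (new_tape (inl _)); apply/val_inj.
    by rewrite h1 // lift_wtape nth_mkseq.
  rewrite h2; first by rewrite t0_new.
  by move=> x /= hx; rewrite argE.
rewrite et2 in r3.
exists (m + (m2 + mF.+1).+1), t3; split.
- by lia.
- have := runs_mseq r1' (runs_mseq r2 r3); congr runs.
  apply/funext => i; case: (unindexP old_tape i) => [[j -> _]|[ni _]].
    by rewrite put_in; [case: j => j /=; rewrite ?lift_wtape | apply: old_tape_inj].
  rewrite put_out //; case: i ni => [i|[i|[i|i]]] //= ni.
    by case: (ni (inl i)).
- move=> i u tu; rewrite /t3 put_out; last by case: i tu => i _ [].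
  rewrite h2; last by move=> j /= hj; rewrite argE; case: i tu.
  by rewrite /t0 put_in; [apply: shows_lift | apply: old_tape_inj].
- move=> i u tu; rewrite /t3 put_in; last exact: new_tape_inj.
  exact: shows_lift.
Qed.

End Call.

Lemma env_call k n N rs F (sel : nat -> nat) :
  (forall i, i < n -> sel i < N) -> env k N rs -> FP n F ->
  env k N.+1 (fun a j => if j == N then F (mkseq (fun i => rs a (sel i)) n) else rs a j).
Proof.
move=> selN [J [G [M [reg [q [d h]]]]]] [JF [GF [MF [out [qF [dF hF]]]]]].
(* The [n] arguments of the call are registers, each of length at most [q]; [S] bounds their total
   length. *)
pose S : {poly nat} := (n%:P * q)%R.
exists _, _, (call M MF (reg \o sel)),
  (fun j => if j == N then new_tape k J out else old_tape n JF (reg j)),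
  (q + n%:P * (2%N%:P * q + 3%N%:P) + (qF \Po S) + 2%N%:P)%R.
split; first exact: mdet_call.
move=> a ak; have [h1 [m [v [t [h2 h3 h4]]]]] := h a ak.
set ws := mkseq _ n.
have sws : size ws = n by rewrite size_mkseq.
have tws : total ws <= peval S (total a).
  rewrite pevalM pevalC -sws; apply: total_le => w /mapP [i].
  by rewrite mem_iota => /andP[_ hi] ->; apply/h1/selN.
have [h1' [mF [vF [tF [h2' h3' h4']]]]] := hF ws sws.
have hq := leq_peval qF tws; rewrite pevalM pevalC in hq.
split=> [j jN|].
  by rewrite !(pevalD, peval_comp, pevalM, pevalC); case: eqP => [_|ne]; [|have := h1 j ltac:(lia)]; lia.
have [||m' [t' [hm' r' s1 s2]]] := runs_call (src := reg \o sel) (w := fun i => rs a (sel i)) (B := peval q (total a)) h3 _ _ h3'.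
- by move=> i hi; apply/h4/selN.
- by move=> i hi; apply/h1/selN.
exists m', vF, t'; split=> //.
  by rewrite !(pevalD, peval_comp, pevalM, pevalC); lia.
move=> j jN; case: eqP => [_|ne]; first exact: s2.
by apply/s1/h4; lia.
Qed.

Lemma FP_comp k n F (Gs : nat -> seq word -> word) :
  FP n F -> (forall i, i < n -> FP k (Gs i)) ->
  FP k (fun a => F (mkseq (Gs^~ a) n)).
Proof.
move=> hF hG.
(* Registers below [k] keep the arguments; register [k + i] receives the value of [Gs i]. *)
pose rs (a : seq word) j := if j < k then nth [::] a j else Gs (j - k) a.
have he m : m <= n -> env k (k + m) rs.
  elim: m => [_|m IH mn].
    by rewrite addn0; apply: env_ext (@env_args k) => a j _ jk; rewrite /rs jk.
  have kN i : i < k -> id i < k + m by rewrite /=; lia.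
  have := @env_call k k (k + m) rs (Gs m) id kN (IH (ltnW mn)) (hG m mn).
  rewrite addnS; apply: env_ext => a j ak jm; case: eqP => [->|//].
  rewrite /rs ltnNge leq_addr /= addKn; congr (Gs m _).
  rewrite -[RHS](mkseq_nth [::]) ak; apply/eq_in_map => i.
  by rewrite mem_iota /= => ->.
have kN i : i < n -> k + i < k + n by lia.
have := @env_call k n (k + n) rs F (addn k) kN (he n (leqnn n)) hF.
move=> /(FP_of_env (ltnSn _)); apply: FP_ext => a ak.
rewrite eqxx; congr F; apply: eq_map => i.
by rewrite /rs ltnNge leq_addr /= addKn.
Qed.

(** * Transducers *)

(* A finite control with one two-way read-only head per argument and a write-only output;
   [None] stops it. *)
Record transducer := Transducer {
  tstate : finType;
  tstart : tstate;
  tdelta : tstate -> (nat -> option bool) -> option (tstate * option bool * (nat -> dir))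
}.

Section Transducer.
Variable T : transducer.
Variable a : seq word.

Definition tconf : Type := (tstate T * (nat -> int) * word)%type.

Definition letter_at (w : word) (i : int) : option bool :=
  if i is Posz n then onth w n else None.

Definition tread (pos : nat -> int) (j : nat) : option bool :=
  letter_at (nth [::] a j) (pos j).

Definition tnext (c : tconf) : option tconf :=
  if tdelta c.1.1 (tread c.1.2) is Some (q, o, mv) then
    Some (q, fun j => (c.1.2 j + offset (mv j))%R, c.2 ++ seq_of_opt o)
  else None.

Inductive tsteps : nat -> tconf -> tconf -> Prop :=
  | tsteps_refl c : tsteps 0 c c
  | tsteps_next n c c' c'' : tnext c = Some c' -> tsteps n c' c'' -> tsteps n.+1 c c''.

Lemma tsteps_cat n1 n2 c1 c2 c3 : tsteps n1 c1 c2 -> tsteps n2 c2 c3 -> tsteps (n1 + n2) c1 c3.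
Proof.
elim=> [//|n c c' c'' e _ IH /IH].
by rewrite addSn; apply: tsteps_next.
Qed.

Lemma tsteps_size n c c' : tsteps n c c' -> size c'.2 <= size c.2 + n.
Proof.
elim=> [{}c|{}n {}c d {}c' e _ IH]; first by rewrite addn0.
apply: leq_trans IH _; move: e; rewrite /tnext.
case: (tdelta _ _) => [[[q o] mv]|] // [<-] /=.
by rewrite size_cat; case: o => [b|] /=; lia.
Qed.

Definition tinit : tconf := (tstart T, fun _ => 0%R, [::]).

Variable k : nat.
Hypothesis ak : size a = k.

Definition letter (c : cell void) : option bool := if c is Some (inl b) then Some b else None.

(** The extra states [inr true] and [inr false] rewind the output tape and halt, so that the output
    ends up at the head, as [shows] requires. *)
Definition tmach : mach ('I_k + unit)%type void :=
  @Mach ('I_k + unit)%type void (tstate T + bool)%type (inl (tstart T)) (fun q r =>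
    match q with
    | inl q => match tdelta q (fun i => if insub i is Some j then letter (r (inl j)) else None) with
       | Some (q', o, mv) => MStep (inl q', fun i => match i with
           | inl j => (r i, mv j)
           | inr _ => if o is Some b then (Some (inl b), Right) else (r i, Stay)
           end)
       | None => MStep (inr true, fun i => (r i, if i is inl _ then Stay else Left))
       end
    | inr true => if is_bit (r (inr tt))
        then MStep (inr true, fun i => (r i, if i is inl _ then Stay else Left))
        else MStep (inr false, fun i => (r i, if i is inl _ then Stay else Right))
    | inr false => MHalt true
    end).

Lemma mdet_tmach : mdet tmach.
Proof.
case=> [q|[]] r b //=; last by case: ifP.
by case: tdelta => [[[q' o] mv]|].
Qed.

Definition ttapes (pos : nat -> int) (s : int) (out : word) : tapes ('I_k + unit)%type void :=
  fun i => match i with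
    | inl j => shift (pos j) (wtape void (nth [::] a j))
    | inr _ => shift s (wtape void out)
    end.

Lemma letter_wtape w i : letter (wtape void w i) = letter_at w i.
Proof.
case: i => n; rewrite /letter_at ?wtapeN // wtapeE.
rewrite onthE; case: ltnP => h; first by rewrite (nth_map false).
by rewrite nth_default // size_map.
Qed.

Lemma tread_ttapes pos s out :
  (fun i => if insub i is Some j then letter (heads (ttapes pos s out) (inl j)) else None) =
  tread pos.
Proof.
apply/funext => i; case: insubP => [j _ <-|]; rewrite /tread.
  by rewrite /heads /= /shift add0r letter_wtape.
by rewrite -leqNgt -ak => h; rewrite nth_default //; case: (pos i) => m; rewrite /= ?onth0n.
Qed.

Lemma reach_tmach n c c' : tsteps n c c' ->
  @reach _ _ tmach n (inl c.1.1, ttapes c.1.2 (size c.2) c.2) [::]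
    (inl c'.1.1, ttapes c'.1.2 (size c'.2) c'.2).
Proof.
elim=> [{}c|{}n {}c d {}c' e _ IH]; first exact: reach_refl.
rewrite -add1n; apply: reach_cat0 IH.
have := @reach1 _ _ tmach (inl c.1.1, ttapes c.1.2 (size c.2) c.2) _ _.
rewrite /= tread_ttapes; move: e; rewrite /tnext.
case: (tdelta _ _) => [[[q o] mv]|] // [<-] /= /(_ _ erefl).
congr reach; rewrite /mperform /=; congr pair; apply/funext => -[j|[]] /=.
  by rewrite /heads /= {1}/shift add0r act_shift.
case: o => [b|] /=; last by rewrite cats0 act_id.
rewrite act_shiftE size_cat /=; congr shift.
apply/funext => -[m|m]; last by rewrite /aset; case: eqP => // _; rewrite !wtapeN.
rewrite /aset !wtapeE size_cat /= addn1 ltnS nth_cat.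
have -> : (Posz m == Posz (size c.2)) = (m == size c.2) by [].
by case: ltngtP => // ->; rewrite subnn.
Qed.

Lemma runs_tmach n c : tsteps n tinit c -> tnext c = None ->
  exists v t, runs tmach (n + size c.2 + 2) (@load k _ _ a) [::] v t /\
    shows (t (inr tt)) c.2.
Proof.
move=> st ce; set w := c.2; set pos := c.1.2.
exists true, (ttapes pos 0 w); split; last first.
  by rewrite /= shift0; apply: shows_wtape.
exists (inr false : mstate tmach) => //.
have h0 := reach_tmach st.
have h1 : @reach _ _ tmach 1 (inl c.1.1, ttapes pos (size w) w) [::]
    (inr true, ttapes pos ((size w)%:Z - 1)%R w).
  have := @reach1 _ _ tmach (inl c.1.1, ttapes pos (size w) w) _ _.
  rewrite /= tread_ttapes; move: ce; rewrite /tnext -/pos.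
  case: (tdelta _ _) => [[[q o] mv]|] // _ /(_ _ erefl).
  congr reach; rewrite /mperform /=; congr pair; apply/funext => -[j|[]] /=.
    by rewrite act_id.
  by rewrite act_shiftE /= /heads /= /shift add0r aset_id.
have h2 m : m <= size w -> @reach _ _ tmach m (inr true, ttapes pos (m%:Z - 1)%R w) [::]
    (inr true, ttapes pos (-1)%R w).
  elim: m => [_|m IH mw]; first by rewrite sub0r; exact: reach_refl.
  rewrite -add1n; apply: reach_cat0 (IH (ltnW mw)).
  have := @reach1 _ _ tmach (inr true, ttapes pos (m.+1%:Z - 1)%R w) _ _.
  have e : (m.+1%:Z - 1 = m)%R by lia.
  rewrite /= e {1}/heads /= {1}/shift add0r wtapeE mw /= => /(_ _ erefl).
  congr reach; rewrite /mperform /=; congr pair; apply/funext => -[j|[]] /=.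
    by rewrite act_id.
  by rewrite act_shiftE /= /heads /= /shift add0r aset_id.
have h3 : @reach _ _ tmach 1 (inr true, ttapes pos (-1)%R w) [::]
    (inr false, ttapes pos 0 w).
  have := @reach1 _ _ tmach (inr true, ttapes pos (-1)%R w) _ _.
  move=> /= /(_ _ erefl).
  congr reach; rewrite /mperform /=; congr pair; apply/funext => -[j|[]] /=.
    by rewrite act_id.
  by rewrite act_shiftE /= /heads /= /shift add0r aset_id.
have := reach_cat0 h0 (reach_cat0 h1 (reach_cat0 (h2 _ (leqnn _)) h3)).
have -> : n + (1 + (size w + 1)) = n + size w + 2 by lia.
congr reach; congr pair; apply/funext => -[j|[]] /=; first by rewrite shift0.
by rewrite shift0 wtape_nil.
Qed.

End Transducer.

(** At most one letter is written per step, so rewinding the output at most doubles the time, up to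
    the constant. *)
Lemma FP_transducer T k F (q : {poly nat}) :
  (forall a, size a = k -> exists n c, [/\ n <= peval q (total a),
     tsteps a n (tinit T) c, tnext a c = None & c.2 = F a]) -> FP k F.
Proof.
move=> h; exists unit, void, (tmach T k), (inr tt), (2%N%:P * q + 2%N%:P)%R.
split; first exact: mdet_tmach.
move=> a ak; have [n [c [hn st ce <-]]] := h a ak.
have [v [t [r s]]] := runs_tmach ak st ce.
have := tsteps_size st; rewrite /= add0n => sc.
rewrite !(pevalD, pevalM, pevalC); split; first by lia.
by exists (n + size c.2 + 2), v, t; split=> //; rewrite !(pevalD, pevalM, pevalC); lia.
Qed.

Section Mealy.
Variables (Q : finType) (q0 : Q).
Variable step : Q -> (nat -> option bool) -> Q * option bool.
Variable fin : Q -> option bool.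

(** A synchronous automaton: all heads advance together until every argument is exhausted, exhausted
    arguments being read as [None]; then [fin] may emit one last letter. *)
Inductive mealy : Q -> seq word -> word -> Prop :=
  | mealy_end q us : all (@nilp bool) us -> mealy q us (seq_of_opt (fin q))
  | mealy_next q us out : ~~ all (@nilp bool) us ->
      let s := step q (fun j => ohead (nth [::] us j)) in
      mealy s.1 (map behead us) out -> mealy q us (seq_of_opt s.2 ++ out).

Definition mealy_transducer k : transducer :=
  @Transducer (option Q) (Some q0) (fun q r =>
    if q is Some q then
      if all (fun j => r j == None) (iota 0 k) then Some (None, fin q, fun _ => Stay)
      else let s := step q r in Some (Some s.1, s.2, fun _ => Right)
    else None).

Lemma FP_mealy k F :
  (forall a, size a = k -> mealy q0 a (F a)) -> FP k F.
Proof.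
move=> h; apply: (@FP_transducer (mealy_transducer k) k F ('X + 1)%R) => a ak.
rewrite pevalD pevalX -[1%R]/(1%N%:P)%R pevalC.
have readE i pos : pos = (fun _ => i%:Z)%R ->
    @tread a pos = fun j => ohead (nth [::] [seq drop i w | w <- a] j).
  move=> ->; apply/funext => j; rewrite /tread /= onthE.
  case: (ltnP j (size a)) => ja; last by rewrite !nth_default ?size_map.
  rewrite (nth_map [::]) //; elim: (nth _ a j) (i) => [|b w IH] [|m] //=.
(* Generalized to a run that has already read [i] letters of every argument and written [out0]. *)
have main q us out (H : mealy q us out) : forall i out0,
    us = [seq drop i w | w <- a] ->
    exists n c, [/\ n <= (total us).+1,
      @tsteps (mealy_transducer k) a n (Some q, fun _ => i%:Z%R, out0) c,
      tnext a c = None & c.2 = out0 ++ out].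
  elim: H => {q us out} [q us hn|q us out hn s _ IH] i out0 us_a.
    exists 1, (None, fun _ => i%:Z%R, out0 ++ seq_of_opt (fin q)); split=> //.
    apply: tsteps_next (tsteps_refl _ _).
    rewrite /tnext /= (readE i) // -us_a.
    have -> : all (fun j => ohead (nth [::] us j) == None) (iota 0 k).
      apply/allP => j _; case: (ltnP j (size us)) => ju; last by rewrite nth_default.
      by have := allP hn _ (mem_nth [::] ju) => /nilP ->.
    by congr (Some (_, _, _)); apply/funext => j /=; rewrite addr0.
  have [] := IH i.+1 (out0 ++ seq_of_opt s.2).
    by rewrite us_a -map_comp; apply: eq_map => w /=; rewrite -drop1 drop_drop.
  move=> n [c [hn' st ce co]]; exists n.+1, c; split=> //; last by rewrite co catA.
    have : total (map behead us) < total us.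
      move: hn; clear; elim: us => [|[|b w] us IH] //= h; rewrite !total_cons //=.
      - by rewrite !add0n IH.
      - rewrite addSn ltnS leq_add2l; elim: us {IH h} => // u us IH.
        by rewrite /= !total_cons leq_add // size_behead leq_pred.
    by lia.
  apply: tsteps_next st; rewrite /tnext /= (readE i) // -us_a.
  case: ifP => [/allP al|_].
    case/negP: hn; apply/allP => u /(nthP [::]) [j ju <-].
    have := al j; rewrite mem_iota -ak -(size_map (drop i) a) -us_a => /(_ ju).
    by case: (nth _ _ _).
  by congr (Some (_, _, _)); apply/funext => j /=; lia.
have [|n [c [hn st ce co]]] := main _ _ _ (h a ak) 0 [::].
  by rewrite (eq_map (@drop0 _)) map_id.
exists n, c; split=> //; lia.
Qed.

End Mealy.

(** * Elementary polynomial-time functions *)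

Notation arg := (nth (@nil bool)).

Lemma FP1_comp k (f : word -> word) g :
  FP 1 (fun a => f (arg a 0)) -> FP k g -> FP k (fun a => f (g a)).
Proof. by move=> hf hg; apply: (FP_comp hf (Gs := fun _ => g)). Qed.

Lemma FP2_comp k (f : word -> word -> word) g0 g1 :
  FP 2 (fun a => f (arg a 0) (arg a 1)) -> FP k g0 -> FP k g1 ->
  FP k (fun a => f (g0 a) (g1 a)).
Proof.
move=> hf h0 h1; apply: (FP_comp hf (Gs := fun i => if i is 0 then g0 else g1)).
by case.
Qed.

Lemma FP3_comp k (f : word -> word -> word -> word) g0 g1 g2 :
  FP 3 (fun a => f (arg a 0) (arg a 1) (arg a 2)) -> FP k g0 -> FP k g1 -> FP k g2 ->
  FP k (fun a => f (g0 a) (g1 a) (g2 a)).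
Proof.
move=> hf h0 h1 h2.
apply: (FP_comp hf (Gs := fun i => match i with 0 => g0 | 1 => g1 | _ => g2 end)).
by case=> [|[]].
Qed.

Lemma FP_arg k i : i < k -> FP k (fun a => arg a i).
Proof. by move=> ik; apply: (FP_of_env ik (env_args k)). Qed.

Lemma FP_nil k : FP k (fun _ => [::]).
Proof.
have h0 : FP 0 (fun _ => [::]).
  apply: (@FP_mealy unit tt (fun _ _ => (tt, None)) (fun _ => None)) => a /eqP/nilP ->.
  exact: mealy_end.
exact: (@FP_comp k 0 _ (fun _ _ => [::]) h0).
Qed.

Lemma FP_bit k b : FP k (fun _ => [:: b]).
Proof.
have h0 : FP 0 (fun _ => [:: b]).
  apply: (@FP_mealy unit tt (fun _ _ => (tt, None)) (fun _ => Some b)) => a /eqP/nilP ->.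
  exact: mealy_end.
exact: (@FP_comp k 0 _ (fun _ _ => [::]) h0).
Qed.

Lemma FP_nseq k b g : FP k g -> FP k (fun a => nseq (size (g a)) b).
Proof.
apply: (@FP1_comp k (fun w => nseq (size w) b)).
apply: (@FP_mealy unit tt (fun _ _ => (tt, Some b)) (fun _ => None)) => -[|x [|]] //= _.
elim: x => [|c x IH]; first exact: mealy_end.
exact: (@mealy_next _ _ _ tt [:: c :: x]).
Qed.

Lemma FP_take k g0 g1 : FP k g0 -> FP k g1 -> FP k (fun a => take (size (g0 a)) (g1 a)).
Proof.
apply: (@FP2_comp k (fun x y => take (size x) y)).
apply: (@FP_mealy unit tt (fun _ r => (tt, if r 0 then r 1 else None)) (fun _ => None)).
move=> -[|x [|y [|]]] //= _.
elim: y x => [|d y IH] x.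
  elim: x => [|c x IH]; first exact: mealy_end.
  exact: (@mealy_next _ _ _ tt [:: c :: x; [::]]).
case: x => [|c x].
  by have := @mealy_next unit (fun _ r => (tt, if r 0 then r 1 else None)) (fun _ => None)
    tt [:: [::]; d :: y] _ isT (IH [::]); rewrite take0.
exact: (@mealy_next _ _ _ tt [:: c :: x; d :: y] _ _ (IH x)).
Qed.

Lemma FP_drop k g0 g1 : FP k g0 -> FP k g1 -> FP k (fun a => drop (size (g0 a)) (g1 a)).
Proof.
apply: (@FP2_comp k (fun x y => drop (size x) y)).
apply: (@FP_mealy unit tt (fun _ r => (tt, if r 0 then None else r 1)) (fun _ => None)).
move=> -[|x [|y [|]]] //= _.
elim: y x => [|d y IH] x.
  elim: x => [|c x IH]; first exact: mealy_end.
  exact: (@mealy_next _ _ _ tt [:: c :: x; [::]]).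
case: x => [|c x].
  by have := @mealy_next unit (fun _ r => (tt, if r 0 then None else r 1)) (fun _ => None)
    tt [:: [::]; d :: y] _ isT (IH [::]); rewrite drop0.
exact: (@mealy_next _ _ _ tt [:: c :: x; d :: y] _ _ (IH x)).
Qed.

Lemma FP_if k c g0 g1 : FP k (fun a => [:: c a]) -> FP k g0 -> FP k g1 ->
  FP k (fun a => if c a then g0 a else g1 a).
Proof.
apply: (@FP3_comp k (fun x y z => if head false x then y else z) (fun a => [:: c a])).
(* State [None] lasts for the first step only, which reads the condition and already emits the first
   letter of the selected branch. *)
pose step (q : option bool) (r : nat -> option bool) :=
  let s := if q is Some b then b else odflt false (r 0) in (Some s, if s then r 1 else r 2).
apply: (@FP_mealy _ None step (fun _ => None)) => -[|x [|y [|z [|]]]] //= _.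
have main b : forall x y z, mealy step (fun _ => None) (Some b) [:: x; y; z] (if b then y else z).
  (* Induction on a bound for the total length, since any of the three words may be exhausted
     first. *)
  move=> {}x {}y {}z; move: {2}(size x + size y + size z) (leqnn (size x + size y + size z)) => n.
  elim: n x y z => [|n IH] x y z.
    by case: x y z => [|? ?] [|? ?] [|? ?] //= _; case: b; apply: mealy_end.
  move=> hn; case e: (all (@nilp bool) [:: x; y; z]).
    by move: e; case: x y z {hn} => [|? ?] [|? ?] [|? ?] //= _; case: b {IH}; apply: mealy_end.
  have := @mealy_next _ step (fun _ => None) (Some b) [:: x; y; z] _ (negbT e) (IH _ _ _ _).
  by case: b {IH}; case: x y z hn e => [|? ?] [|? ?] [|? ?] //= hn e; apply; rewrite /=; lia.
case e: (all (@nilp bool) [:: x; y; z]).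
  by move: e; case: x y z => [|? ?] [|? ?] [|? ?] //= _; apply: mealy_end.
have := @mealy_next _ step (fun _ => None) None [:: x; y; z] _ (negbT e) (main _ _ _ _).
by case: x y z e => [|[] x] [|? ?] [|? ?] //= e.
Qed.

Lemma FP_eq k g0 g1 : FP k g0 -> FP k g1 -> FP k (fun a => [:: g0 a == g1 a]).
Proof.
apply: (@FP2_comp k (fun x y => [:: x == y])).
pose step (q : bool) (r : nat -> option bool) : bool * option bool := (q && (r 0 == r 1), None).
apply: (@FP_mealy _ true step Some) => -[|x [|y [|]]] //= _.
have main q : mealy step Some q [:: x; y] [:: q && (x == y)].
  elim: x y q => [|c x IH] y q.
    elim: y q => [|d y IH] q; first by rewrite andbT; apply: mealy_end.
    have := @mealy_next _ step Some q [:: [::]; d :: y] _ isT (IH _).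
    by rewrite /= andbF.
  case: y => [|d y].
    have := @mealy_next _ step Some q [:: c :: x; [::]] _ isT (IH [::] _).
    by rewrite /= !andbF.
  have := @mealy_next _ step Some q [:: c :: x; d :: y] _ isT (IH y _).
  by rewrite /= eqseq_cons andbA.
exact: main true.
Qed.

Fixpoint leading_ones (w : word) : word :=
  if w is true :: w' then true :: leading_ones w' else [::].

Lemma FP_leading_ones k g : FP k g -> FP k (fun a => leading_ones (g a)).
Proof.
apply: FP1_comp.
pose step (q : bool) (r : nat -> option bool) :=
  let s := q && (r 0 == Some true) in (s, if s then Some true else None).
apply: (@FP_mealy _ true step (fun _ => None)) => -[|x [|]] //= _.
have main q : mealy step (fun _ => None) q [:: x] (if q then leading_ones x else [::]).
  elim: x q => [|c x IH] q; first by case: q; apply: mealy_end.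
  have := @mealy_next _ step (fun _ => None) q [:: c :: x] _ isT (IH _).
  by case: q c => [] [].
exact: main true.
Qed.

(* In lexicographic order the successor of [u 0 1^i] is [u 1 0^i]. *)
Fixpoint succ_word (x y : word) : bool :=
  match x, y with
  | b :: x', c :: y' =>
      (b == c) && succ_word x' y' || [&& ~~ b, c, all id x', all negb y' & size x' == size y']
  | _, _ => false
  end.

Lemma FP_succ k g0 g1 : FP k g0 -> FP k g1 -> FP k (fun a => [:: succ_word (g0 a) (g1 a)]).
Proof.
apply: (@FP2_comp k (fun x y => [:: succ_word x y])).
(* [Some false]: equal so far; [Some true]: past the position where [x] has 0 and [y] has 1 *)
pose step (q : option bool) (r : nat -> option bool) : option bool * option bool :=
  (match q, r 0, r 1 with
   | Some false, Some b, Some c => if b == c then Some false else if c then Some true else None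
   | Some true, Some true, Some false => Some true
   | _, _, _ => None
   end, None).
pose fin (q : option bool) := Some (q == Some true).
apply: (@FP_mealy _ (Some false) step fin) => -[|x [|y [|]]] //= _.
have main q : mealy step fin q [:: x; y] [:: match q with
    | Some false => succ_word x y
    | Some true => [&& all id x, all negb y & size x == size y]
    | None => false end].
  elim: x y q => [|c x IH] y q.
    elim: y q => [|d y IH] q; first by case: q => [[]|]; apply: mealy_end.
    have := @mealy_next _ step fin q [:: [::]; d :: y] _ isT (IH _).
    by case: q d => [[]|] [] /=; rewrite ?andbF.
  case: y => [|d y].
    have := @mealy_next _ step fin q [:: c :: x; [::]] _ isT (IH [::] _).
    by case: q c => [[]|] [] /=; rewrite ?andbF.
  have := @mealy_next _ step fin q [:: c :: x; d :: y] _ isT (IH y _).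
  by case: q c d => [[]|] [] [] /=; rewrite ?andbF ?orbF ?eqSS.
exact: main (Some false).
Qed.

Definition pos2 (i j : int) : nat -> int :=
  fun n => match n with 0 => i | 1 => j | _ => 0%R end.

Definition move_head (n : nat) (d : dir) : nat -> dir := fun i => if i == n then d else Stay.

Lemma move_head0 i j d :
  (fun n => (pos2 i j n + offset (move_head 0 d n))%R) = pos2 (i + offset d)%R j.
Proof. by apply/funext => -[|[|n]] //=; rewrite addr0. Qed.

Lemma move_head1 i j d :
  (fun n => (pos2 i j n + offset (move_head 1 d n))%R) = pos2 i (j + offset d)%R.
Proof. by apply/funext => -[|[|n]] //=; rewrite addr0. Qed.

Lemma pos2_00 : pos2 0 0 = fun _ => 0%R.
Proof. by apply/funext => -[|[|n]]. Qed.

Lemma tsteps_rcons T a n c c' c'' : @tsteps T a n c c' -> tnext a c' = Some c'' -> tsteps a n.+1 c c''.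
Proof.
by move=> h e; rewrite -addn1; apply: tsteps_cat h (tsteps_next e (tsteps_refl _ _)).
Qed.

Lemma onth_lt (w : word) n : n < size w -> onth w n = Some (nth false w n).
Proof. by move=> h; rewrite onthE (nth_map false). Qed.

Lemma FP_cat k g0 g1 : FP k g0 -> FP k g1 -> FP k (fun a => g0 a ++ g1 a).
Proof.
apply: (@FP2_comp k (fun x y => x ++ y)).
pose T := @Transducer bool false (fun q r =>
  if q then if r 1 is Some b then Some (true, Some b, move_head 1 Right) else None
  else if r 0 is Some b then Some (false, Some b, move_head 0 Right)
       else Some (true, None, fun _ => Stay)).
apply: (@FP_transducer T 2 _ ('X + 1%N%:P)%R) => -[|x [|y [|]]] //= _.
have h0 n : n <= size x -> @tsteps T [:: x; y] n (tinit T) (false, pos2 n 0, take n x).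
  elim: n => [_|n IH nx]; first by rewrite pos2_00 take0; apply: tsteps_refl.
  apply: tsteps_rcons (IH (ltnW nx)) _.
  rewrite /tnext /= /tread /= (onth_lt nx) /= move_head0 (take_nth false nx) -cats1 /=.
  by congr (Some (_, _, _)); congr pos2; lia.
have h1 n : n <= size y ->
    @tsteps T [:: x; y] (size x + n.+1) (tinit T) (true, pos2 (size x) n, x ++ take n y).
  elim: n => [_|n IH ny].
    rewrite addn1 take0; apply: tsteps_rcons (h0 _ (leqnn _)) _.
    rewrite /tnext /= /tread /= onth_default //= take_size.
    by congr (Some (_, _, _)); apply/funext => -[|[|n]] //=; rewrite addr0.
  rewrite addnS; apply: tsteps_rcons (IH (ltnW ny)) _.
  rewrite /tnext /= /tread /= (onth_lt ny) /= move_head1 (take_nth false ny) -cats1 catA /=.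
  by congr (Some (_, _, _)); congr pos2; lia.
exists (size x + (size y).+1), (true, pos2 (size x) (size y), x ++ y).
split=> //.
- by rewrite pevalD pevalX pevalC !total_cons; lia.
- by have := h1 _ (leqnn _); rewrite take_size.
- by rewrite /tnext /= /tread /= onth_default.
Qed.

Lemma FP_mul k g0 g1 : FP k g0 -> FP k g1 ->
  FP k (fun a => nseq (size (g0 a) * size (g1 a)) false).
Proof.
apply: (@FP2_comp k (fun x y => nseq (size x * size y) false)).
(* for each letter of [x] (state [Some false]), [y] is scanned (state [Some true])
   and rewound (state [None]) *)
pose T := @Transducer (option bool) (Some false) (fun q r =>
  match q with
  | Some false => if r 0 then Some (Some true, None, move_head 0 Right) else None
  | Some true => if r 1 then Some (Some true, Some false, move_head 1 Right)
                 else Some (None, None, move_head 1 Left)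
  | None => if r 1 then Some (None, None, move_head 1 Left)
            else Some (Some false, None, move_head 1 Right)
  end).
apply: (@FP_transducer T 2 _ ('X * (2%N%:P * 'X + 3%N%:P))%R) => -[|x [|y [|]]] //= _.
have scan n i m : n <= size y -> @tsteps T [:: x; y] n
    (Some true, pos2 i 0, nseq m false) (Some true, pos2 i n, nseq (m + n) false).
  elim: n => [_|n IH ny]; first by rewrite addn0; apply: tsteps_refl.
  apply: tsteps_rcons (IH (ltnW ny)) _.
  rewrite /tnext /= /tread /= (onth_lt ny) /= move_head1.
  have -> : m + n.+1 = m + n + 1 by lia.
  rewrite !nseqD /=; congr (Some (_, _, _)); congr pos2; rewrite /=; lia.
have rewind n i m : n <= size y -> @tsteps T [:: x; y] n.+1
    (None, pos2 i (n%:Z - 1)%R, nseq m false) (Some false, pos2 i 0, nseq m false).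
  elim: n => [_|n IH ny].
    apply: tsteps_next (tsteps_refl _ _).
    by rewrite /tnext /= /tread /= cats0 move_head1.
  apply: tsteps_next (IH (ltnW ny)).
  have e : (n.+1%:Z - 1 = n)%R by lia.
  rewrite /tnext /= /tread e /= (onth_lt ny) /= move_head1 cats0.
  by congr (Some (_, _, _)); congr pos2.
have main n : n <= size x -> @tsteps T [:: x; y] (n * (2 * size y + 3))
    (tinit T) (Some false, pos2 n 0, nseq (n * size y) false).
  elim: n => [_|n IH nx]; first by rewrite pos2_00; apply: tsteps_refl.
  rewrite mulSn addnC; apply: tsteps_cat (IH (ltnW nx)) _.
  have -> : 2 * size y + 3 = (size y + (size y).+2).+1 by lia.
  apply: (@tsteps_next T _ _ _ (Some true, pos2 n.+1 0, nseq (n * size y) false)).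
    rewrite /tnext /= /tread /= (onth_lt nx) /= move_head0 cats0.
    by congr (Some (_, _, _)); congr pos2; rewrite /=; lia.
  apply: tsteps_cat (scan _ _ _ (leqnn _)) _.
  apply: (@tsteps_next T _ _ _ (None, pos2 n.+1 ((size y)%:Z - 1)%R,
    nseq (n * size y + size y) false)).
    by rewrite /tnext /= /tread /= onth_default //= move_head1 cats0.
  by rewrite mulSn addnC; apply: rewind.
exists (size x * (2 * size y + 3)), (Some false, pos2 (size x) 0, nseq (size x * size y) false).
split=> //.
- rewrite !(pevalD, pevalM, pevalX, pevalC) !total_cons.
  by apply: leq_mul; lia.
- exact: main.
- by rewrite /tnext /= /tread /= onth_default.
Qed.

Lemma FP_cons k b g : FP k g -> FP k (fun a => b :: g a).
Proof. exact: (@FP_cat k (fun _ => [:: b]) g (FP_bit k b)). Qed.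

Lemma FP_const k w : FP k (fun _ => w).
Proof. by elim: w => [|b w IH]; [apply: FP_nil | apply: FP_cons]. Qed.

(** Horner's scheme in unary. The resulting words serve as yardsticks: [take], [drop] and length
    tests use only their lengths. *)
Lemma FP_poly k (p : {poly nat}) g : FP k g ->
  FP k (fun a => nseq (peval p (size (g a))) false).
Proof.
move=> hg; elim/poly_ind: p => [|p c IH].
  by apply: FP_ext (FP_nil k) => a _; rewrite /peval horner0.
have := FP_cat (FP_mul IH hg) (FP_const k (nseq c false)).
by apply: FP_ext => a _; rewrite size_nseq -nseqD peval_MXaddC.
Qed.

Lemma FP_and k P1 P2 : FP k (fun a => [:: P1 a]) -> FP k (fun a => [:: P2 a]) ->
  FP k (fun a => [:: P1 a && P2 a]).
Proof.
move=> h1 h2; have := FP_if h1 h2 (FP_bit k false).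
by apply: FP_ext => a _; case: (P1 a).
Qed.

Lemma FP_not k P : FP k (fun a => [:: P a]) -> FP k (fun a => [:: ~~ P a]).
Proof.
move=> h; have := FP_if h (FP_bit k false) (FP_bit k true).
by apply: FP_ext => a _; case: (P a).
Qed.

Lemma FP_or k P1 P2 : FP k (fun a => [:: P1 a]) -> FP k (fun a => [:: P2 a]) ->
  FP k (fun a => [:: P1 a || P2 a]).
Proof.
move=> h1 h2; have := FP_if h1 (FP_bit k true) h2.
by apply: FP_ext => a _; case: (P1 a).
Qed.

Lemma FP_head k g : FP k g -> FP k (fun a => [:: head false (g a)]).
Proof.
move=> h; have := FP_take (FP_bit k true) (FP_cat h (FP_bit k false)).
by apply: FP_ext => a _; case: (g a) => //= b w; rewrite take0.
Qed.

Lemma FP_behead k g : FP k g -> FP k (fun a => behead (g a)).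
Proof.
by move=> h; have := FP_drop (FP_bit k true) h; apply: FP_ext => a _; rewrite drop1.
Qed.

Lemma FP_eqsize k g0 g1 : FP k g0 -> FP k g1 -> FP k (fun a => [:: size (g0 a) == size (g1 a)]).
Proof.
move=> h0 h1; have := FP_eq (FP_nseq false h0) (FP_nseq false h1).
apply: FP_ext => a _; congr [:: _]; apply/eqP/eqP => [/(congr1 size)|->//].
by rewrite !size_nseq.
Qed.

(** * Pairing of words *)

Definition pair_word (x y : word) : word := nseq (size x) true ++ false :: x ++ y.
(** The [.+1] removes the [0] that ends the unary prefix; the number of leading ones is the length
    of the first component. *)
Definition payload (c : word) : word := drop (size (leading_ones c)).+1 c.
Definition fst_word (c : word) : word := take (size (leading_ones c)) (payload c).
Definition snd_word (c : word) : word := drop (size (leading_ones c)) (payload c).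

Lemma leading_ones_pair x y : leading_ones (pair_word x y) = nseq (size x) true.
Proof. by rewrite /pair_word; elim: (size x) => //= n ->. Qed.

Lemma payload_pair x y : payload (pair_word x y) = x ++ y.
Proof.
rewrite /payload leading_ones_pair size_nseq /pair_word -cat1s catA drop_size_cat //.
by rewrite size_cat size_nseq addn1.
Qed.

Lemma fst_pair x y : fst_word (pair_word x y) = x.
Proof. by rewrite /fst_word payload_pair leading_ones_pair size_nseq take_size_cat. Qed.

Lemma snd_pair x y : snd_word (pair_word x y) = y.
Proof. by rewrite /snd_word payload_pair leading_ones_pair size_nseq drop_size_cat. Qed.

Lemma size_pair x y : size (pair_word x y) = 2 * size x + size y + 1.
Proof. by rewrite /pair_word size_cat size_nseq /= size_cat; lia. Qed.

Lemma FP_pair k g0 g1 : FP k g0 -> FP k g1 -> FP k (fun a => pair_word (g0 a) (g1 a)).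
Proof. by move=> h0 h1; apply: FP_cat (FP_nseq true h0) (FP_cons false (FP_cat h0 h1)). Qed.

Lemma FP_payload k g : FP k g -> FP k (fun a => payload (g a)).
Proof. by move=> h; apply: (FP_drop (FP_cons true (FP_leading_ones h)) h). Qed.

Lemma FP_fst k g : FP k g -> FP k (fun a => fst_word (g a)).
Proof. by move=> h; apply: FP_take (FP_leading_ones h) (FP_payload h). Qed.

Lemma FP_snd k g : FP k g -> FP k (fun a => snd_word (g a)).
Proof. by move=> h; apply: FP_drop (FP_leading_ones h) (FP_payload h). Qed.

(** * Turing machines as machines with functional tapes *)

(** The machine itself decides when to guess and when to halt, so the guess strings of the complete
    computations from [c] are prefix-free, and each of them determines its outcome. *)
Lemma computation_inj M (c : config M) w v d r v' d' :
  computation c w v d -> computation c (w ++ r) v' d' -> [/\ r = [::], v = v' & d = d'].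
Proof.
move=> h; elim: h r v' d' => {c w v d}.
- move=> c v e r v' d' /= h; case: h e => [c0 v0 e0|c0 a w v0 c' e0 _|c0 a0 a1 b w v0 c' e0 _].
  + by rewrite e0 => -[->].
  + by rewrite e0.
  + by rewrite e0.
- move=> c a w v d e _ IH r v' d'; move: {-2}(w ++ r) (erefl (w ++ r)) => s es h.
  case: h e es IH => [c0 v0 e0|c0 a' w' v0 c' e0 h'|c0 a0 a1 b w' v0 c' e0 _]; rewrite e0 //.
  by move=> [<-] es IH; apply: IH; rewrite -es.
- move=> c a0 a1 b w v d e _ IH r v' d' /=; move: {-2}(b :: _) (erefl (b :: w ++ r)) => s es h.
  case: h e es IH => [c0 v0 e0|c0 a' w' v0 c' e0 h'|c0 a0' a1' b' w' v0 c' e0 h']; rewrite e0 //.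
  by move=> [<- <-] [eb es] IH; apply: IH; rewrite -es -eb.
Qed.

Lemma computation_det M (c : config M) w v d v' d' :
  computation c w v d -> computation c w v' d' -> v = v' /\ d = d'.
Proof. by move=> h h'; case: (@computation_inj M c w v d [::] v' d' h); rewrite ?cats0. Qed.

Lemma computation_inv M (c : config M) w v d : computation c w v d ->
  match cur_instr c with
  | Halt _ => True
  | Step a => computation (perform a c) w v d
  | Guess a0 a1 => exists b u, w = b :: u /\ computation (perform (if b then a1 else a0) c) u v d
  end.
Proof.
case=> [c0 v0 ->|c0 a u v0 c' -> h|c0 a0 a1 b u v0 c' -> h] //.
by exists b, u.
Qed.

Section MachOfTM.
Variable M : tm.

Definition mach_of_tm : mach 'I_(ntapes M).+1 (aux M) :=
  @Mach _ _ (state M) (start M) (fun q r =>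
    match delta q (finfun r) with
    | Halt v => MHalt v
    | Step a => MStep (a.1, fun i => a.2 i)
    | Guess a0 a1 => MGuess (fun b => let a := if b then a1 else a0 in (a.1, fun i => a.2 i))
    end).

Definition atapes (c : config M) : tapes 'I_(ntapes M).+1 (aux M) := fun i => atape_of (c.2 i).

Lemma atapes_init a i : atapes (init M a) i = wtape (aux M) (nth [::] a i).
Proof. by rewrite /atapes ffunE. Qed.

Lemma mdelta_atapes c : mdelta (m := mach_of_tm) c.1 (heads (atapes c)) =
  match cur_instr c with
  | Halt v => MHalt v
  | Step a => MStep (a.1, fun i => a.2 i)
  | Guess a0 a1 => MGuess (fun b => let a := if b then a1 else a0 in (a.1, fun i => a.2 i))
  end.
Proof.
rewrite /= /cur_instr; suff -> : [ffun i => read (c.2 i)] = finfun (heads (atapes c)) by [].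
by apply/ffunP => i; rewrite !ffunE /heads /atapes -atape_of0.
Qed.

Lemma mperform_atapes (a : action _ _ _) c :
  @mperform _ _ mach_of_tm (a.1, fun i => a.2 i) (atapes c) =
  ((perform a c).1, atapes (perform a c)).
Proof.
rewrite /mperform /=.
suff -> : (fun i => act (a.2 i) (atapes c i)) = atapes (perform a c) by [].
by apply/funext => i; rewrite /atapes ffunE atape_of_act; case: (a.2 i).
Qed.

Lemma reach_of_computation c w v d n : computation c w v d -> halts_within n c ->
  exists2 k, k <= n & @reach _ _ mach_of_tm k (c.1, atapes c) w (d.1, atapes d) /\
    cur_instr d = Halt _ _ _ v.
Proof.
move=> h; elim: h n => {c w v d}.
- by move=> c v e n _; exists 0 => //; split=> //; apply: reach_refl.
- move=> c a w v d e _ IH [|n] /=; rewrite e // => /IH [k kn [h1 h2]].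
  exists k.+1 => //; split=> //.
  refine (@reach_step _ _ mach_of_tm _ (c.1, atapes c) _ _ _ _ _).
    by rewrite mdelta_atapes e.
  by rewrite mperform_atapes.
- move=> c a0 a1 b w v d e _ IH [|n] /=; rewrite e // => /andP[hn0 hn1].
  have [|k kn [h1 h2]] := IH n; first by case: (b).
  exists k.+1 => //; split=> //.
  refine (@reach_guess _ _ mach_of_tm _ (c.1, atapes c) _ b _ _ _ _).
    by rewrite mdelta_atapes e.
  by rewrite mperform_atapes.
Qed.

Lemma runs_of_computation a w v d n :
  computation (init M a) w v d -> halts_within n (init M a) ->
  exists2 k, k <= n & runs mach_of_tm k (atapes (init M a)) w v (atapes d).
Proof.
move=> h hn; have [k kn [r e]] := reach_of_computation h hn.
by exists k => //; exists d.1 => //; rewrite mdelta_atapes e.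
Qed.

(** Functional tapes forget how a tape is represented, so the run is followed with a concrete
    configuration [c] alongside it. *)
Lemma computation_of_reach k ac w ac' v (h : @reach _ _ mach_of_tm k ac w ac') :
  mdelta ac'.1 (heads ac'.2) = MHalt v ->
  forall c, ac = (c.1, atapes c) -> exists2 d, computation c w v d & ac' = (d.1, atapes d).
Proof.
elim: h => {k ac w ac'} [ac|k ac a w ac' e _ IH|k ac a b w ac' e _ IH] hv c ec.
- exists c => //; apply: computation_halt.
  by move: hv; rewrite ec mdelta_atapes; case: (cur_instr c) => // ? [->].
- move: e; rewrite ec mdelta_atapes; case ec' : (cur_instr c) => [|a'|] // [ea].
  have [|d h1 h2] := IH hv (perform a' c); first by rewrite -ea ec mperform_atapes.
  by exists d => //; apply: computation_step ec' h1.
- move: e; rewrite ec mdelta_atapes; case ec' : (cur_instr c) => [| |a0 a1] // [ea].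
  have [|d h1 h2] := IH hv (perform (if b then a1 else a0) c).
    by rewrite -ea ec mperform_atapes.
  by exists d => //; apply: computation_guess ec' h1.
Qed.

Lemma computation_of_runs k a w v t : runs mach_of_tm k (atapes (init M a)) w v t ->
  exists2 d, computation (init M a) w v d & t = atapes d.
Proof.
move=> [q r e]; have [d h1 [_ h2]] := @computation_of_reach _ _ _ _ _ r e (init M a) erefl.
by exists d.
Qed.

(** Guess strings of a single length [l] suffice. A guess consumes a letter, so both successors
    satisfy the hypothesis for [l - 1]; once [l] is [0] no guess can occur. *)
Lemma halts_within_of_reach B l c :
  (forall w, size w = l -> exists k v ac', [/\ k <= B,
     @reach _ _ mach_of_tm k (c.1, atapes c) w ac' & mdelta ac'.1 (heads ac'.2) = MHalt v]) ->
  halts_within B c.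
Proof.
elim: B l c => [|B IH] l c h.
  have [k [v [ac' [k0 r e]]]] := h (nseq l true) (size_nseq _ _).
  have := reach_inv r e; rewrite mdelta_atapes /=.
  by case: (cur_instr c) => [//|a [k' ek]|a0 a1 [k' [b [u [ek]]]]]; rewrite ek in k0.
rewrite /=; case ec : (cur_instr c) => [//|a|a0 a1].
- apply: (IH l) => w wl; have [k [v [ac' [kB r e]]]] := h w wl.
  have := reach_inv r e; rewrite mdelta_atapes ec => -[k' ek r'].
  by exists k', v, ac'; rewrite mperform_atapes in r'; split=> //; rewrite ek in kB.
- case: l h => [|l] h.
    have [k [v [ac' [kB r e]]]] := h [::] erefl.
    by have := reach_inv r e; rewrite mdelta_atapes ec => -[k' [b [u []]]].
  have hb b : halts_within B (perform (if b then a1 else a0) c).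
    apply: (IH l) => w wl; have [|k [v [ac' [kB r e]]]] := h (b :: w); first by rewrite /= wl.
    have := reach_inv r e; rewrite mdelta_atapes ec => -[k' [b' [u [ek [eb eu]]]]].
    rewrite -eb -eu => r'; rewrite mperform_atapes in r'.
    by exists k', v, ac'; split=> //; rewrite ek in kB.
  by rewrite (hb true) (hb false).
Qed.

End MachOfTM.

(** * Back from functional tapes to Turing machines *)

Section TMOfMach.
Variables (N : nat) (G : finType) (M : mach 'I_N.+1 G).

Definition tm_of_mach : tm :=
  @TM N G (mstate M) (mstart M) (fun q s =>
    match mdelta q s with
    | MHalt v => Halt _ _ _ v
    | MStep a => Step (a.1, [ffun i => a.2 i])
    | MGuess a => Guess ((a false).1, [ffun i => (a false).2 i])
                        ((a true).1, [ffun i => (a true).2 i])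
    end).

(** An equality of machines, so that the facts about [mach_of_tm] apply to constructed machines
    without a further simulation. *)
Lemma tm_of_machK : mach_of_tm tm_of_mach = M.
Proof.
rewrite /mach_of_tm /=; case: M => Q q0 d /=; congr Mach.
apply/funext => q; apply/funext => r.
have -> : (finfun r : _ -> _) = r by apply/funext => i; rewrite ffunE.
have E (f : 'I_N.+1 -> cell G * dir) : (fun i => [ffun i => f i] i) = f.
  by apply/funext => i; rewrite ffunE.
case: (d q r) => [//|[p f]|a] /=; first by rewrite E.
congr MGuess; apply/funext => b; rewrite /= (fun_if (fun x => x.1)) /=.
by case: b; rewrite /= E; case: (a _).
Qed.

Lemma deterministic_tm_of_mach : mdet M -> deterministic tm_of_mach.
Proof.
move=> d q s a0 a1 /=; case e: mdelta => [| |a] //; by case: (d _ _ _ e).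
Qed.

End TMOfMach.

Section Implement.
Variables (k : nat) (J G : finType) (M : mach ('I_k + J)%type G).

(** Argument tapes come first and in order, since [init] writes argument [i] on tape [i]. The spare
    tape keeps the number of tapes positive. *)
Definition place (i : 'I_k + J) : 'I_(k + #|J|).+1 :=
  inord (match i with inl j => nat_of_ord j | inr x => k + enum_rank x end).

Lemma placeE i : place i = match i with inl j => nat_of_ord j | inr x => k + enum_rank x end :> nat.
Proof.
rewrite /place inordK //; case: i => [j|x].
  by have := ltn_ord j; lia.
by rewrite ltnS leq_add2l ltnW ?ltn_ord.
Qed.

Lemma place_inj : injective place.
Proof.
move=> i j /(congr1 (@nat_of_ord _)); rewrite !placeE.
case: i j => [i|x] [j|y].
- by move/val_inj ->.
- by have := ltn_ord i; lia.
- by have := ltn_ord j; lia.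
- by move/addnI/val_inj/enum_rank_inj ->.
Qed.

Definition implement : tm := tm_of_mach (lift place (@id G) M).

Lemma init_implement a : size a = k ->
  atapes (init implement a) = put place (@id G) (fun _ => blank) (@load k J G a).
Proof.
move=> ak; apply/funext => i; rewrite atapes_init.
case: (unindexP place i) => [[j -> _]|[ni _]].
  rewrite put_in; last exact: place_inj.
  rewrite placeE; case: j => [j|x]; first by rewrite lift_wtape.
  by rewrite nth_default ?ak ?leq_addr // wtape_nil; apply/funext.
rewrite put_out // nth_default ?wtape_nil //.
rewrite leqNgt ak; apply/negP => ik.
by apply: (ni (inl (Ordinal ik))); apply/val_inj; rewrite /= placeE.
Qed.

Lemma runs_implement a n w v t : size a = k -> runs M n (load a) w v t ->
  exists2 d, computation (init implement a) w v d &
    atapes d = put place (@id G) (fun _ => blank) t.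
Proof.
move=> ak /(runs_lift place_inj (@inj_id G) (fun _ => blank)) r.
have [|d h1 h2] := @computation_of_runs implement n a w v
  (put place (@id G) (fun _ => blank) t).
  by rewrite init_implement // /implement tm_of_machK.
by exists d.
Qed.

Lemma halts_implement a B l : size a = k ->
  (forall w, size w = l -> exists n v t, n <= B /\ runs M n (load a) w v t) ->
  halts_within B (init implement a).
Proof.
move=> ak h; apply: (@halts_within_of_reach implement B l) => w /h [n [v [t [nB r]]]].
have [q r' e] : runs (mach_of_tm implement) n (atapes (init implement a)) w v
    (put place (@id G) (fun _ => blank) t).
  rewrite init_implement // /implement tm_of_machK.
  exact: (runs_lift place_inj (@inj_id G) (fun _ => blank) r).
by exists n, v, (q, put place (@id G) (fun _ => blank) t).
Qed.

Lemma deterministic_implement : mdet M -> deterministic implement.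
Proof. by move=> d; apply/deterministic_tm_of_mach/mdet_lift. Qed.

End Implement.

(** * Predicates, and exchange with the machine classes of the definitions *)

Definition decides k (P : seq word -> bool) : Prop :=
  exists (J G : finType) (M : mach ('I_k + J)%type G) (q : {poly nat}),
  mdet M /\ forall a, size a = k -> computes M q a (fun v _ => v = P a).

Section Verdict.
Variables (I G : finType) (M : mach I G).

(** Predicates are treated as functions with one-letter values. This machine records a verdict as
    such a letter; [mread] goes the other way. *)
Definition mwrite (o : I) : mach I G :=
  @Mach I G (mstate M + unit)%type (inl (mstart M)) (fun q r =>
    match q with
    | inl q => match mdelta q r with
        | MHalt v => MStep (inr tt, fun i => (if i == o then Some (inl v) else r i, Stay))
        | MStep a => MStep (inl a.1, a.2)
        | MGuess a => MGuess (fun b => (inl (a b).1, (a b).2))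
        end
    | inr _ => MHalt true
    end).

Lemma reach_mwrite o n c w c' : @reach _ _ M n c w c' ->
  @reach _ _ (mwrite o) n (inl c.1, c.2) w (inl c'.1, c'.2).
Proof.
elim=> [{}c|{}n {}c a {}w {}c' e _ IH|{}n {}c a b {}w {}c' e _ IH].
- exact: reach_refl.
- refine (@reach_step _ _ (mwrite o) n (inl c.1, c.2) (inl a.1, a.2) w _ _ IH).
  by rewrite /= e.
- refine (@reach_guess _ _ (mwrite o) n (inl c.1, c.2)
    (fun b => (inl (a b).1, (a b).2)) b w _ _ IH).
  by rewrite /= e.
Qed.

Lemma runs_mwrite o n t w v t' : runs M n t w v t' -> t' o = blank ->
  runs (mwrite o) (n + 1) t w true (mset t' o (wtape G [:: v])).
Proof.
case=> q r h ob; exists (inr tt : mstate (mwrite o)) => //.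
rewrite -[w]cats0; apply: reach_cat (reach_mwrite o r) _.
have := @reach1 _ _ (mwrite o) (inl q, t') _ _; rewrite /= h => /(_ _ erefl).
rewrite /mperform /=; suff -> : (fun i => act (if i == o then Some (inl v) else heads t' i, Stay) (t' i)) = mset t' o (wtape G [:: v]) by [].
 apply/funext => i; rewrite /mset.
case: eqP => [->|_]; last by rewrite act_id.
rewrite ob; apply/funext => -[[|m]|m]; rewrite ?wtapeN ?wtapeE /act /= ?addr0 //.
Qed.

Lemma mdet_mwrite o : mdet M -> mdet (mwrite o).
Proof.
by move=> d [q|q] r a //=; case e: (mdelta q r) => // _; case: (d _ _ _ e).
Qed.

Definition mread (o : I) : mach I G :=
  @Mach I G unit tt (fun _ r => MHalt (r o == Some (inl true))).

Lemma runs_mread o t b : shows (t o) [:: b] -> runs (mread o) 0 t [::] b t.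
Proof.
case=> h _; exists (tt : mstate (mread o)); first exact: reach_refl.
by rewrite /= /heads (h 0) //=; case: b {h}.
Qed.

End Verdict.

Lemma FP_of_decides k P : decides k P -> FP k (fun a => [:: P a]).
Proof.
move=> [J [G [M [q [d h]]]]].
pose e (i : 'I_k + J) : 'I_k + (J + unit) := match i with inl j => inl j | inr x => inr (inl x) end.
have e_inj : injective e by move=> [x|x] [y|y] //= [->].
exists _, G, (mwrite (lift e id M) (inr (inr tt))), (inr (inr tt)), (q + 1%N%:P)%R.
split; first exact/mdet_mwrite/mdet_lift.
move=> a ak; have [n [v [t [hn r <-]]]] := h a ak.
rewrite pevalD pevalC; split; first by rewrite /=; lia.
have r' := runs_lift e_inj (@inj_id G) (fun _ => blank) r.
have o_blank : put e id (fun _ => blank) t (inr (inr tt)) = blank.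
  by rewrite put_out // => -[].
exists (n + 1), true, (mset (put e id (fun _ => blank) t) (inr (inr tt)) (wtape G [:: v])).
split; first by rewrite pevalD pevalC; lia.
- have := runs_mwrite r' o_blank; congr runs; apply/funext => i.
  case: (unindexP e i) => [[j -> _]|[ni _]].
    by rewrite put_in //; case: j => j /=; rewrite ?lift_wtape.
  by rewrite put_out //; case: i ni => [i|//] ni; case: (ni (inl i)).
- by rewrite /mset eqxx; apply: shows_wtape.
Qed.

Lemma decides_of_FP k P : FP k (fun a => [:: P a]) -> decides k P.
Proof.
move=> [J [G [M [out [q [d h]]]]]].
exists J, G, (mseq M (mread G out)), (q + 1%N%:P)%R; split; first exact: mdet_mseq.
move=> a ak; have [_ [n [v [t [hn r s]]]]] := h a ak.
exists (n + 1), (P a), t; split=> //; first by rewrite pevalD pevalC; lia.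
by have := runs_mseq r (runs_mread s).
Qed.

Section Import_tm.
Variables (k : nat) (M : tm).

(** The machine may have fewer than [k] tapes, and then misses the later arguments just as with
    [init], or more, and then the further ones become private tapes. *)
Definition tape_slot (i : 'I_(ntapes M).+1) : 'I_k + 'I_(ntapes M).+1 :=
  if insub (nat_of_ord i) is Some j then inl j else inr i.

Lemma tape_slot_inj : injective tape_slot.
Proof.
move=> i j; rewrite /tape_slot.
case: insubP => [x _ ex|_]; case: insubP => [y _ ey|_] //.
- by move=> [xy]; apply/val_inj/(etrans (esym ex))/(etrans _ ey); rewrite xy.
- by move=> [].
Qed.

Lemma put_init a (T : tapes ('I_k + 'I_(ntapes M).+1)%type (aux M)) : size a = k -> (forall i, T (inr i) = blank) ->
  (forall j, T (inl j) = wtape (aux M) (nth [::] a j)) ->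
  put tape_slot id T (atapes (init M a)) = T.
Proof.
move=> ak Tr Tl; apply/funext => i; case: (unindexP tape_slot i) => [[j -> _]|[ni _]].
  rewrite put_in; last exact: tape_slot_inj.
  rewrite atapes_init lift_wtape /tape_slot.
  case: insubP => [x _ <-|]; first by rewrite Tl.
  by rewrite -leqNgt => h; rewrite Tr nth_default ?ak // wtape_nil.
by rewrite put_out.
Qed.

Lemma runs_import a n w v d : size a = k ->
  computation (init M a) w v d -> halts_within n (init M a) ->
  exists2 m, m <= n & runs (lift tape_slot id (mach_of_tm M)) m (load a) w v
    (put tape_slot id (@load k _ _ a) (atapes d)).
Proof.
move=> ak h1 h2; have [m mn r] := runs_of_computation h1 h2.
exists m => //; have := runs_lift tape_slot_inj (@inj_id _) (@load k _ _ a) r.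
by rewrite put_init.
Qed.

Lemma mdet_mach_of_tm : deterministic M -> mdet (mach_of_tm M).
Proof.
by move=> d q r a /=; case e: delta => [| |a0 a1] // _; case: (d _ _ _ _ e).
Qed.

End Import_tm.

Lemma deterministic_halts M n (c : config M) : deterministic M -> halts_within n c ->
  exists v d, computation c [::] v d.
Proof.
move=> dM; elim: n c => [|n IH] c /=; case e: (cur_instr c) => [v|a|a0 a1] //;
  try by move=> _; exists v, c; apply: computation_halt.
- by move/IH=> [v [d h]]; exists v, d; apply: computation_step e h.
- by case: (dM _ _ _ _ e).
Qed.

(** [polytime] speaks about steps only; the length bound asked for here is supplied by the endpoint
    condition when the lemma is applied. *)
Lemma FP_of_FPt (g : word -> word) p : FPt g ->
  (forall x, size (g x) <= peval p (size x)) -> FP 1 (fun a => g (arg a 0)).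
Proof.
move=> [M [dM [q hq] hM]] gp.
exists _, _, (lift (@tape_slot 1 M) id (mach_of_tm M)), (tape_slot 1 ord0), (p + q)%R.
split; first exact/mdet_lift/mdet_mach_of_tm.
move=> [|x [|]] //= _; rewrite pevalD.
have tE : total [:: x] = size x by rewrite /total big_seq1.
split; first by rewrite tE; have := gp x; lia.
have [v [d [h1 h2]]] := hM x.
have hh := hq [tuple x]; rewrite -/(total _) /= in hh.
have [m mn r] := @runs_import 1 M [:: x] _ _ _ _ erefl h1 hh.
exists m, v, (put (@tape_slot 1 M) id (load [:: x]) (atapes d)).
split; [by rewrite pevalD; lia | exact: r | ].
rewrite put_in; last exact: tape_slot_inj.
by rewrite -h2; apply/shows_lift/shows_leading_bits.
Qed.

Lemma FP_of_polytime_pred3 R : polytime_pred3 R ->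
  FP 3 (fun a => [:: `[< R (arg a 0) (arg a 1) (arg a 2) >]]).
Proof.
move=> [M [dM [q hq] hM]]; apply: FP_of_decides.
exists _, _, (lift (@tape_slot 3 M) id (mach_of_tm M)), q.
split; first exact/mdet_lift/mdet_mach_of_tm.
move=> [|x [|y [|z [|]]]] //= _.
have hh := hq [tuple x; y; z]; rewrite -/(total _) /= in hh.
have [v [d h]] := deterministic_halts dM hh.
have [m mn r] := @runs_import 3 M [:: x; y; z] _ _ _ _ erefl h hh.
exists m, v, (put (@tape_slot 3 M) id (load [:: x; y; z]) (atapes d)); split=> //.
apply/esym/asboolP; case: v h r => h _.
  by apply/hM; exists d.
by move/hM => [d' /(computation_det h) []].
Qed.

Lemma polytime_pred3_of_FP R :
  FP 3 (fun a => [:: `[< R (arg a 0) (arg a 1) (arg a 2) >]]) -> polytime_pred3 R.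
Proof.
move=> /decides_of_FP [J [G [M [q [d h]]]]].
exists (implement M); split; first exact: deterministic_implement.
  exists q => a; rewrite -/(total _).
  have [n [v [t [hn r _]]]] := h a (size_tuple a).
  (* A deterministic run consumes the empty guess string, hence the length [0]. *)
  apply: (@halts_implement _ _ _ M a _ 0 (size_tuple a)) => -[|//] _.
  by exists n, v, t.
move=> x y z; have [n [v [t [hn r ev]]]] := h [:: x; y; z] erefl.
have [c hc _] := @runs_implement _ _ _ M [:: x; y; z] _ _ _ _ erefl r.
rewrite /= in ev; split=> [hR|[c' hc']].
  by exists c; rewrite ev asboolT in hc.
by apply/asboolP; rewrite -ev; have [-> _] := computation_det hc hc'.
Qed.

(** * Simulation along a guess string *)

(* Padding with zeros turns accepting paths into strings of any prescribed larger length,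
   one for each path. *)
Definition padded_path M (x s : word) : Prop :=
  exists w j, s = w ++ nseq j false /\ accepting_path M [:: x] w.

Section Simulation.
Variable M : tm.
Let I := ('I_2 + 'I_(ntapes M).+1)%type.

Definition guess_tape : I := inl ord_max.

Definition sim_slot (i : 'I_(ntapes M).+1) : I := if i == ord0 then inl ord0 else inr i.

Lemma sim_slot_inj : injective sim_slot.
Proof.
move=> i j; rewrite /sim_slot.
by case: eqP => [->|_]; case: eqP => [->|_] // [].
Qed.

Lemma sim_slot_guess i : guess_tape <> sim_slot i.
Proof. by rewrite /sim_slot; case: eqP. Qed.

(** Guesses are replaced by letters read from [guess_tape]; running out of letters means rejection.
    When [M] accepts, state [inr tt] checks that only zeros remain. *)
Definition simulator : mach I (aux M) :=
  @Mach I (aux M) (state M + unit)%type (inl (start M)) (fun q r =>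
    let stay := fun i => (r i, Stay) in
    let next := fun i => (r i, if i == guess_tape then Right else Stay) in
    match q with
    | inl q =>
        match mdelta (m := mach_of_tm M) q (fun j => unlift_cell id (r (sim_slot j))) with
        | MHalt v => if v then MStep (inr tt, stay) else MHalt false
        | MStep a => MStep (inl a.1, lift_action sim_slot id r a.2)
        | MGuess a => if r guess_tape is Some (inl b) then
            MStep (inl (a b).1, fun i => if i == guess_tape then next i
                                         else lift_action sim_slot id r (a b).2 i)
            else MHalt false
        end
    | inr _ => match r guess_tape with
        | Some (inl false) => MStep (inr tt, next)
        | Some _ => MHalt false
        | None => MHalt true
        end
    end).

Lemma mdet_simulator : mdet simulator.
Proof.
move=> [q|q] r a /=.
- by case: (delta _ _) => [[]|?|??] //=; case: (r guess_tape) => [[]|].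
- by case: (r guess_tape) => [[[]|]|].
Qed.

Variable s : word.

Definition sim_load (t : tapes 'I_(ntapes M).+1 (aux M)) (k : nat) : tapes I (aux M) :=
  mset (put sim_slot id (fun _ => blank) t) guess_tape (shift k (wtape (aux M) s)).

Lemma sim_load_guess t k : sim_load t k guess_tape = shift k (wtape (aux M) s).
Proof. by rewrite /sim_load /mset eqxx. Qed.

Lemma heads_sim t k :
  (fun j => unlift_cell id (heads (sim_load t k) (sim_slot j))) = heads t.
Proof.
apply/funext => j; rewrite /heads /sim_load /mset ifN; last first.
  by apply/eqP => /esym; apply: sim_slot_guess.
by rewrite put_in ?lift_cellK //; apply: sim_slot_inj.
Qed.

Lemma act_sim t k a :
  (fun i => act (lift_action sim_slot id (heads (sim_load t k)) a i) (sim_load t k i)) =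
  sim_load (fun j => act (a j) (t j)) k.
Proof.
apply/funext => i; rewrite /sim_load -act_put /mset.
case: (altP (i =P guess_tape)) => [->|ni].
  rewrite /lift_action; case: (unindexP sim_slot guess_tape) => [[j /sim_slot_guess]|[_ ->]] //.
  by rewrite /heads eqxx act_id.
rewrite /lift_action; case: (unindexP sim_slot i) => [[j _ ->]|[_ ->]] //.
by rewrite /heads (negbTE ni).
Qed.

Lemma act_sim_guess t k a :
  (fun i => act (if i == guess_tape then
                   (heads (sim_load t k) i, if i == guess_tape then Right else Stay)
                 else lift_action sim_slot id (heads (sim_load t k)) a i) (sim_load t k i)) =
  sim_load (fun j => act (a j) (t j)) k.+1.
Proof.
apply/funext => i; case: (altP (i =P guess_tape)) => [->|ni].
  rewrite !sim_load_guess /heads sim_load_guess {1}/shift add0r act_shift.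
  by have -> : (k%:Z + offset Right)%R = k.+1 by rewrite /=; lia.
have := congr1 (@^~ i) (act_sim t k a); rewrite /= => ->.
by rewrite /sim_load /mset (negbTE ni).
Qed.

Lemma act_sim_next t k :
  (fun i => act (heads (sim_load t k) i, if i == guess_tape then Right else Stay)
                (sim_load t k i)) = sim_load t k.+1.
Proof.
apply/funext => i; case: (altP (i =P guess_tape)) => [->|ni].
  rewrite !sim_load_guess /heads sim_load_guess {1}/shift add0r act_shift.
  by have -> : (k%:Z + offset Right)%R = k.+1 by rewrite /=; lia.
by rewrite act_id /sim_load /mset (negbTE ni).
Qed.

Lemma heads_guess t k : heads (sim_load t k) guess_tape = omap inl (onth s k).
Proof.
rewrite /heads sim_load_guess /shift add0r wtapeE; case: ltnP => h.
  by rewrite onth_lt.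
by rewrite onth_default.
Qed.

Definition sim_result (q : mstate simulator) (t : tapes I (aux M)) B (P : Prop) : Prop :=
  exists n q' t' v, [/\ n <= B, @reach _ _ simulator n (q, t) [::] (q', t'),
    mdelta q' (heads t') = MHalt v & v <-> P].

Lemma sim_result_step q t q' t' B P :
  @reach _ _ simulator 1 (q, t) [::] (q', t') ->
  sim_result q' t' B P -> sim_result q t B.+1 P.
Proof.
move=> r [n [q1 [t1 [v [nB r1 e ev]]]]]; exists n.+1, q1, t1, v; split=> //.
exact: (reach_cat0 r r1).
Qed.

Lemma sim_result_ext q t B B' (P P' : Prop) : B <= B' -> (P <-> P') ->
  sim_result q t B P -> sim_result q t B' P'.
Proof.
move=> BB PP [n [q' [t' [v [h1 h2 h3 h4]]]]]; exists n, q', t', v.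
by split=> //; [apply: leq_trans h1 BB | rewrite h4].
Qed.

Lemma sim_check t k B : size s <= k + B ->
  sim_result (inr tt) (sim_load t k) B (all negb (drop k s)).
Proof.
elim: B k => [|B IH] k sk.
  rewrite addn0 in sk; rewrite drop_oversize //.
  exists 0, (inr tt), (sim_load t k), true; split=> //; first exact: reach_refl.
  by rewrite /= heads_guess onth_default.
case: (ltnP k (size s)) => ks; last first.
  rewrite drop_oversize //.
  exists 0, (inr tt), (sim_load t k), true; split=> //; first exact: reach_refl.
  by rewrite /= heads_guess onth_default.
rewrite (drop_nth false ks) /=; case eb : (nth false s k) => /=.
  exists 0, (inr tt), (sim_load t k), false; split=> //; first exact: reach_refl.
  by rewrite /= heads_guess onth_lt //= eb.
apply: sim_result_step (IH k.+1 _); last by lia.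
have := @reach1 _ _ simulator (inr tt, sim_load t k) _ _.
rewrite /= heads_guess onth_lt //= eb => /(_ _ erefl).
by rewrite /mperform /= act_sim_next.
Qed.

Definition padded_from (c : config M) (s : word) : Prop :=
  exists w j d, s = w ++ nseq j false /\ computation c w true d.

Lemma all_negb (w : word) : all negb w -> w = nseq (size w) false.
Proof. by elim: w => // -[] // w IH /= /IH <-. Qed.

Lemma mdelta_simulator (c : config M) k :
  mdelta (m := simulator) (inl c.1) (heads (sim_load (atapes c) k)) =
  match cur_instr c with
  | Halt v => if v then MStep (inr tt, fun i => (heads (sim_load (atapes c) k) i, Stay))
              else MHalt false
  | Step a => MStep (inl a.1,
      lift_action sim_slot id (heads (sim_load (atapes c) k)) (fun i => a.2 i))
  | Guess a0 a1 => if onth s k is Some b then let a := if b then a1 else a0 in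
      MStep (inl a.1, fun i => if i == guess_tape then
          (heads (sim_load (atapes c) k) i, if i == guess_tape then Right else Stay)
        else lift_action sim_slot id (heads (sim_load (atapes c) k)) (fun i => a.2 i) i)
      else MHalt false
  end.
Proof.
have := mdelta_atapes c; rewrite [LHS]/= => e.
rewrite [LHS]/= heads_sim heads_guess e.
case: (cur_instr c) => [v|a|a0 a1] //.
by case: (onth s k) => [[]|].
Qed.

(** At most [n] steps follow [M], one switches to the check, and the check takes one step per
    remaining letter. *)
Lemma sim_run n (c : config M) k : halts_within n c ->
  sim_result (inl c.1) (sim_load (atapes c) k) (n + (size s - k) + 1) (padded_from c (drop k s)).
Proof.
(* From a halting configuration the only path is the empty one, so all that remains of the guess
   string has to be padding. *)
have halt v c1 k1 B : cur_instr c1 = Halt _ _ _ v -> size s - k1 <= B ->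
    sim_result (inl c1.1) (sim_load (atapes c1) k1) B.+1 (padded_from c1 (drop k1 s)).
  move=> e kB; have := mdelta_simulator c1 k1; rewrite e; case: v e => e em; last first.
    exists 0, (inl c1.1), (sim_load (atapes c1) k1), false; split=> //.
      exact: reach_refl.
    split=> // -[w [j [d [_ h]]]].
    by have [] := @computation_inj _ c1 [::] false c1 w true d (computation_halt e) h.
  apply: (@sim_result_ext _ _ B.+1 B.+1 (all negb (drop k1 s))) => //.
    split=> [/all_negb h|[w [j [d [es h]]]]].
      by exists [::], (size (drop k1 s)), c1; split=> //; apply: computation_halt.
    have [ew _ _] := @computation_inj _ c1 [::] true c1 w true d (computation_halt e) h.
    by rewrite es ew all_nseq orbT.
  apply: (@sim_result_step _ _ (inr tt) (sim_load (atapes c1) k1)); last by apply: sim_check; lia.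
  have := @reach1 _ _ simulator (inl c1.1, sim_load (atapes c1) k1) _ em.
  by congr (reach _ _ _ (_, _)); apply/funext => i; exact: act_id.
elim: n c k => [|n IH] c k /=; case ec: (cur_instr c) => [v|a|a0 a1] // hn.
- by rewrite addn1; apply: halt ec _; lia.
- by rewrite addn1; apply: halt ec _; lia.
- have h := IH _ k hn; rewrite -[n.+1 + _ + 1]/(n + (size s - k) + 1).+1.
  apply: (@sim_result_ext _ _ (n + (size s - k) + 1).+1 _ (padded_from (perform a c) (drop k s))) => //.
    split=> -[w [j [d [es hd]]]]; exists w, j, d; split=> //.
      exact: computation_step ec hd.
    by have := computation_inv hd; rewrite ec.
  apply: sim_result_step h; have := mdelta_simulator c k; rewrite ec => em.
  have := @reach1 _ _ simulator (inl c.1, sim_load (atapes c) k) _ em.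
  rewrite /mperform /= act_sim; congr (reach _ _ _ (_, sim_load _ _)).
  by have := mperform_atapes a c; rewrite /mperform /= => -[].
- have := mdelta_simulator c k; rewrite ec.
  case: (ltnP k (size s)) => ks; last first.
    rewrite onth_default // => em.
    exists 0, (inl c.1), (sim_load (atapes c) k), false; split=> //; first exact: reach_refl.
    split=> // -[w [j [d [es hd]]]]; rewrite drop_oversize // in es.
    by have := computation_inv hd; rewrite ec => -[b [u [ew _]]]; rewrite ew in es.
  rewrite onth_lt //; set b := nth false s k => em.
  have hb : halts_within n (perform (if b then a1 else a0) c).
    by case/andP: hn; case: (b).
  have h := IH _ k.+1 hb.
  apply: (@sim_result_ext _ _ (n + (size s - k.+1) + 1).+1 _
    (padded_from (perform (if b then a1 else a0) c) (drop k.+1 s))); first by lia.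
    split=> -[w [j [d [es hd]]]].
      exists (b :: w), j, d; split; last exact: computation_guess ec hd.
      by rewrite (drop_nth false ks) es.
    rewrite (drop_nth false ks) -/b in es.
    have := computation_inv hd; rewrite ec => -[b' [u [ew hu]]].
    by move: es; rewrite ew => -[-> es]; exists u, j, d.
  apply: sim_result_step h.
  have := @reach1 _ _ simulator (inl c.1, sim_load (atapes c) k) _ em.
  rewrite /mperform /= act_sim_guess; congr (reach _ _ _ (_, sim_load _ _)).
  by have := mperform_atapes (if b then a1 else a0) c; rewrite /mperform /= => -[].
Qed.

End Simulation.

Lemma decides_padded_path M : NPTM M ->
  decides 2 (fun a => `[< padded_path M (arg a 0) (arg a 1) >]).
Proof.
move=> [q hq]; exists _, _, (simulator M), (q + 'X + 1%N%:P)%R; split; first exact: mdet_simulator.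
move=> [|x [|s [|]]] //= _.
have hh := hq [tuple x]; rewrite -/(total _) /= in hh.
have [n [c [t [v [h1 h2 h3 h4]]]]] := @sim_run M s _ _ 0 hh.
exists n, v, t; split.
- rewrite !pevalD pevalX pevalC; have : total [:: x] <= total [:: x; s] by rewrite !total_cons; lia.
  by move/(leq_peval q); move: h1; rewrite !total_cons; lia.
- exists c => //; move: h2; congr (reach _ (_, _) _ _).
  apply/funext => i; rewrite /sim_load /mset shift0; case: eqP => [->|ni] //.
  case: (unindexP (@sim_slot M) i) => [[j -> _]|[nj _]].
    rewrite put_in ?atapes_init; last exact: sim_slot_inj.
    rewrite lift_wtape /sim_slot; case: eqP => [->|/eqP j0] //=.
    by rewrite nth_default /= ?wtape_nil // lt0n.
  rewrite put_out //; case: i ni nj => [i|i] ni nj //=.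
  case: (altP (i =P ord0)) => [i0|i0].
    by case: (nj ord0); rewrite /sim_slot eqxx i0.
  case: ni; congr inl; apply/val_inj; move: i0; clear; by case: i => -[|[|]].
- apply/idP/asboolP; rewrite h4 drop0.
    by move=> [w [j [d [es hd]]]]; exists w, j; split=> //; exists d.
  by move=> [w [j [es [d hd]]]]; exists w, j, d.
Qed.

(** * Guessing certificates *)

Section GuessLoop.
Variables (I G : finType) (count guess : I).
Hypothesis cg : count != guess.

(** The states mean guessing one bit per letter of [count], rewinding [guess], and done. The head on
    [count] is left at the end of its word, so that tape is not restored. *)
Definition mguess : mach I G :=
  @Mach I G (option bool) (Some true) (fun q r =>
    let go c d d' := fun i => if i == guess then (c, d) else
                              if i == count then (r i, d') else (r i, Stay) in
    match q with
    | Some true => if is_bit (r count)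
        then MGuess (fun b => (Some true, go (Some (inl b)) Right Right))
        else MStep (Some false, go (r guess) Left Stay)
    | Some false => if is_bit (r guess)
        then MStep (Some false, go (r guess) Left Stay)
        else MStep (None, go (r guess) Right Stay)
    | None => MHalt true
    end).

Variable T : tapes I G.

Definition guess_tapes (k l : int) (w : word) : tapes I G := fun i =>
  if i == guess then shift l (wtape G w) else
  if i == count then shift k (T count) else T i.

Lemma gtapeE k l w : guess_tapes k l w guess = shift l (wtape G w).
Proof. by rewrite /guess_tapes eqxx. Qed.

Lemma countE k l w : guess_tapes k l w count = shift k (T count).
Proof. by rewrite /guess_tapes (negbTE cg) eqxx. Qed.

Lemma heads_gtape k l w : heads (guess_tapes k l w) guess = wtape G w l.
Proof. by rewrite /heads /guess_tapes eqxx /shift add0r. Qed.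

Lemma heads_count k l w : heads (guess_tapes k l w) count = T count k.
Proof. by rewrite /heads /guess_tapes (negbTE cg) eqxx /shift add0r. Qed.

Lemma act_guess_tapes (k l : int) w c d d' w' :
  aset (wtape G w) l c = wtape G w' ->
  (fun i => act (if i == guess then (c, d) else
                 if i == count then (heads (guess_tapes k l w) i, d')
                 else (heads (guess_tapes k l w) i, Stay)) (guess_tapes k l w i)) =
  guess_tapes (k + offset d')%R (l + offset d)%R w'.
Proof.
move=> e; apply/funext => i; case: (altP (i =P guess)) => [->|ng].
  by rewrite !gtapeE act_shiftE e.
case: (altP (i =P count)) => [->|nc]; last first.
  by rewrite act_id /guess_tapes (negbTE ng) (negbTE nc).
by rewrite heads_count !countE act_shift.
Qed.

Lemma runs_mguess u w : shows (T count) u -> T guess = blank -> size w = size u ->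
  exists t', [/\ runs mguess (2 * size u + 2) T w true t', t' guess = wtape G w
    & forall i, i != guess -> i != count -> t' i = T i].
Proof.
move=> [u1 u2] gb sw; rewrite -sw.
have forth v z : v ++ z = w -> @reach I G mguess (size z)
    (Some true, guess_tapes (size v) (size v) v) z
    (Some true, guess_tapes (size w) (size w) w).
  elim: z v => [|b z IH] v vz; first by rewrite cats0 in vz; rewrite vz; apply: reach_refl.
  have hc : is_bit (heads (guess_tapes (size v) (size v) v) count).
    by rewrite heads_count u1 // -sw -vz size_cat /=; lia.
  refine (@reach_guess I G mguess _ (Some true, guess_tapes (size v) (size v) v) _ b z _ _ _).
    by rewrite /= hc.
  rewrite /mperform /= (@act_guess_tapes _ _ _ _ _ _ (rcons v b)).
    have := IH (rcons v b); rewrite cat_rcons => /(_ vz).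
    by rewrite size_rcons; have -> : ((size v)%:Z + 1)%R = (size v).+1 by lia.
  apply/funext => -[n|n]; last by rewrite /aset; case: eqP => // _; rewrite !wtapeN.
  rewrite /aset !wtapeE size_rcons ltnS nth_rcons.
  have -> : (Posz n == Posz (size v)) = (n == size v) by [].
  by case: ltngtP.
have turn : @reach I G mguess 1 (Some true, guess_tapes (size w) (size w) w) [::]
    (Some false, guess_tapes (size w) ((size w)%:Z - 1)%R w).
  have := @reach1 I G mguess (Some true, guess_tapes (size w) (size w) w) _ _.
  rewrite /= {1}heads_count sw (negbTE u2) -sw => /(_ _ erefl).
  by rewrite /mperform /= heads_gtape (@act_guess_tapes _ _ _ _ _ _ w) ?aset_id //= addr0.
have back k : k <= size w -> @reach I G mguess k.+1
    (Some false, guess_tapes (size w) (k%:Z - 1)%R w) [::] (None, guess_tapes (size w) 0 w).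
  elim: k => [_|k IH kw].
    have := @reach1 I G mguess (Some false, guess_tapes (size w) (-1)%R w) _ _.
    rewrite /= {1}heads_gtape wtapeN => /(_ _ erefl).
    by rewrite /mperform /= heads_gtape (@act_guess_tapes _ _ _ _ _ _ w) ?aset_id //= addr0.
  rewrite -add1n; apply: reach_cat0 (IH (ltnW kw)).
  have e : (k.+1%:Z - 1 = k)%R by lia.
  have := @reach1 I G mguess (Some false, guess_tapes (size w) (k.+1%:Z - 1)%R w) _ _.
  rewrite /= e {1}heads_gtape wtapeE kw => /(_ _ erefl).
  by rewrite /mperform /= heads_gtape (@act_guess_tapes _ _ _ _ _ _ w) ?aset_id //= addr0.
exists (guess_tapes (size w) 0 w); split.
- exists (None : mstate mguess) => //.
  have := reach_cat (forth [::] w erefl) (reach_cat turn (back _ (leqnn _))).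
  rewrite /= cats0; have -> : size w + (1 + (size w).+1) = 2 * size w + 2 by lia.
  congr (reach _ (_, _) _ _); apply/funext => i; rewrite /guess_tapes wtape_nil shift0.
  by case: eqP => [->|_] //; case: eqP => [->|_]; rewrite ?shift0.
- by rewrite /guess_tapes eqxx shift0.
- by move=> i /negbTE ng /negbTE nc; rewrite /guess_tapes ng nc.
Qed.

End GuessLoop.

(** The normal form of every nondeterministic machine built below. All guesses are made before the
    deterministic check, and their number depends on [x] alone; balance is thereby built in. *)
Lemma guess_and_check (u : word -> word) (V : word -> word -> bool) :
  FP 1 (fun a => u (arg a 0)) -> FP 2 (fun a => [:: V (arg a 0) (arg a 1)]) ->
  exists M, [/\ NPTM M,
    forall x w, complete_path M [:: x] w <-> size w = size (u x) &
    forall x w, accepting_path M [:: x] w <-> size w = size (u x) /\ V x w].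
Proof.
move=> [JU [GU [MU [outU [qU [_ hU]]]]]] /decides_of_FP [JV [GV [MV [qV [_ hV]]]]].
pose I := ('I_1 + (('I_1 + JU) + (unit + JV)))%type.
pose eU (i : 'I_1 + JU) : I := inr (inl i).
pose guess : I := inr (inr (inl tt)).
pose eV (i : 'I_2 + JV) : I := match i with
  | inl j => if j == ord0 then inl ord0 else guess
  | inr y => inr (inr (inr y)) end.
have eU_inj : injective eU by move=> i j [].
have eV_inj : injective eV.
  move=> [i|x] [j|y] //=; rewrite /eV.
  - case: (altP (i =P ord0)) => [->|i0]; case: (altP (j =P ord0)) => [->|j0] // _.
    congr inl; apply/val_inj; move: i0 j0; clear.
    by case: i j => -[|[|]] // ? [[|[|]]].
  - by case: eqP.
  - by case: eqP.
  - by move=> [->].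
pose G := (GU + GV)%type.
pose M : mach I G := mseq (mcopy G (inl ord0) (eU (inl ord0)))
  (mseq (lift eU inl MU) (mseq (mguess G (eU outU) guess) (lift eV inr MV))).
(* Copying, computing [u], guessing, checking. The [5] is the [2] of the guessing loop and three
   transitions in [mseq]. *)
pose Q : {poly nat} := (2%N%:P * 'X + 2%N%:P + qU + 2%N%:P * qU + (qV \Po ('X + qU)) + 5%N%:P)%R.
have main x w : size w = size (u x) -> exists n t,
    n <= peval Q (size x) /\ runs M n (@load 1 _ _ [:: x]) w (V x w) t.
  move=> sw; have [hu [n1 [v1 [t1 [hn1 r1 s1]]]]] := hU [:: x] erefl.
  have [n2 [v2 [t2 [hn2 r2 ev2]]]] := hV [:: x; w] erefl.
  rewrite /= in hu s1 ev2.
  have ex : total [:: x] = size x by rewrite /total big_seq1.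
  have exw : total [:: x; w] = size x + size w by rewrite total_cons /total big_seq1.
  pose T0 : tapes I G := @load 1 _ _ [:: x].
  have rc : runs (mcopy G (inl ord0) (eU (inl ord0))) (2 * size x + 2) T0 [::] true
      (mset T0 (eU (inl ord0)) (wtape G x)).
    have := @runs_mcopy I G (inl ord0) (eU (inl ord0)) isT T0 x (shows_wtape _ _) isT.
    by rewrite [T0 (eU _)]/= overwrite_blank.
  set T1 := mset T0 _ _ in rc.
  have rU := runs_lift eU_inj (@inl_injective GU GV) T1 r1.
  have eT1 : put eU inl T1 (@load 1 _ _ [:: x]) = T1.
    apply/funext => i; case: (unindexP eU i) => [[j -> _]|[ni _]]; last by rewrite put_out.
    rewrite put_in //; case: j => [j|j] /=; last by rewrite /T1 /mset /=; apply/funext.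
    by rewrite lift_wtape !ord1 /T1 /mset eqxx.
  rewrite eT1 in rU; set T2 := put _ _ _ t1 in rU.
  have cnt : shows (T2 (eU outU)) (u x) by rewrite /T2 put_in //; apply: shows_lift.
  have gb : T2 guess = blank by rewrite /T2 put_out.
  have [T3 [rG g1 g2]] := @runs_mguess I G (eU outU) guess isT T2 (u x) w cnt gb sw.
  have rV := runs_lift eV_inj (@inr_injective GU GV) T3 r2.
  have eT3 : put eV inr T3 (@load 2 _ _ [:: x; w]) = T3.
    apply/funext => i; case: (unindexP eV i) => [[j -> _]|[ni _]]; last by rewrite put_out.
    rewrite put_in //; case: j => [j|j] /=; last first.
      by rewrite g2 // /T2 put_out // /T1 /mset /=; apply/funext.
    rewrite lift_wtape; case: (altP (j =P ord0)) => [->|j0] /=.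
      by rewrite g2 // /T2 put_out // /T1 /mset /=.
    by rewrite g1; move: j0; clear; case: j => -[|[|]].
  rewrite eT3 ev2 in rV.
  have := runs_mseq rc (runs_mseq rU (runs_mseq rG rV)); rewrite /= cats0 => r.
  exists (2 * size x + 2 + (n1 + (2 * size (u x) + 2 + n2.+1).+1).+1), (put eV inr T3 t2); split; last exact: r.
  rewrite /Q !(pevalD, peval_comp, pevalM, pevalC, pevalX).
  rewrite ex in hu hn1; rewrite exw in hn2.
  have : peval qV (size x + size w) <= peval qV (size x + peval qU (size x)).
    by apply: leq_peval; lia.
  lia.
have comp x w : size w = size (u x) -> exists d,
    computation (init (implement M) [:: x]) w (V x w) d.
  by move=> /main [n [t [_ r]]]; have [d h _] := runs_implement (a := [:: x]) erefl r; exists d.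
(* A path of another length would be a proper prefix or a proper extension of a path of length
   [size (u x)], against [computation_inj]. *)
have size_path x w v d : computation (init (implement M) [:: x]) w v d ->
    size w = size (u x) /\ v = V x w.
  move=> h; set l := size (u x).
  case: (leqP (size w) l) => hl.
    have [|d' h'] := comp x (w ++ nseq (l - size w) true).
      by rewrite size_cat size_nseq subnKC.
    have [e -> _] := computation_inj h h'; rewrite e cats0; split=> //.
    by move/(congr1 size): e; rewrite size_nseq /=; lia.
  have [|d' h'] := comp x (take l w); first by rewrite size_takel // ltnW.
  move: h; rewrite -{1}(cat_take_drop l w) => h.
  by have [e] := computation_inj h' h; move/(congr1 size): e; rewrite size_drop /=; lia.
exists (implement M); split.
- exists Q => a; rewrite -/(total _).
  case: a => -[|x [|]] //= ?.
  apply: (@halts_implement _ _ _ M [:: x] _ (size (u x))) => // w /main [n [t [hn r]]].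
  by exists n, (V x w), t; rewrite total_cons /total big_nil addn0.
- move=> x w; split=> [[v [d /size_path []]] //|/comp [d h]].
  by exists (V x w), d.
- move=> x w; split=> [[d /size_path []] //|[/comp [d h] hv]].
  by exists d; rewrite hv in h.
Qed.

(** * Lexicographic rank *)

(** Binary notation with the most significant letter first, so that lexicographic comparison of
    strings of equal length becomes comparison of numbers. *)
Fixpoint value (w : word) : nat := if w is b :: w' then b * 2 ^ size w' + value w' else 0.

Lemma value_lt w : value w < 2 ^ size w.
Proof. by elim: w => //= -[] w IH; rewrite expnS; lia. Qed.

Lemma value_inj x y : size x = size y -> value x = value y -> x = y.
Proof.
elim: x y => [|b x IH] [|c y] //= [sxy]; have := value_lt x; have := value_lt y.
by rewrite -sxy; case: b c => [] [] hy hx e; try (congr cons; apply: IH => //); lia.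
Qed.

Lemma value_nseq_false n : value (nseq n false) = 0.
Proof. by elim: n. Qed.

Lemma value_nseq_true n : (value (nseq n true)).+1 = 2 ^ n.
Proof. by elim: n => //= n IH; rewrite size_nseq expnS; lia. Qed.

Lemma succ_wordE x y : size x = size y -> succ_word x y = (value y == (value x).+1).
Proof.
elim: x y => [|b x IH] [|c y] //= [sxy]; rewrite IH // sxy eqxx andbT.
have hx := value_lt x; have hy := value_lt y; rewrite sxy in hx.
(* A carry runs through all of [x] exactly if its value is maximal for its length. *)
have E1 : all id x = ((value x).+1 == 2 ^ size y).
  rewrite -sxy -value_nseq_true eqSS; apply/idP/eqP => [h|h].
    by congr value; elim: (x) h => // -[] // v IHv /= /IHv {1}->.
  by rewrite (@value_inj x (nseq (size x) true)) ?size_nseq // all_nseq orbT.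
have E2 : all negb y = (value y == 0).
  apply/idP/eqP => [/all_negb ->|h]; first exact: value_nseq_false.
  by rewrite (@value_inj y (nseq (size y) false)) ?size_nseq ?value_nseq_false // all_nseq orbT.
by rewrite E1 E2; case: b c => [] [] /=; lia.
Qed.

Section Tuples.
Variable m : nat.
Implicit Types a b : m.-tuple bool.

Lemma value_tuple_inj a b : value a = value b -> a = b.
Proof. by move=> h; apply/val_inj/value_inj; rewrite ?size_tuple. Qed.

Lemma value_tuple_lt a : value a < 2 ^ m.
Proof. by have := value_lt a; rewrite size_tuple. Qed.

Lemma lexleE a b : lexle a b = (value a <= value b).
Proof.
rewrite /lexle -[LHS]/((val a : seqlexi bool) <= (val b : seqlexi bool))%O.
rewrite -[value a]/(value (val a)) -[value b]/(value (val b)).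
have : size (val a) = size (val b) by rewrite !size_tuple.
elim: (val a) (val b) => [|c x IH] [|d y] //=.
move=> -[sxy].
rewrite Order.SeqLexiOrder.lexi_cons IH // sxy.
have := value_lt x; have := value_lt y; rewrite sxy => hy hx.
by case: c d => [] [] /=; lia.
Qed.

Lemma lexltE a b : lexlt a b = (value a < value b).
Proof.
rewrite /lexlt Order.TotalTheory.ltNge -[X in ~~ X]/(lexle b a) lexleE -ltnNge //.
Qed.

Lemma tuple_of_value n : n < 2 ^ m -> exists a, value a = n.
Proof.
move=> nm; pose f (a : m.-tuple bool) : 'I_(2 ^ m) := Ordinal (value_tuple_lt a).
have finj : injective f by move=> a b [/value_tuple_inj].
have : #|{: m.-tuple bool}| = #|'I_(2 ^ m)| by rewrite card_tuple card_bool card_ord.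
move=> e; have [g _ gK] := inj_card_bij finj (eq_leq (esym e)).
by exists (g (Ordinal nm)); rewrite -[LHS]/(nat_of_ord (f _)) gK.
Qed.

Lemma lexsuccE a b : lexsucc a b = (value b == (value a).+1).
Proof.
rewrite /lexsucc lexltE; apply/andP/eqP => [[ab /forallP h]|e].
  case: (ltngtP (value b) (value a).+1) => //; first by lia.
  move=> h'; have [c ec] := @tuple_of_value (value a).+1 (ltn_trans h' (value_tuple_lt b)).
  by have := h c; rewrite !lexltE ec ltnSn h'.
by split; [lia | apply/forallP => c; rewrite !lexltE; lia].
Qed.

Lemma zerosE a : (a == zeros m) = (value a == 0).
Proof.
apply/eqP/eqP => [->|h]; first exact: value_nseq_false.
by apply: value_tuple_inj; rewrite h value_nseq_false.
Qed.

Lemma onesE a : (a == ones m) = ((value a).+1 == 2 ^ m).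
Proof.
apply/eqP/eqP => [->|h]; first exact: value_nseq_true.
by apply: value_tuple_inj; apply/eqP; rewrite -eqSS h value_nseq_true.
Qed.

(** Addition of one modulo [2 ^ m]. For [m = 0] the only string is its own successor. *)
Lemma circsuccE a b :
  circsucc a b = (value b == if (value a).+1 == 2 ^ m then 0 else (value a).+1).
Proof.
rewrite /circsucc lexsuccE onesE zerosE; have := value_tuple_lt b.
case: ((value a).+1 =P 2 ^ m) => [-> h|_ _]; last by rewrite /= orbF.
by rewrite (ltn_eqF h).
Qed.

End Tuples.

(** * Orders given as lists of words *)

Fixpoint lex_words m : seq word :=
  if m is m'.+1 then map (cons false) (lex_words m') ++ map (cons true) (lex_words m')
  else [:: [::]].

Definition pairs (s : seq word) : seq (word * word) := zip s (behead s).

(** Joining two nonempty lists creates one new adjacency; the junctions of the constructed orders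
    are read off from this. *)
Lemma pairs_cat s a b t :
  pairs (rcons s a ++ b :: t) = pairs (rcons s a) ++ (a, b) :: pairs (b :: t).
Proof.
by rewrite /pairs; elim: s => [|c [|d s] IH] //=; rewrite -IH.
Qed.

Lemma pairs_map f s : pairs (map f s) = map (fun p => (f p.1, f p.2)) (pairs s).
Proof.
by rewrite /pairs; elim: s => //= a [|b s] //= ->.
Qed.

Lemma pairs_mem s x y : (x, y) \in pairs s -> x \in s /\ y \in behead s.
Proof.
rewrite /pairs; elim: s => //= a [|b s] //= IH; rewrite inE => /orP[/eqP [-> ->]|/IH [h1 h2]].
  by rewrite !inE !eqxx.
by rewrite [x \in _]inE h1 orbT inE; split=> //; rewrite h2 orbT.
Qed.

Lemma pairs_index s x y : uniq s ->
  ((x, y) \in pairs s) = [&& x \in s, y \in s & index y s == (index x s).+1].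
Proof.
move=> us; have sz : size (pairs s) = (size s).-1 by rewrite size_zip size_behead (minn_idPr (leq_pred _)).
apply/idP/and3P => [/(nthP ([::], [::])) [i hi]|[xs ys /eqP e]].
  rewrite nth_zip_cond hi nth_behead => -[<- <-]; rewrite sz in hi.
  by rewrite !index_uniq ?mem_nth //; lia.
have := ys; rewrite -index_mem e => hx; have hi : index x s < size (pairs s) by rewrite sz; lia.
apply/(nthP ([::], [::])); exists (index x s) => //.
by rewrite nth_zip_cond hi nth_behead nth_index // -e nth_index.
Qed.

Definition enumerates m (L : seq word) : Prop := uniq L /\ forall w, (w \in L) = (size w == m).

Lemma cons_inj b : injective (@cons bool b).
Proof. by move=> x y []. Qed.

Lemma enumerates_lex_words m : enumerates m (lex_words m).
Proof.
elim: m => [|m [um memm]]; first by split=> // w; rewrite inE; case: w.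
split=> [|w] /=.
  rewrite cat_uniq !map_inj_uniq ?um; try exact: cons_inj.
  by rewrite andbT; apply/hasPn => w /mapP [v _ ->]; apply/mapP => -[].
rewrite mem_cat; case: w => [|b w]; first by apply/orP => -[] /mapP [].
rewrite eqSS -memm; apply/orP/idP => [[] /mapP [v vm [_ ->]] //|h].
by case: b; [right | left]; apply: map_f.
Qed.

Lemma enumerates_perm m L L' : enumerates m L -> enumerates m L' -> perm_eq L L'.
Proof. by move=> [u h] [u' h']; apply: uniq_perm => // w; rewrite h h'. Qed.

Lemma size_lex_words m : size (lex_words m) = 2 ^ m.
Proof. by elim: m => //= m IH; rewrite size_cat !size_map IH expnS mul2n addnn. Qed.

Lemma enumerates_size m L : enumerates m L -> size L = 2 ^ m.
Proof.
by move=> h; rewrite (perm_size (enumerates_perm h (enumerates_lex_words m))) size_lex_words.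
Qed.

Lemma index_lex_words m w : size w = m -> index w (lex_words m) = value w.
Proof.
move=> <- {m}; elim: w => //= b w IH; rewrite index_cat.
have mem : w \in lex_words (size w) by rewrite (enumerates_lex_words _).2.
case: b; last by rewrite map_f // index_map //; apply: cons_inj.
rewrite ifN; last by apply/mapP => -[].
by rewrite size_map size_lex_words index_map ?IH ?mul1n //; apply: cons_inj.
Qed.

Lemma nth_lex_words m i : i < 2 ^ m -> value (nth [::] (lex_words m) i) = i.
Proof.
move=> im; set w := nth _ _ _.
have : w \in lex_words m by rewrite mem_nth // size_lex_words.
rewrite (enumerates_lex_words m).2 => /eqP sw.
rewrite -(index_lex_words sw) index_uniq ?size_lex_words //.
exact: (enumerates_lex_words m).1.
Qed.

Lemma pairs_lex_words m x y : size x = m -> size y = m ->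
  ((x, y) \in pairs (lex_words m)) = succ_word x y.
Proof.
move=> sx sy; have [u h] := enumerates_lex_words m.
rewrite pairs_index // !h sx sy eqxx /= succ_wordE ?sx //.
by rewrite !index_lex_words.
Qed.

Lemma last_lex_words m : exists s, lex_words m = rcons s (nseq m true).
Proof.
elim: m => [|m [s e]]; first by exists [::].
by exists (map (cons false) (lex_words m) ++ map (cons true) s); rewrite /= {2}e map_rcons rcons_cat.
Qed.

Lemma head_lex_words m : exists s, lex_words m = nseq m false :: s.
Proof.
elim: m => [|m [s e]]; first by exists [::].
by exists (map (cons false) s ++ map (cons true) (lex_words m)); rewrite /= {1}e.
Qed.

Section Ranking.
Variable m : nat.

(** For an enumerating [L], this says that [L] is [lex_words m] transported along the inverse of
    [h]. Lists can be cut and concatenated, which is awkward for bijections. *)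
Definition ranks (L : seq word) (h : m.-tuple bool -> m.-tuple bool) : Prop :=
  forall y : m.-tuple bool, index (val y) L = value (h y).

Lemma list_of_bijection h : bijective h -> exists2 L, enumerates m L & ranks L h.
Proof.
move=> [g hK gK].
(* [f] extended by the identity to words of other lengths, so that it becomes an invertible map on
   all words. *)
pose H (f : m.-tuple bool -> m.-tuple bool) w := if insub w is Some t then val (f t) else w.
have HE f (t : m.-tuple bool) : H f (val t) = val (f t) by rewrite /H valK.
have Hid f w : size w <> m -> H f w = w.
  by move=> /eqP sw; rewrite /H insubN.
have HK f f' : cancel f f' -> cancel (H f) (H f').
  move=> fK w; case: (eqVneq (size w) m) => [/eqP sw|/eqP sw]; last by rewrite !Hid.
  by rewrite -[w]/(val (Tuple sw)) !HE fK.
have [u memE] := enumerates_lex_words m.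
exists (map (H g) (lex_words m)).
  split; first by rewrite map_inj_uniq //; apply: can_inj (HK _ _ gK).
  move=> w; rewrite -memE; case: (eqVneq (size w) m) => [/eqP sw|sw].
    rewrite -[w in LHS](HK _ _ hK) mem_map; last exact: can_inj (HK _ _ gK).
    by rewrite !memE -[w]/(val (Tuple sw)) HE !size_tuple.
  rewrite [RHS]memE (negbTE sw); apply/mapP => -[v vm ew].
  have sv : size v == m by rewrite -memE.
  by move: sw; rewrite ew -[v]/(val (Tuple sv)) HE size_tuple eqxx.
move=> y; rewrite -[val y](HK _ _ hK) index_map; last exact: can_inj (HK _ _ gK).
by rewrite HE index_lex_words ?size_tuple.
Qed.

Lemma bijection_of_list L : enumerates m L -> exists2 h, bijective h & ranks L h.
Proof.
move=> hL; have [u memL] := hL; have sL := enumerates_size hL.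
have iL (y : m.-tuple bool) : index (val y) L < 2 ^ m.
  by rewrite -sL index_mem memL size_tuple.
have sz (y : m.-tuple bool) : size (nth [::] (lex_words m) (index (val y) L)) == m.
  by rewrite -(enumerates_lex_words m).2 mem_nth // size_lex_words.
pose h y := Tuple (sz y).
have hr : ranks L h.
  by move=> y; rewrite -[RHS]/(value (nth [::] (lex_words m) (index (val y) L))) nth_lex_words.
exists h => //; apply: injF_bij => y z e; apply/val_inj.
have eyz : index (val y) L = index (val z) L by rewrite !hr e.
have yL (t : m.-tuple bool) : val t \in L by rewrite memL size_tuple.
by rewrite -(nth_index [::] (yL y)) eyz nth_index.
Qed.

Variables (L : seq word) (h : m.-tuple bool -> m.-tuple bool).
Hypotheses (hL : enumerates m L) (hr : ranks L h).

Lemma lexsucc_ranks y z : lexsucc (h y) (h z) = ((val y, val z) \in pairs L).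
Proof.
have [u memL] := hL.
by rewrite pairs_index // !memL !size_tuple eqxx /= !hr lexsuccE.
Qed.

Lemma ranks_zeros y : (h y == zeros m) = (val y == head [::] L).
Proof.
have [u memL] := hL; have := memL y; rewrite size_tuple eqxx.
rewrite zerosE -hr; case: (L) => [//|a s] _ /=.
by rewrite [RHS]eq_sym; case: ifP.
Qed.

Lemma ranks_ones y : (h y == ones m) = (val y == last [::] L).
Proof.
have [u memL] := hL; have yL : val y \in L by rewrite memL size_tuple.
rewrite onesE -hr -(enumerates_size hL).
case/lastP: (L) yL u => // s a; rewrite last_rcons size_rcons eqSS => yL u.
move: u; rewrite rcons_uniq => /andP[as_ _].
rewrite -cats1 index_cat; case: ifP => ys; last first.
  by move: yL; rewrite mem_rcons inE ys orbF => /eqP ->; rewrite /= eqxx addn0 eqxx.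
rewrite ltn_eqF ?index_mem //; apply/esym/negbTE/eqP => e.
by rewrite -e ys in as_.
Qed.

End Ranking.

Lemma card_acc M m x (L2 : seq word) : uniq L2 -> (forall w, w \in L2 -> size w = m) ->
  (forall w : m.-tuple bool, accepting_path M [:: x] w <-> val w \in L2) ->
  #|acc M m x| = size L2.
Proof.
move=> u sz h; rewrite cardE -(size_map val); apply: perm_size; apply: uniq_perm => //.
  by rewrite map_inj_uniq ?enum_uniq //; apply: val_inj.
move=> w; apply/mapP/idP => [[t]|wL].
  by rewrite mem_enum inE => /asboolP/h ht ->.
have sw : size w == m by rewrite sz.
by exists (Tuple sw) => //; rewrite mem_enum inE; apply/asboolP/h.
Qed.

(** A cluster is a contiguous segment of the list; its first and last entries serve as the
    bounds. *)
Lemma cluster_of_list M f m x L1 L2 L3 (h : m.-tuple bool -> m.-tuple bool) :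
  let L := L1 ++ L2 ++ L3 in enumerates m L -> ranks L h ->
  (forall w, size w = m -> (accepting_path M [:: x] w <-> w \in L2)) -> f x = size L2 ->
  cluster M f x h /\ f x = #|acc M m x|.
Proof.
move=> L hL hr hacc fx; have [u memL] := hL.
have [u1 u2 u3 u12 u23] : [/\ uniq L1, uniq L2, uniq L3, {in L2, forall w, w \notin L1}
   & {in L3, forall w, w \notin L2}].
  move: u; rewrite !cat_uniq => /and5P[u1 /hasPn h1 u2 /hasPn h2 u3]; split=> //.
  by move=> w w2; apply: h1; rewrite mem_cat w2.
split; last first.
  rewrite fx; apply/esym/card_acc => // [w w2|w]; last by apply: hacc; rewrite size_tuple.
  by apply/eqP; rewrite -memL !mem_cat w2 orbT.
move=> fx0; have s2 : 0 < size L2 by rewrite -fx lt0n; apply/eqP.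
have sz i : i < size L2 -> size (nth [::] L2 i) == m.
  by move=> hi; rewrite -memL !mem_cat mem_nth // orbT.
have s2' : (size L2).-1 < size L2 by rewrite prednK.
exists (Tuple (sz 0 s2)), (Tuple (sz _ s2')).
have ix i : i < size L2 -> index (nth [::] L2 i) L = size L1 + i.
  move=> hi; rewrite /L index_cat ifN ?index_cat ?mem_nth ?index_uniq //.
  by apply: u12; apply: mem_nth.
apply/setP => w; rewrite !inE !lexleE -!hr !ix //= addn0.
apply/asboolP/andP => [/hacc|].
  rewrite size_tuple => /(_ erefl) w2; rewrite /L index_cat ifN ?u12 // index_cat w2.
  by rewrite leq_addr leq_add2l -ltnS prednK // index_mem.
move=> [h1 h2]; apply/hacc; rewrite ?size_tuple //.
have wL : val w \in L by rewrite memL size_tuple.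
move: h1 h2; rewrite /L index_cat; case: ifP => [w1|w1].
  by rewrite leqNgt index_mem w1.
by rewrite index_cat; case: ifP => // w2 _; rewrite leq_add2l -ltnS prednK // ltnNge leq_addr.
Qed.

Lemma list_of_cluster M f m x L (h : m.-tuple bool -> m.-tuple bool) :
  enumerates m L -> ranks L h -> cluster M f x h -> f x = #|acc M m x| ->
  exists L1 L2 L3, [/\ L = L1 ++ L2 ++ L3, f x = size L2 &
    forall w, size w = m -> (accepting_path M [:: x] w <-> w \in L2)].
Proof.
move=> hL hr hc fx; have [u memL] := hL.
have [i [j hij]] : exists i j, forall w, size w = m ->
    (accepting_path M [:: x] w <-> i <= index w L < j).
  have accE w (sw : size w == m) : accepting_path M [:: x] w <-> Tuple sw \in acc M m x.
    by rewrite inE; split=> [h1|/asboolP //]; apply/asboolP.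
  (* At value [0] the cluster condition says nothing, but then no path accepts and an empty segment
     will do. *)
  case: (eqVneq (f x) 0) => [f0|/eqP /hc [l [v e]]].
    exists 0, 0 => w /eqP sw; rewrite (accE w sw) ltn0 andbF.
    by move: fx; rewrite f0 => /esym/eqP; rewrite cards_eq0 => /eqP ->; rewrite inE.
  exists (index (val l) L), (index (val v) L).+1 => w /eqP sw; rewrite (accE w sw) e inE !lexleE -!hr.
  by rewrite ltnS.
(* If [j < i] the middle part is empty, and [maxn] makes the last part start where the first one
   ends. *)
exists (take i L), (drop i (take j L)), (drop (maxn i j) L).
have e : L = take i L ++ drop i (take j L) ++ drop (maxn i j) L.
  case: (leqP i j) => ij.
    rewrite -{1}(cat_take_drop j L) -{1}(cat_take_drop i (take j L)) -catA; congr (_ ++ _ ++ _).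
    by rewrite take_takel.
  by rewrite [drop i _]drop_oversize ?cat_take_drop // size_take; case: ltnP; lia.
have mem2 w : size w = m -> (accepting_path M [:: x] w <-> w \in drop i (take j L)).
  move=> sw; rewrite hij //; have wL : w \in L by rewrite memL sw.
  have hi : index w L < size L by rewrite index_mem.
  split=> [/andP[h1 h2]|].
    have -> : w = nth [::] (drop i (take j L)) (index w L - i).
      by rewrite nth_drop subnKC // nth_take // nth_index.
    have hk : index w L - i < size (drop i (take j L)).
      by rewrite size_drop size_take; case: (ltnP j (size L)) => _; lia.
    exact: mem_nth hk.
  move=> /(nthP [::]) [k hk <-]; have {}hk : k < size (drop i (take j L)) by [].
  rewrite size_drop in hk.
  have : size (take j L) <= j by rewrite size_take; case: (ltnP j (size L)); lia.
  have : size (take j L) <= size L by rewrite size_take; case: (ltnP j (size L)); lia.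
  move=> h1 h2; rewrite nth_drop nth_take; last by lia.
  have ik : i + k < size L by lia.
  by rewrite index_uniq //; lia.
have ss : subseq (drop i (take j L)) L.
  exact: subseq_trans (drop_subseq _ _) (take_subseq _ _).
split=> //; rewrite fx; apply: card_acc => [|w /(mem_subseq ss)|w].
- exact: subseq_uniq ss u.
- by rewrite memL => /eqP.
- by apply: mem2; rewrite size_tuple.
Qed.

(** * Fillers and chain *)

(** The output is expected on tape 0, where the input stands. The input is therefore copied to a
    private tape, and the result is copied back over it. *)
Lemma FPt_of_FP (g : word -> word) : FP 1 (fun a => g (arg a 0)) -> FPt g.
Proof.
move=> [J [G [MF [out [q [dF hF]]]]]].
pose I := ('I_1 + ('I_1 + J))%type.
pose e (i : 'I_1 + J) : I := inr i.
have e_inj : injective e by move=> i j [].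
pose M : mach I G := mseq (mcopy G (inl ord0) (e (inl ord0)))
  (mseq (lift e id MF) (mcopy G (e out) (inl ord0))).
have dM : mdet M.
  apply: mdet_mseq; first exact: mdet_mcopy.
  by apply: mdet_mseq; [apply: mdet_lift | apply: mdet_mcopy].
pose Q : {poly nat} := (2%N%:P * 'X + q + 2%N%:P * q + 6%N%:P)%R.
have main x : exists n t, [/\ n <= peval Q (size x),
    runs M n (@load 1 _ _ [:: x]) [::] true t & shows (t (inl ord0)) (g x)].
  have [hg [n1 [v1 [t1 [hn1 r1 s1]]]]] := hF [:: x] erefl; rewrite /= in hg s1.
  have ex : total [:: x] = size x by rewrite /total big_seq1.
  pose T0 : tapes I G := @load 1 _ _ [:: x].
  have rc : runs (mcopy G (inl ord0) (e (inl ord0))) (2 * size x + 2) T0 [::] true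
      (mset T0 (e (inl ord0)) (wtape G x)).
    have := @runs_mcopy I G (inl ord0) (e (inl ord0)) isT T0 x (shows_wtape _ _) isT.
    by rewrite [T0 (e _)]/= overwrite_blank.
  set T1 := mset T0 _ _ in rc.
  have rF := runs_lift e_inj (@inj_id G) T1 r1.
  have eT1 : put e id T1 (@load 1 _ _ [:: x]) = T1.
    apply/funext => i; case: (unindexP e i) => [[j -> _]|[ni _]]; last by rewrite put_out.
    rewrite put_in //; case: j => [j|j] /=; last by rewrite /T1 /mset /=; apply/funext.
    by rewrite lift_wtape !ord1 /T1 /mset eqxx.
  rewrite eT1 in rF; set T2 := put _ _ _ t1 in rF.
  have T2out : shows (T2 (e out)) (g x) by rewrite /T2 put_in //; apply: shows_lift.
  have T2in : T2 (inl ord0) = wtape G x by rewrite /T2 put_out // /T1 /mset.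
  have rc' := @runs_mcopy I G (e out) (inl ord0) isT T2 (g x) T2out.
  rewrite T2in wtapeN in rc'; have {}rc' := rc' isT.
  exists (2 * size x + 2 + (n1 + (2 * size (g x) + 2).+1).+1), (mset T2 (inl ord0) (overwrite (g x) (wtape G x))); split.
  - by rewrite ex in hg hn1; rewrite !(pevalD, pevalM, pevalC, pevalX); lia.
  - exact: runs_mseq rc (runs_mseq rF rc').
  - by rewrite /mset eqxx; apply: shows_overwrite.
exists (implement M); split; first exact: deterministic_implement.
- exists Q => a; rewrite -/(total _); case: a => -[|x [|]] //= ?.
  have [n [t [hn r _]]] := main x.
  apply: (@halts_implement _ _ _ M [:: x] _ 0) => // -[|//] _.
  by exists n, true, t; rewrite total_cons /total big_nil addn0.
- move=> x; have [n [t [_ r s]]] := main x.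
  have [d h ed] := @runs_implement _ _ _ M [:: x] _ _ _ _ erefl r.
  exists true, d; split=> //; apply: shows_unique (shows_leading_bits _) _.
  have -> : atape_of (d.2 ord0) = atapes d (place (inl ord0)).
    by rewrite /atapes; congr (atape_of (d.2 _)); apply/val_inj; rewrite /= placeE.
  by rewrite ed put_in; [apply: shows_lift | apply: place_inj].
Qed.

Section Fillers.
Variable V : word -> bool.

(* For each [u] in lexicographic order the string [1u] is a filler, and so is [0u] unless [u]
   is valid; the valid strings [0u] are left over for the chain.  As [1u] is always there, the
   successor of a filler is found by testing the validity of one string only. *)
Definition block (u : word) : seq word :=
  (true :: u) :: if V u then [::] else [:: false :: u].

Definition blocks (E : seq word) : seq word := flatten (map block E).

(** Either both strings lie in the block of [u], or [s] ends its block and [s'] starts the next one.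
    The last string of the block begins with [1] exactly if [u] is valid, whence the test against
    [V u]. *)
Definition block_succ (s s' : word) : bool :=
  let u := behead s in let u' := behead s' in
  [&& head false s, ~~ head false s', ~~ V u & u == u'] ||
  [&& head false s == V u, head false s' & succ_word u u'].

Lemma mem_blocks E c u : (c :: u \in blocks E) = (u \in E) && (c || ~~ V u).
Proof.
elim: E => //= a E IH; rewrite /blocks /= inE mem_cat -/(blocks E) IH [u \in _ :: _]inE.
rewrite eqseq_cons; case Va : (V a); rewrite ?inE ?eqseq_cons.
  by case: (altP (u =P a)) => [->|_] /=; rewrite ?Va; case: c {IH} => //=; rewrite andbF.
by case: (altP (u =P a)) => [->|_] /=; rewrite ?Va; case: c {IH}.
Qed.

Lemma nil_blocks E : [::] \notin blocks E.
Proof.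
elim: E => //= a E IH; rewrite /blocks /= inE mem_cat -/(blocks E) (negbTE IH) orbF.
by case: (V a).
Qed.

Lemma uniq_blocks E : uniq E -> uniq (blocks E).
Proof.
elim: E => //= a E IH /andP[aE uE].
have nE c : c :: a \notin blocks E by rewrite mem_blocks (negbTE aE).
rewrite /blocks /= mem_cat cat_uniq -/(blocks E) IH // (negbTE (nE _)) orbF andbT.
case: (V a) => //=; first by apply/hasPn.
apply/hasPn => w; apply: contraTN; rewrite inE => /eqP ->; apply: nE.
Qed.

Lemma pairs_blocks E c u c' u' :
  ((c :: u, c' :: u') \in pairs (blocks E)) =
  [&& c, ~~ c', ~~ V u, u == u' & u \in E] || [&& c == V u, c' & (u, u') \in pairs E].
Proof.
elim: E => [|a E IH]; first by rewrite !andbF.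
case: E IH => [_|b E IH].
  rewrite /blocks /block /= cats0 /pairs /= !andbF orbF.
  case Va : (V a); rewrite !inE.
    by case: (altP (u =P a)) => [->|_]; rewrite ?Va /= !andbF.
  rewrite xpair_eqE !eqseq_cons; case: (altP (u =P a)) => [->|_]; rewrite ?Va /= ?andbF //.
  by rewrite [a == u']eq_sym !andbT; case: c c' => [] [].
have -> : pairs (a :: b :: E) = (a, b) :: pairs (b :: E) by [].
have -> : pairs (blocks (a :: b :: E)) =
    (if V a then [:: (true :: a, true :: b)]
     else [:: (true :: a, false :: a); (false :: a, true :: b)]) ++ pairs (blocks (b :: E)).
  by rewrite /blocks /= {1}/block; case: (V a).
rewrite mem_cat IH [u \in a :: _]inE [(u, u') \in _ :: _]inE xpair_eqE.
case Va : (V a); rewrite !inE !xpair_eqE !eqseq_cons.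
  case: (altP (u =P a)) => [->|_]; rewrite ?Va /= ?andbF //.
  by case: c c' {IH} => [] [] //=; rewrite ?andbF ?orbF.
case: (altP (u =P a)) => [->|_]; rewrite ?Va /= ?andbF //.
case: c c' {IH} => [] [] //=; rewrite ?andbF ?orbF ?andbT //.
by rewrite [u' == a]eq_sym; case: (a == u').
Qed.

Variable m : nat.

Definition fillers : seq word := blocks (lex_words m).

Lemma pairs_fillers s s' : size s = m.+1 -> size s' = m.+1 ->
  ((s, s') \in pairs fillers) = block_succ s s'.
Proof.
case: s s' => [|c u] [|c' u'] //= [su] [su']; rewrite pairs_blocks /block_succ /=.
by rewrite (enumerates_lex_words m).2 su eqxx andbT pairs_lex_words.
Qed.

(** The order of the valid strings is left open; each construction brings its own. *)
Definition chain (C : seq word) : Prop :=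
  uniq C /\ forall w, w \in C <-> exists2 u, w = false :: u & size u = m /\ V u.

Lemma enumerates_fillers C : chain C -> enumerates m.+1 (fillers ++ C).
Proof.
move=> [uC memC]; have [uE memE] := enumerates_lex_words m; split.
  rewrite cat_uniq uniq_blocks // uC andbT; apply/hasPn => w /memC [u -> [_ Vu]].
  by rewrite mem_blocks Vu andbF.
move=> w; rewrite mem_cat; case: w => [|c u].
  by rewrite (negbTE (nil_blocks _)); apply/negbTE/negP => /memC [].
rewrite mem_blocks memE /= eqSS; apply/orP/idP => [[/andP[]//|/memC [v [_ ->] [-> _]]//]|su].
rewrite su; case: c => //=; first by left.
by case Vu : (V u); [right; apply/memC; exists u => //; split=> //; apply/eqP | left].
Qed.

Definition first_filler : word := true :: nseq m false.
Definition penult_filler : word := true :: nseq m true.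
Definition last_filler : word := false :: nseq m true.

Hypothesis V1 : ~~ V (nseq m true).

(** As [1^m] is invalid, the last block has both its strings, so the last two fillers are known
    whatever [V] is. *)
Lemma fillers_last : exists s, fillers = rcons (rcons s penult_filler) last_filler.
Proof.
have [s e] := last_lex_words m; exists (blocks s).
rewrite /fillers /blocks e map_rcons flatten_rcons /block (negbTE V1).
by rewrite -cats1 -cats1 -catA.
Qed.

Lemma fillers_first : head [::] fillers = first_filler.
Proof. by have [s e] := head_lex_words m; rewrite /fillers e. Qed.

End Fillers.

(** * From known ends to free and circular orders *)

Lemma CLU_sub_free : (CLU `<=` CLU_free)%classic.
Proof.
move=> f [p [M [b [t [R [[hM hb] _ _ hR h]]]]]]; exists p, M, R; split=> // x.
by have [h' [h1 _ h2 h3 h4]] := h x; exists h'.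
Qed.

Lemma CLU_sub_circular : (CLU `<=` CLU_circular)%classic.
Proof.
move=> f [p [M [b [t [R [[hM hb] hbF htF hR h]]]]]].
pose R' x y z := R x y z \/ y = t x /\ z = b x.
have sizes x : size (b x) = peval p (size x) /\ size (t x) = peval p (size x).
  by have [h' [_ [B [T [-> -> _ _]]] _ _ _]] := h x; rewrite !size_tuple.
exists p, M, R'; split=> //.
  apply: polytime_pred3_of_FP.
  have gb : FP 3 (fun a => b (arg a 0)).
    by apply: FP1_comp (FP_of_FPt hbF _) (FP_arg _) => // x; rewrite (sizes x).1.
  have gt : FP 3 (fun a => t (arg a 0)).
    by apply: FP1_comp (FP_of_FPt htF _) (FP_arg _) => // x; rewrite (sizes x).2.
  have := FP_or (FP_of_polytime_pred3 hR)
    (FP_and (FP_eq (FP_arg (isT : 1 < 3)) gt) (FP_eq (FP_arg (isT : 2 < 3)) gb)).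
  apply: FP_ext => a _; congr [:: _]; apply/orP/asboolP => -[].
  - by move/asboolP; left.
  - by move=> /andP[/eqP -> /eqP ->]; right.
  - by left; apply/asboolP.
  - by move=> [-> ->]; right; rewrite !eqxx.
move=> x; have [h' [h1 [B [T [eb et hB hT]]] h2 h3 h4]] := h x.
exists h'; split=> // y z; rewrite /R' h2 /circsucc eb et.
have hi := bij_inj h1; split=> [[->//|[/val_inj -> /val_inj ->]]|/orP[]].
- by rewrite hB hT !eqxx orbT.
- by left.
- by move=> /andP[/eqP ey /eqP ez]; right; rewrite (hi y T) ?ey // (hi z B) ?ez.
Qed.

(** * From circular orders to UP = coUP *)

Lemma computation_size M (c : config M) w v d n :
  computation c w v d -> halts_within n c -> size w <= n.
Proof.
move=> h; elim: h n => {c w v d} [//|c a w v d e _ IH|c a0 a1 b w v d e _ IH] [|n] /=.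
- by rewrite e.
- by rewrite e => /IH /leqW.
- by rewrite e.
- by rewrite e ltnS => /andP[h0 h1]; apply: IH; case: (b).
Qed.

Lemma accepting_path_bound M : NPTM M ->
  exists q, forall x w, accepting_path M [:: x] w -> size w <= peval q (size x).
Proof.
move=> [q hq]; exists q => x w [d h].
have := computation_size h (hq [tuple x]).
by rewrite /= big_seq1.
Qed.

(** All paths on [x] already have the length of [w], which leaves no room for padding. The
    simulation, which decides padded paths, thus decides acceptance. *)
Lemma padded_path_balanced M p x w : balanced M p -> size w = peval p (size x) ->
  (padded_path M x w <-> accepting_path M [:: x] w).
Proof.
move=> hb sw; split=> [[v [j [ew hv]]]|h]; last by exists w, 0; rewrite cats0.
have sv : size v = peval p (size x) by apply/hb; exists true.
by move: sw; rewrite ew size_cat size_nseq sv => h; have -> : j = 0 by [lia]; rewrite cats0.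
Qed.

Lemma padded_path_unique M x s s' :
  (forall w w', accepting_path M [:: x] w -> accepting_path M [:: x] w' -> w = w') ->
  padded_path M x s -> padded_path M x s' -> size s = size s' -> s = s'.
Proof.
move=> hu [w [j [-> hw]]] [w' [j' [-> hw']]]; rewrite (hu _ _ hw hw') !size_cat !size_nseq.
by move/addnI->.
Qed.

Lemma FP_padded_path k M g0 g1 : NPTM M -> FP k g0 -> FP k g1 ->
  FP k (fun a => [:: `[< padded_path M (g0 a) (g1 a) >]]).
Proof.
move=> hM; apply: (@FP2_comp k (fun x s => [:: `[< padded_path M x s >]])).
exact/FP_of_decides/decides_padded_path.
Qed.

Lemma FP_block_succ k V gx g0 g1 :
  FP 2 (fun a => [:: V (arg a 0) (arg a 1)]) -> FP k gx -> FP k g0 -> FP k g1 ->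
  FP k (fun a => [:: block_succ (V (gx a)) (g0 a) (g1 a)]).
Proof.
move=> hV hx h0 h1.
have hv : FP k (fun a => [:: V (gx a) (behead (g0 a))]).
  exact: (@FP2_comp k (fun x s => [:: V x s]) _ _ hV hx (FP_behead h0)).
apply: FP_or.
  apply: (FP_and (FP_head h0)); apply: (FP_and (FP_not (FP_head h1))).
  by apply: (FP_and (FP_not hv)); apply: FP_eq; apply: FP_behead.
apply: FP_and.
  have := FP_eq (FP_head h0) hv; apply: FP_ext => a _.
  by rewrite eqseq_cons eqxx andbT.
by apply: (FP_and (FP_head h1)); apply: FP_succ; apply: FP_behead.
Qed.

Lemma polytime_pred3_bool (R : word -> word -> word -> bool) :
  FP 3 (fun a => [:: R (arg a 0) (arg a 1) (arg a 2)]) -> polytime_pred3 R.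
Proof.
by move=> h; apply: polytime_pred3_of_FP; apply: FP_ext h => a _; rewrite asboolb.
Qed.

(** This is what the circle contributes: by wrapping around, even the bottom string has a
    predecessor to show. *)
Lemma circular_pred m (b : m.-tuple bool) : exists a, circsucc a b.
Proof.
have p0 : 0 < 2 ^ m by rewrite expn_gt0.
case: (posnP (value b)) => b0.
  have [|a ea] := @tuple_of_value m (2 ^ m).-1; first by rewrite prednK.
  by exists a; rewrite circsuccE ea prednK // eqxx b0.
have [|a ea] := @tuple_of_value m (value b).-1.
  by apply: leq_ltn_trans (leq_pred _) (value_tuple_lt b).
by exists a; rewrite circsuccE ea prednK // (ltn_eqF (value_tuple_lt b)).
Qed.

Lemma circular_succ m (a : m.-tuple bool) : exists b, circsucc a b.
Proof.
have p0 : 0 < 2 ^ m by rewrite expn_gt0.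
case e : ((value a).+1 == 2 ^ m).
  by have [b eb] := @tuple_of_value m 0 p0; exists b; rewrite circsuccE e eb.
have [|b eb] := @tuple_of_value m (value a).+1.
  by have := value_tuple_lt a; rewrite leq_eqVlt e.
by exists b; rewrite circsuccE e eb.
Qed.

Lemma circsucc_inj_l m (a a' b : m.-tuple bool) : circsucc a b -> circsucc a' b -> a = a'.
Proof.
rewrite !circsuccE => /eqP -> /eqP e; apply: value_tuple_inj; move: e.
have := value_tuple_lt a; have := value_tuple_lt a'; move: (2 ^ m) => k.
by case: ((value a).+1 =P k) => ?; case: ((value a').+1 =P k) => ?; lia.
Qed.

Lemma circsucc_inj_r m (a b b' : m.-tuple bool) : circsucc a b -> circsucc a b' -> b = b'.
Proof.
by rewrite !circsuccE => /eqP h /eqP h'; apply: value_tuple_inj; rewrite h h'.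
Qed.

Section OneOrTwo.
Variables (A : language) (N : tm).
Hypotheses (hN : NPTM N)
  (uN : forall x w w', accepting_path N [:: x] w -> accepting_path N [:: x] w' -> w = w')
  (AN : forall x, A x <-> exists w, accepting_path N [:: x] w).

(* The fillers come first.  The last one, [0 1^m], always counts as accepting, and the
   accepting path of [N], if there is one, is its successor; so deciding which string is
   the top of the order amounts to deciding [A]. *)
Lemma one_plus_indicator_free : CLU_free (fun x => 1 + `[< A x >]).
Proof.
have [q hq] := accepting_path_bound hN.
(* Besides a padded path, a valid string has one leading letter, required to be [0]; this makes
   [1^m] invalid. *)
pose mp : {poly nat} := (q + 1%N%:P)%R.
pose m (x : word) := peval mp (size x).
have mE x : m x = (peval q (size x)).+1 by rewrite /m pevalD pevalC addn1.
pose V x u := ~~ head false u && `[< padded_path N x (behead u) >].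
have hV : FP 2 (fun a => [:: V (arg a 0) (arg a 1)]).
  apply: FP_and; first exact/FP_not/FP_head/FP_arg.
  by apply: FP_padded_path => //; [apply: FP_arg | apply/FP_behead/FP_arg].
have V_unique x u u' : size u = m x -> size u' = m x -> V x u -> V x u' -> u = u'.
  rewrite mE; case: u u' => [|c u] [|c' u'] //= [su] [su'] /andP[nc /asboolP h] /andP[nc' /asboolP h'].
  rewrite /= in nc nc' h h'; rewrite (negbTE nc) (negbTE nc'); congr cons.
  by apply: padded_path_unique h h' _; [apply: uN | rewrite su].
have V_exists x : A x -> exists2 u, size u = m x & V x u.
  move=> /AN [w hw]; have sw := hq x w hw.
  exists (false :: w ++ nseq (peval q (size x) - size w) false).
    by rewrite mE /= size_cat size_nseq subnKC.
  by apply/andP; split=> //; apply/asboolP; exists w, (peval q (size x) - size w).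
have V_A x u : V x u -> A x.
  by move=> /andP[_ /asboolP [w [j [_ hw]]]]; apply/AN; exists w.
have V1 x : ~~ V x (nseq (m x) true) by rewrite mE.
have h_last k g : FP k g -> FP k (fun a => last_filler (m (g a))).
  move=> hg; have := FP_cons false (FP_nseq true (FP_poly mp hg)).
  by apply: FP_ext => a _; rewrite /last_filler size_nseq.
pose tail x s := ~~ head false s && V x (behead s).
have h_tail k g0 g1 : FP k g0 -> FP k g1 -> FP k (fun a => [:: tail (g0 a) (g1 a)]).
  move=> h0 h1; apply: (FP_and (FP_not (FP_head h1))).
  exact: (@FP2_comp k (fun x s => [:: V x s]) _ _ hV h0 (FP_behead h1)).
pose W x s := (s == last_filler (m x)) || tail x s.
have hW : FP 2 (fun a => [:: W (arg a 0) (arg a 1)]).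
  apply: FP_or; last by apply: h_tail; apply: FP_arg.
  by apply: FP_eq; [apply: FP_arg | apply/h_last/FP_arg].
(* One more letter distinguishes [1u] from [0u] in the blocks. *)
pose p : {poly nat} := (mp + 1%N%:P)%R.
have pE x : peval p (size x) = (m x).+1 by rewrite pevalD pevalC addn1.
have hp : FP 1 (fun a => nseq (peval p (size (arg a 0))) false) by apply/FP_poly/FP_arg.
have [M [hM hbal hacc]] := @guess_and_check (fun x => nseq (peval p (size x)) false) W hp hW.
pose R x s s' := block_succ (V x) s s' || (s == last_filler (m x)) && tail x s'.
exists p, M, R; split=> //.
- by move=> x w; rewrite hbal size_nseq.
- apply: polytime_pred3_bool; apply: FP_or.
    by apply: FP_block_succ => //; apply: FP_arg.
  apply: FP_and; last by apply: h_tail; apply: FP_arg.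
  by apply: FP_eq; [apply: FP_arg | apply/h_last/FP_arg].
move=> x; rewrite pE /=.
(* Unambiguity of [N] leaves at most one valid string, so the chain has no inner adjacency, and [R]
   extends that of the fillers by the junction alone. *)
have [C hC sC] : exists2 C, chain (V x) (m x) C & size C = `[< A x >].
  case: asboolP => [/V_exists [u su Vu]|nA].
    exists [:: false :: u] => //; split=> // w; rewrite inE; split=> [/eqP ->|]; first by exists u.
    by move=> [u' -> [su' Vu']]; rewrite (V_unique x u' u).
  by exists [::] => //; split=> // w; split=> // -[u _ [_ /V_A]].
have [s es] := fillers_last (V1 x).
have hL := enumerates_fillers hC.
set pen := penult_filler _ in es; set lst := last_filler _ in es.
have eL : fillers (V x) (m x) ++ C = rcons s pen ++ (lst :: C) ++ [::].
  by rewrite es cats0 -!cats1 -!catA.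
have [h hb hr] := bijection_of_list hL.
have tailE w : size w = (m x).+1 -> tail x w <-> w \in C.
  case: w => [|c w] // [sw]; rewrite (hC.2 _); split.
    by case: c => //= Vw; exists w.
  by move=> [u [-> ->] [_ Vu]].
have hacc' w : size w = (m x).+1 -> (accepting_path M [:: x] w <-> w \in lst :: C).
  move=> sw; rewrite hacc size_nseq pE sw inE /W.
  split=> [[_ /orP[->//|/(tailE w sw) ->]]|]; first by rewrite orbT.
  by move=> /orP[e|/(tailE w sw) hw]; split=> //; rewrite ?e // hw orbT.
have hL' := hL; have hr' := hr; rewrite eL in hL' hr'.
have fx : 1 + `[< A x >] = size (lst :: C) by rewrite /= sC.
have [cl cf] := @cluster_of_list M (fun x => 1 + `[< A x >]) _ x _ _ _ h hL' hr' hacc' fx.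
exists h; split=> // y z; rewrite (lexsucc_ranks hL hr).
have sy := size_tuple y; have sz := size_tuple z.
rewrite /R -(pairs_fillers _ sy sz).
case: C hC sC tailE {hL eL hr hb hL' hr' hacc' fx} => [|c [|c' C]] hC sC tailE; last by move: sC; case: `[< _ >].
  rewrite cats0; split=> [/orP[//|/andP[_ /(tailE _ sz)]]|->] //.
rewrite es pairs_cat mem_cat -es inE /= xpair_eqE.
have -> : tail x z = (val z == c).
  by apply/idP/eqP => [/(tailE _ sz)|ez]; [rewrite inE => /eqP | apply/(tailE _ sz); rewrite inE ez].
by [].
Qed.

End OneOrTwo.

Section Neighbours.
Variables (m : nat) (h : m.-tuple bool -> m.-tuple bool) (S : {set m.-tuple bool}).
Hypothesis h_bij : bijective h.

(** The alternatives [y == w] and [z == w] serve the circle with one point, [m = 0], where [w] is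
    its own neighbour. *)
Definition isolated y w z := [/\ w \in S, circsucc (h y) (h w), circsucc (h w) (h z),
  y == w \/ y \notin S & z == w \/ z \notin S].

(* In an interval with a second point [v], a neighbour of [w] towards [v] lies in it too. *)
Lemma isolated_card y w z l u :
  S = finset (fun v => lexle (h l) (h v) && lexle (h v) (h u)) ->
  isolated y w z -> #|S| <= 1.
Proof.
move=> eS [wS yw wz hy hz]; rewrite leqNgt; apply/negP => S2.
have [v vS vw] : exists2 v, v \in S & v != w.
  have /card_gt1P [a [b [aS bS ab]]] := S2.
  by case: (eqVneq a w) => [aw|]; [exists b; rewrite // -aw eq_sym | exists a].
have hi := bij_inj h_bij.
have vw' : value (h v) <> value (h w) by move=> /value_tuple_inj/hi /eqP; rewrite (negbTE vw).
have := vS; have := wS; rewrite eS !inE !lexleE => /andP[lw wu] /andP[lv vu].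
have := value_tuple_lt (h v); rewrite !circsuccE in yw wz.
case: (ltngtP (value (h v)) (value (h w))) vw' => // [vw'|wv] _ vlt.
- case: hy => [/eqP yw'|/negP[]].
    by move: yw; rewrite yw'; case: (_ =P 2 ^ m) => _ /eqP; lia.
  by rewrite eS inE !lexleE; move: yw; case: (_ =P 2 ^ m) => _ /eqP; lia.
- have wlt : ((value (h w)).+1 == 2 ^ m) = false by rewrite ltn_eqF // (leq_ltn_trans wv).
  rewrite wlt in wz; case: hz => [/eqP zw|/negP[]].
    by move: wz; rewrite zw => /eqP; lia.
  by rewrite eS inE !lexleE (eqP wz); lia.
Qed.

Lemma isolated_exists : #|S| = 1 -> exists y w z, isolated y w z.
Proof.
move=> /eqP/cards1P [w eS]; have [g hK gK] := h_bij.
have [y hy] := circular_pred (h w); have [z hz] := circular_succ (h w).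
exists (g y), w, (g z); rewrite /isolated !gK eS !inE eqxx; split=> //.
  by case: eqP; [left | right].
by case: eqP; [left | right].
Qed.

(** If [S] has only one element, this element is [w], and circular neighbours are determined by
    it. *)
Lemma isolated_unique y w z y' w' z' :
  #|S| <= 1 -> isolated y w z -> isolated y' w' z' -> [/\ y = y', w = w' & z = z'].
Proof.
move=> /card_le1_eqP S1 [wS yw wz _ _] [wS' yw' wz' _ _].
have ew : w = w' by apply: S1.
rewrite -ew in yw' wz'; have hi := bij_inj h_bij; split=> //; apply: hi.
  exact: circsucc_inj_l yw yw'.
exact: circsucc_inj_r wz wz'.
Qed.

End Neighbours.

(** For [x] in [A] the two accepting strings are consecutive, so neither is isolated; otherwise the
    only accepting string and its neighbours form the only certificate. *)
Lemma compl_UP_of_circular : (CLU_free `<=` CLU_circular)%classic ->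
  forall A, UP A -> UP (~` A)%classic.
Proof.
move=> hcirc A [N [hN uN eA]].
have AN x : A x <-> exists w, accepting_path N [:: x] w by rewrite eA.
have [p [M [R [hM hb hR hx]]]] := hcirc _ (one_plus_indicator_free hN uN AN).
pose m (x : word) := peval p (size x).
pose P x w := `[< padded_path M x w >].
pose y_ (x s : word) : word := take (m x) s.
pose w_ (x s : word) : word := take (m x) (drop (m x) s).
pose z_ (x s : word) : word := drop (m x) (drop (m x) s).
(* A certificate of length [3 * m x] is cut into three strings [y], [w], [z]; the test is
   [isolated], expressed through [R] and acceptance. *)
pose U x s := [&& P x (w_ x s), `[< R x (y_ x s) (w_ x s) >], `[< R x (w_ x s) (z_ x s) >],
  (y_ x s == w_ x s) || ~~ P x (y_ x s) & (z_ x s == w_ x s) || ~~ P x (z_ x s)].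
have hm : FP 2 (fun a => nseq (m (arg a 0)) false) by apply/FP_poly/FP_arg.
have tk g : FP 2 g -> FP 2 (fun a => take (m (arg a 0)) (g a)).
  by move=> hg; apply: FP_ext (FP_take hm hg) => a _; rewrite size_nseq.
have dr g : FP 2 g -> FP 2 (fun a => drop (m (arg a 0)) (g a)).
  by move=> hg; apply: FP_ext (FP_drop hm hg) => a _; rewrite size_nseq.
have x2 : FP 2 (fun a => arg a 0) by apply: FP_arg.
have s2 : FP 2 (fun a => arg a 1) by apply: FP_arg.
have hy : FP 2 (fun a => y_ (arg a 0) (arg a 1)) by apply: tk.
have hw : FP 2 (fun a => w_ (arg a 0) (arg a 1)) by apply/tk/dr.
have hz : FP 2 (fun a => z_ (arg a 0) (arg a 1)) by apply/dr/dr.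
have hP g : FP 2 g -> FP 2 (fun a => [:: P (arg a 0) (g a)]) by apply: FP_padded_path.
have hRR g1 g2 : FP 2 g1 -> FP 2 g2 -> FP 2 (fun a => [:: `[< R (arg a 0) (g1 a) (g2 a) >]]).
  exact: (@FP3_comp 2 (fun x y z => [:: `[< R x y z >]]) _ _ _ (FP_of_polytime_pred3 hR)).
have hU : FP 2 (fun a => [:: U (arg a 0) (arg a 1)]).
  apply: (FP_and (hP _ hw)); apply: (FP_and (hRR _ _ hy hw)); apply: (FP_and (hRR _ _ hw hz)).
  by apply: FP_and; apply: FP_or; [apply: FP_eq | apply/FP_not/hP | apply: FP_eq | apply/FP_not/hP].
pose lp : {poly nat} := (3%N%:P * p)%R.
have lpE (x : word) : peval lp (size x) = 3 * m x by rewrite pevalM pevalC.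
have hl : FP 1 (fun a => nseq (peval lp (size (arg a 0))) false) by apply/FP_poly/FP_arg.
have [K [hK _ hacc]] := @guess_and_check (fun x => nseq (peval lp (size x)) false) U hl hU.
have Kacc x s : accepting_path K [:: x] s <-> size s = 3 * m x /\ U x s.
  by rewrite hacc size_nseq lpE.
have slices x s : size s = 3 * m x ->
    exists y w z : (m x).-tuple bool, [/\ y_ x s = y, w_ x s = w & z_ x s = z].
  move=> ss; have sy : size (y_ x s) == m x by rewrite size_takel // ss; lia.
  have sw : size (w_ x s) == m x by rewrite size_takel // size_drop ss; lia.
  have sz : size (z_ x s) == m x by rewrite !size_drop ss; lia.
  by exists (Tuple sy), (Tuple sw), (Tuple sz).
have glue x s : s = y_ x s ++ w_ x s ++ z_ x s by rewrite !cat_take_drop.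
have PE x (w : (m x).-tuple bool) : P x w = (w \in acc M (m x) x).
  by rewrite inE; apply/asboolP/asboolP => /(padded_path_balanced hb (size_tuple w)).
have UE x (h : (m x).-tuple bool -> (m x).-tuple bool) s (y w z : (m x).-tuple bool) :
    adjacency circsucc R x h -> y_ x s = y -> w_ x s = w -> z_ x s = z ->
    U x s <-> isolated h (acc M (m x) x) y w z.
  move=> hadj ey ew ez; rewrite /U ey ew ez !PE.
  split=> [/and5P[i1 /asboolP/hadj i2 /asboolP/hadj i3 /orP i4 /orP i5] //|].
  move=> [i1 /hadj i2 /hadj i3 /orP i4 /orP i5].
  by apply/and5P; split=> //; apply/asboolP.
have sliced x s h (S := acc M (m x) x) : bijective h -> adjacency circsucc R x h ->
    cluster M (fun x => 1 + `[< A x >]) x h -> accepting_path K [:: x] s ->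
    exists y w z : (m x).-tuple bool, [/\ s = y ++ w ++ z, isolated h S y w z & #|S| <= 1].
  move=> hbij hadj hclu /Kacc [ss Us].
  have [y [w [z [ey ew ez]]]] := slices x s ss.
  have iso := (UE x h s y w z hadj ey ew ez).1 Us.
  exists y, w, z; split=> //; first by rewrite {1}(glue x s) ey ew ez.
  (* The value [1 + _] is never zero, so the cluster condition applies on every input. *)
  have [//|l [u eS]] := hclu.
  exact: (isolated_card (S := S) hbij eS iso).
exists K; split=> //.
- move=> x s s' hs hs'; have [h [hbij hadj hclu hcard]] := hx x.
  have [y [w [z [-> iso S1]]]] := sliced x s h hbij hadj hclu hs.
  have [y' [w' [z' [-> iso' _]]]] := sliced x s' h hbij hadj hclu hs'.
  by have [-> -> ->] := isolated_unique hbij S1 iso iso'.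
apply/seteqP; split=> x /=; have [h [hbij hadj hclu hcard]] := hx x.
- move=> nA; rewrite asboolF // addn0 in hcard.
  have [y [w [z iso]]] := isolated_exists hbij (esym hcard).
  exists (y ++ w ++ z); apply/Kacc; split; first by rewrite !size_cat !size_tuple -/(m x) mulSn mul2n addnn.
  apply/(UE x h _ y w z hadj) => //.
  + by rewrite /y_ take_size_cat ?size_tuple.
  + by rewrite /w_ drop_size_cat ?size_tuple // take_size_cat ?size_tuple.
  + by rewrite /z_ drop_size_cat ?size_tuple // drop_size_cat ?size_tuple.
- move=> [s hs] Ax; have [y [w [z [_ _]]]] := sliced x s h hbij hadj hclu hs.
  by rewrite -hcard asboolT.
Qed.

(** * From UP = coUP to known ends *)

(* The certificate of [y0] consists of [y0] itself, followed by the padded path of the UP machine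
   which accepts the complement of the set of pairs [(x, y)] where [y] has a predecessor. *)
Lemma end_certificate p (R : word -> word -> word -> Prop) : UP = coUP ->
  FP 3 (fun a => [:: `[< R (arg a 0) (arg a 1) (arg a 2) >]]) ->
  (forall x y z z', size z = peval p (size x) -> size z' = peval p (size x) ->
     size y = peval p (size x) -> R x z y -> R x z' y -> z = z') ->
  exists (r : {poly nat}) (E : word -> word -> bool),
    FP 2 (fun a => [:: E (arg a 0) (arg a 1)]) /\
    forall x y0, size y0 = peval p (size x) ->
      (forall y, size y = peval p (size x) ->
         (exists2 z, size z = peval p (size x) & R x z y) <-> y <> y0) ->
      exists e0, [/\ size e0 = peval r (size x), take (peval p (size x)) e0 = y0 &
        forall e, size e = peval r (size x) -> E x e = (e == e0)].
Proof.
move=> eqUP hR uR.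
pose l c := peval p (size (fst_word c)).
(* The length test makes [uR] applicable on every input [c], so that the machine is unambiguous also
   on words that encode no pair of suitable lengths. *)
pose B c z := (size (snd_word c) == l c) && `[< R (fst_word c) z (snd_word c) >].
pose D : language := fun c => exists2 z, size z = l c & B c z.
have hl k g : FP k g -> FP k (fun a => nseq (l (g a)) false).
  by move=> hg; apply/FP_poly/FP_fst.
have hB : FP 2 (fun a => [:: B (arg a 0) (arg a 1)]).
  apply: FP_and.
    have := FP_eqsize (FP_snd (FP_arg (isT : 0 < 2))) (hl _ _ (FP_arg (isT : 0 < 2))).
    by apply: FP_ext => a _; rewrite size_nseq.
  apply: (@FP3_comp 2 (fun x y z => [:: `[< R x y z >]]) _ _ _ hR).
  - exact/FP_fst/FP_arg.
  - exact: FP_arg.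
  - exact/FP_snd/FP_arg.
have [K [hK _ Kacc]] := @guess_and_check (fun c => nseq (l c) false) B (hl _ _ (FP_arg (isT : 0 < 1))) hB.
have UPD : UP D.
  exists K; split=> //.
    move=> c z z' /Kacc [sz /andP[/eqP sc /asboolP hz]] /Kacc [sz' /andP[_ /asboolP hz']].
    by rewrite !size_nseq in sz sz'; apply: uR hz hz'.
  apply/seteqP; split=> c /= [z].
    by move=> sz hz; exists z; apply/Kacc; rewrite size_nseq.
  by move/Kacc; rewrite size_nseq => -[sz hz]; exists z.
have [N [hN uN eN]] : coUP D by rewrite -eqUP.
have DN c : ~ D c <-> exists w, accepting_path N [:: c] w.
  by rewrite -[~ D c]/((~` D)%classic c) eN.
have [q hq] := accepting_path_bound hN.
(* The inner polynomial is the length of [pair_word x y] for [y] of length [p]; [q] bounds the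
   accepting paths of [N] on such a pair. *)
pose lenp : {poly nat} := (q \Po (2%N%:P * 'X + p + 1%N%:P))%R.
pose r : {poly nat} := (p + lenp)%R.
pose len (x : word) := peval lenp (size x).
have lenE x y : size y = peval p (size x) -> len x = peval q (size (pair_word x y)).
  by move=> sy; rewrite /len peval_comp !(pevalD, pevalM, pevalC, pevalX) size_pair sy.
pose y_ (x e : word) : word := take (peval p (size x)) e.
pose w_ (x e : word) : word := drop (peval p (size x)) e.
pose E x e := `[< padded_path N (pair_word x (y_ x e)) (w_ x e) >].
have hp2 : FP 2 (fun a => nseq (peval p (size (arg a 0))) false) by apply/FP_poly/FP_arg.
exists r, E; split.
  apply: FP_padded_path => //.
    apply: FP_pair; first exact: FP_arg.
    by have := FP_take hp2 (FP_arg (isT : 1 < 2)); apply: FP_ext => a _; rewrite size_nseq.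
  by have := FP_drop hp2 (FP_arg (isT : 1 < 2)); apply: FP_ext => a _; rewrite size_nseq.
move=> x y0 sy0 hy0.
have DE y : size y = peval p (size x) -> D (pair_word x y) <-> y <> y0.
  move=> sy; rewrite -hy0 //; rewrite /D /B /l fst_pair snd_pair sy eqxx /=.
  by split=> -[z sz hz]; exists z => //; apply/asboolP.
have [w hw] : exists w, accepting_path N [:: pair_word x y0] w by apply/DN => /(DE _ sy0).
have sw := hq _ _ hw; rewrite -lenE // in sw.
pose e0 := y0 ++ w ++ nseq (len x - size w) false.
have se0 : size e0 = peval r (size x).
  by rewrite /e0 !size_cat size_nseq subnKC // sy0 pevalD.
exists e0; split=> //; first by rewrite /e0 take_size_cat.
move=> e se; apply/asboolP/eqP => [he|->]; last first.
  rewrite /y_ /w_ take_size_cat // drop_size_cat //.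
  by exists w, (len x - size w).
have sy : size (y_ x e) = peval p (size x).
  by rewrite size_takel // se pevalD leq_addr.
(* Any other string has a predecessor, so its pair with [x] lies in [D] and [N] has no accepting
   path on it. *)
have ey : y_ x e = y0.
  have [//|ney] := EM (y_ x e = y0).
  have [v [j [_ hv]]] := he.
  by have /DN [] : exists w, accepting_path N [:: pair_word x (y_ x e)] w by [exists v]; apply/(DE _ sy).
rewrite ey in he.
rewrite -(cat_take_drop (peval p (size x)) e) -/(y_ x e) ey; congr cat.
apply: (padded_path_unique (uN _) he); first by exists w, (len x - size w).
by rewrite size_drop se !size_cat size_nseq subnKC // pevalD addKn.
Qed.

Lemma pairs_pred L y : uniq L -> y \in L ->
  (exists z, (z, y) \in pairs L) <-> y <> head [::] L.
Proof.
move=> uL yL; split=> [[z]|yh].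
  rewrite pairs_index // => /and3P[_ _ /eqP e] eyh.
  by move: yL e; rewrite eyh; case: (L) => //= a s _; rewrite eqxx.
have iy : 0 < index y L.
  rewrite lt0n; apply/eqP => i0; apply: yh.
  by rewrite -nth0 -i0 nth_index.
have iL : index y L < size L by rewrite index_mem.
have zL : (index y L).-1 < size L by rewrite prednK // ltnW.
exists (nth [::] L (index y L).-1).
by rewrite pairs_index // mem_nth //= yL index_uniq // prednK //= eqxx.
Qed.

Lemma pairs_succ L y : uniq L -> y \in L ->
  (exists z, (y, z) \in pairs L) <-> y <> last [::] L.
Proof.
move=> uL yL; have iL : index y L < size L by rewrite index_mem.
split=> [[z]|yl].
  rewrite pairs_index // => /and3P[_ zL /eqP e] eyl.
  have sL : 0 < size L by apply: leq_ltn_trans iL.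
  have zi : index z L < size L by rewrite index_mem.
  by rewrite e eyl -nth_last index_uniq ?prednK // ltnn in zi.
have sy : (index y L).+1 < size L.
  rewrite ltn_neqAle iL andbT; apply/eqP => e; apply: yl.
  by rewrite -nth_last -e /= nth_index.
exists (nth [::] L (index y L).+1).
by rewrite pairs_index // mem_nth //= yL index_uniq //= eqxx.
Qed.

Section InsertedChain.
Variables (V : word -> bool) (m : nat) (C : seq word) (c0 c1 : word).
Hypotheses (V1 : ~~ V (nseq m true)) (hC : chain V m C).
Hypotheses (C0 : head [::] C = c0) (C1 : last [::] C = c1) (Cn : C != [::]).

(** The chain goes before the last filler so that the top is a known string, whatever the chain is.
    The insertion destroys one adjacency of the fillers and creates two junctions. *)
Lemma inserted_chain : exists s,
  let L := rcons s (penult_filler m) ++ C ++ [:: last_filler m] in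
  [/\ enumerates m.+1 L, head [::] L = first_filler m &
    forall a b, size a = m.+1 -> size b = m.+1 ->
      ((a, b) \in pairs L) =
      [|| block_succ V a b && (b != last_filler m),
          (a == penult_filler m) && (b == c0),
          (a, b) \in pairs C | (a == c1) && (b == last_filler m)]].
Proof.
have [s es] := fillers_last V1; exists s.
set pen := penult_filler m in es *; set lst := last_filler m in es *.
have [uF mF] := enumerates_fillers hC.
have perm : perm_eq (rcons s pen ++ C ++ [:: lst]) (fillers V m ++ C).
  by rewrite es -cats1 -[rcons (s ++ _) _]cats1 -[X in perm_eq _ X]catA perm_cat2l perm_catC.
split.
- by split=> [|w]; [rewrite (perm_uniq perm) | rewrite (perm_mem perm)].
- have := fillers_first V m; rewrite es; case: (s) => [|a s'] //=.
move=> a b sa sb.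
have uf : uniq (fillers V m) by move: uF; rewrite cat_uniq => /and3P[].
have fE : ((a, b) \in pairs (rcons s pen)) = block_succ V a b && (b != lst).
  rewrite -(pairs_fillers V sa sb) es -[rcons (rcons _ _) _]cats1 pairs_cat mem_cat inE xpair_eqE.
  (* The list is free of duplicates, so [lst] is the second component only in the pair that the
     insertion breaks up. *)
  case: (eqVneq b lst) => [->|nb]; last by rewrite andbF orbF andbT.
  rewrite andbF; apply/negP => /pairs_mem [_ /mem_behead h].
  by move: uf; rewrite es rcons_uniq h.
have eC : C = c0 :: behead C by move: C0 Cn; case: (C) => //= ? ? ->.
have [C' eC'] : exists C', C = rcons C' c1.
  by move: C1 Cn; case/lastP: (C) => // C' c; rewrite last_rcons => ->; exists C'.
rewrite eC pairs_cat mem_cat fE -cat_cons -eC inE xpair_eqE.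
congr (_ || (_ || _)).
by rewrite {1}eC' pairs_cat mem_cat -eC' inE xpair_eqE.
Qed.

End InsertedChain.

Lemma free_sub_CLU : UP = coUP -> (CLU_free `<=` CLU)%classic.
Proof.
move=> eqUP f [p [M [R [hM hbal hR hx]]]].
have FR := FP_of_polytime_pred3 hR.
have FR' : FP 3 (fun a => [:: `[< R (arg a 0) (arg a 2) (arg a 1) >]]).
  by apply: (@FP3_comp 3 (fun x y z => [:: `[< R x y z >]])) => //; apply: FP_arg.
have hL x : exists L (h : (peval p (size x)).-tuple bool -> (peval p (size x)).-tuple bool),
    [/\ enumerates (peval p (size x)) L, ranks L h, cluster M f x h,
    f x = #|acc M (peval p (size x)) x| &
    forall y z, size y = peval p (size x) -> size z = peval p (size x) ->
      (R x y z <-> (y, z) \in pairs L)].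
  have [h [hb hadj hc hf]] := hx x; have [L hL hr] := list_of_bijection hb.
  exists L, h; split=> // y z /eqP sy /eqP sz.
  rewrite -[y]/(val (Tuple sy)) -[z]/(val (Tuple sz)) -(lexsucc_ranks hL hr).
  exact: hadj.
have uR1 x y z z' : size z = peval p (size x) -> size z' = peval p (size x) ->
    size y = peval p (size x) -> R x z y -> R x z' y -> z = z'.
  move=> sz sz' sy; have [L [h [[uL mL] _ _ _ RL]]] := hL x; rewrite !RL // !pairs_index //.
  move=> /and3P[zL _ /eqP e] /and3P[zL' _ /eqP e'].
  by rewrite -(nth_index [::] zL) -(nth_index [::] zL'); congr nth; apply: succn_inj; rewrite -e.
have uR2 x y z z' : size z = peval p (size x) -> size z' = peval p (size x) ->
    size y = peval p (size x) -> R x y z -> R x y z' -> z = z'.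
  move=> sz sz' sy; have [L [h [[uL mL] _ _ _ RL]]] := hL x; rewrite !RL // !pairs_index //.
  move=> /and3P[_ zL /eqP e] /and3P[_ zL' /eqP e'].
  by rewrite -(nth_index [::] zL) -(nth_index [::] zL') e e'.
have [r1 [E1 [hE1 cert1]]] := end_certificate eqUP FR uR1.
(* The top is the bottom of the reversed order. *)
have [r2 [E2 [hE2 cert2]]] := @end_certificate p (fun x y z => R x z y) eqUP FR' uR2.
(* The parts of a valid string: a leading [0], which makes [1^m] invalid, the old string, and the
   certificates of bottom and top. *)
pose mp : {poly nat} := (1%N%:P + (p + (r1 + r2)))%R.
pose m (x : word) := peval mp (size x).
have mE x : m x = (peval p (size x) + (peval r1 (size x) + peval r2 (size x))).+1.
  by rewrite /m !pevalD pevalC.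
pose y_ (x v : word) : word := take (peval p (size x)) v.
pose e1_ (x v : word) : word := take (peval r1 (size x)) (drop (peval p (size x)) v).
pose e2_ (x v : word) : word := drop (peval r1 (size x)) (drop (peval p (size x)) v).
pose V x u := ~~ head false u && (E1 x (e1_ x (behead u)) && E2 x (e2_ x (behead u))).
pose ok x s := ~~ head false s && V x (behead s).
pose pay (s : word) : word := behead (behead s).
have V1 x : ~~ V x (nseq (m x) true) by rewrite mE.
have tk k (q : {poly nat}) g0 g1 : FP k g0 -> FP k g1 ->
    FP k (fun a => take (peval q (size (g0 a))) (g1 a)).
  move=> h0 h1; have := FP_take (FP_poly q h0) h1.
  by apply: FP_ext => a _; rewrite size_nseq.
have dr k (q : {poly nat}) g0 g1 : FP k g0 -> FP k g1 ->
    FP k (fun a => drop (peval q (size (g0 a))) (g1 a)).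
  move=> h0 h1; have := FP_drop (FP_poly q h0) h1.
  by apply: FP_ext => a _; rewrite size_nseq.
have Fy k g0 g1 : FP k g0 -> FP k g1 -> FP k (fun a => y_ (g0 a) (g1 a)) by apply: tk.
have Fe1 k g0 g1 : FP k g0 -> FP k g1 -> FP k (fun a => e1_ (g0 a) (g1 a)).
  by move=> h0 h1; apply: tk => //; apply: dr.
have Fe2 k g0 g1 : FP k g0 -> FP k g1 -> FP k (fun a => e2_ (g0 a) (g1 a)).
  by move=> h0 h1; apply: (dr) => //; apply: (dr).
have FV k g0 g1 : FP k g0 -> FP k g1 -> FP k (fun a => [:: V (g0 a) (g1 a)]).
  move=> h0 h1; apply: FP_and; first exact/FP_not/FP_head.
  apply: FP_and.
    apply: (@FP2_comp k (fun x e => [:: E1 x e]) _ _ hE1 h0).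
    by apply: Fe1 => //; apply: FP_behead.
  apply: (@FP2_comp k (fun x e => [:: E2 x e]) _ _ hE2 h0).
  by apply: Fe2 => //; apply: FP_behead.
have Fok k g0 g1 : FP k g0 -> FP k g1 -> FP k (fun a => [:: ok (g0 a) (g1 a)]).
  by move=> h0 h1; apply: FP_and; [apply/FP_not/FP_head | apply/FV => //; apply: FP_behead].
have Fpay k g : FP k g -> FP k (fun a => pay (g a)) by move=> hg; apply/FP_behead/FP_behead.
have Ffirst k g : FP k g -> FP k (fun a => first_filler (m (g a))).
  by move=> hg; apply/FP_cons/FP_poly.
have Fones k g : FP k g -> FP k (fun a => nseq (m (g a)) true).
  move=> hg; have := FP_nseq true (FP_poly mp hg).
  by apply: FP_ext => a _; rewrite size_nseq.
have Fpen k g : FP k g -> FP k (fun a => penult_filler (m (g a))).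
  by move=> hg; apply/FP_cons/Fones.
have Flast k g : FP k g -> FP k (fun a => last_filler (m (g a))).
  by move=> hg; apply/FP_cons/Fones.
pose W x s := ok x s && `[< padded_path M x (y_ x (pay s)) >].
have hW : FP 2 (fun a => [:: W (arg a 0) (arg a 1)]).
  have x2 : FP 2 (fun a => arg a 0) by apply: FP_arg.
  have s2 : FP 2 (fun a => arg a 1) by apply: FP_arg.
  by apply: FP_and; [apply: Fok | apply: FP_padded_path => //; apply/Fy/Fpay].
pose p' : {poly nat} := (mp + 1%N%:P)%R.
have pE x : peval p' (size x) = (m x).+1 by rewrite pevalD pevalC addn1.
have hp' : FP 1 (fun a => nseq (peval p' (size (arg a 0))) false) by apply/FP_poly/FP_arg.
have [K [hK Kbal Kacc]] := @guess_and_check (fun x => nseq (peval p' (size x)) false) W hp' hW.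
(* The four clauses are those of [inserted_chain]. The ends of the chain are recognized without
   search, since the first certificate starts with the old bottom and the second with the old
   top. *)
pose R' x s s' := [|| block_succ (V x) s s' && (s' != last_filler (m x)),
  (s == penult_filler (m x)) && (ok x s' && (y_ x (pay s') == y_ x (e1_ x (pay s')))),
  ok x s && (ok x s' && `[< R x (y_ x (pay s)) (y_ x (pay s')) >]) |
  (ok x s && (y_ x (pay s) == y_ x (e2_ x (pay s)))) && (s' == last_filler (m x))].
have hR' : polytime_pred3 R'.
  apply: polytime_pred3_bool.
  have x3 : FP 3 (fun a => arg a 0) by apply: FP_arg.
  have s3 : FP 3 (fun a => arg a 1) by apply: FP_arg.
  have t3 : FP 3 (fun a => arg a 2) by apply: FP_arg.
  have V2 : FP 2 (fun a => [:: V (arg a 0) (arg a 1)]) by apply: FV; apply: FP_arg.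
  have ys := Fy _ _ _ x3 (Fpay _ _ s3); have yt := Fy _ _ _ x3 (Fpay _ _ t3).
  have lst3 := Flast _ _ x3.
  apply: FP_or.
    by apply: FP_and; [apply: FP_block_succ | apply/FP_not/FP_eq].
  apply: FP_or.
    apply: FP_and; first by apply: FP_eq => //; apply: Fpen.
    apply: FP_and; first exact: Fok.
    by apply: FP_eq => //; apply: Fy => //; apply: Fe1 => //; apply: Fpay.
  apply: FP_or.
    apply: FP_and; first exact: Fok.
    apply: FP_and; first exact: Fok.
    exact: (@FP3_comp 3 (fun x y z => [:: `[< R x y z >]]) _ _ _ FR x3 ys yt).
  apply: FP_and; last exact: FP_eq.
  apply: FP_and; first exact: Fok.
  by apply: FP_eq => //; apply: Fy => //; apply: Fe2 => //; apply: Fpay.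
exists p', K, (fun x => first_filler (m x)), (fun x => last_filler (m x)), R'.
split=> //.
- by split=> // x w; rewrite Kbal size_nseq.
- by apply/FPt_of_FP/Ffirst/FP_arg.
- by apply/FPt_of_FP/Flast/FP_arg.
move=> x; rewrite pE /=.
have [L [h [hL0 hr0 hc0 hf0 RL]]] := hL x; have [uL mL] := hL0.
set P := peval p (size x) in hL0 hf0 RL mL h hr0 hc0 *.
have Ln : L != [::] by rewrite -size_eq0 (enumerates_size hL0) -lt0n expn_gt0.
pose y0 := head [::] L; pose y1 := last [::] L.
have y0L : y0 \in L by rewrite /y0; case: (L) Ln => // *; apply: mem_head.
have y1L : y1 \in L by rewrite /y1; case: (L) Ln => // a l _; rewrite /= mem_last.
have sP y : y \in L -> size y = P by rewrite mL => /eqP.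
have [e1 [se1 te1 uE1]] : exists e1, [/\ size e1 = peval r1 (size x), take P e1 = y0 &
    forall e, size e = peval r1 (size x) -> E1 x e = (e == e1)].
  apply: (cert1 x y0 (sP _ y0L)) => y sy; have yL : y \in L by rewrite mL sy eqxx.
  rewrite -(pairs_pred uL yL); split=> [[z sz /(RL _ _ sz sy) h']|[z h']]; first by exists z.
  have sz : size z = P by apply: sP; have [] := pairs_mem h'.
  by exists z => //; apply/RL.
have [e2 [se2 te2 uE2]] : exists e2, [/\ size e2 = peval r2 (size x), take P e2 = y1 &
    forall e, size e = peval r2 (size x) -> E2 x e = (e == e2)].
  apply: (cert2 x y1 (sP _ y1L)) => y sy; have yL : y \in L by rewrite mL sy eqxx.
  rewrite -(pairs_succ uL yL); split=> [[z sz /(RL _ _ sy sz) h']|[z h']]; first by exists z.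
  have sz : size z = P by apply: sP; have [_ /mem_behead] := pairs_mem h'.
  by exists z => //; apply/RL.
(* The certificates depend on [x] alone and are unique, so each old string has one valid
   extension. *)
pose enc y : word := false :: false :: y ++ e1 ++ e2.
have enc_inj : {in L &, injective enc}.
  move=> y y' yL yL' [] /eqP; rewrite eqseq_cat; last by rewrite !sP.
  by move=> /andP[/eqP].
have payE y : y \in L -> [/\ y_ x (pay (enc y)) = y, e1_ x (pay (enc y)) = e1 & e2_ x (pay (enc y)) = e2].
  move=> /sP sy; rewrite /y_ /e1_ /e2_ /= take_size_cat // drop_size_cat //.
  by rewrite take_size_cat // drop_size_cat.
have ok_enc y : y \in L -> ok x (enc y).
  move=> yL; have [_ h1 h2] := payE _ yL; rewrite /pay /= in h1 h2.
  by rewrite /ok /V /= h1 h2 uE1 // uE2 // !eqxx.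
have okP s : size s = (m x).+1 -> ok x s -> exists2 y, y \in L & s = enc y.
  rewrite mE; case: s => [|c [|d v]] //= [sv] /andP[nc /andP[nd /andP[h1 h2]]].
  rewrite /= in nc nd h1 h2; rewrite (negbTE nc) (negbTE nd).
  have sy : size (y_ x v) = P by rewrite size_takel // sv leq_addr.
  have s1 : size (e1_ x v) = peval r1 (size x).
    by rewrite size_takel // size_drop sv addKn leq_addr.
  have s2 : size (e2_ x v) = peval r2 (size x) by rewrite !size_drop sv !addKn.
  exists (y_ x v); first by rewrite mL sy eqxx.
  rewrite uE1 // in h1; rewrite uE2 // in h2.
  by rewrite /enc -(eqP h1) -(eqP h2) !cat_take_drop.
pose C := map enc L.
have hC : chain (V x) (m x) C.
  split=> [|w]; first by rewrite map_inj_in_uniq.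
  split=> [/mapP [y yL ->]|[u -> [su Vu]]].
    exists (behead (enc y)) => //; split; last by have /andP[] := ok_enc _ yL.
    by rewrite mE /= !size_cat (sP _ yL) se1 se2.
  have [|//|y yL ->] := okP (false :: u); first by rewrite /= su.
  exact: map_f.
have Cn : C != [::] by rewrite -size_eq0 size_map size_eq0.
have C0 : head [::] C = enc y0 by rewrite /C /y0; case: (L) Ln.
have C1 : last [::] C = enc y1.
  by rewrite /C /y1; case: (L) Ln => // a l _; rewrite /= last_map.
have [s [hL' hd prs]] := inserted_chain (V1 x) hC C0 C1 Cn.
set L' := rcons s _ ++ _ in hL' hd prs.
have [L1 [L2 [L3 [eL fL2 accL2]]]] := list_of_cluster hL0 hr0 hc0 hf0.
have eL' : L' = (rcons s (penult_filler (m x)) ++ map enc L1) ++ map enc L2 ++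
    (map enc L3 ++ [:: last_filler (m x)]).
  by rewrite /L' /C eL !map_cat -!catA.
have [h' hb' hr'] := bijection_of_list hL'.
have okL y' : size y' = (m x).+1 -> ok x y' -> y_ x (pay y') \in L /\ y' = enc (y_ x (pay y')).
  by move=> sy' /(okP _ sy') [y yL ->]; have [-> _ _] := payE _ yL.
(* No filler accepts, so the accepting strings are the image of the old cluster, again a segment and
   of the same size. *)
have Kacc' w : size w = (m x).+1 -> (accepting_path K [:: x] w <-> w \in map enc L2).
  move=> sw; rewrite Kacc size_nseq pE sw; have sub2 : {subset L2 <= L}.
    by move=> y y2; rewrite eL !mem_cat y2 orbT.
  split=> [[_ /andP[/(okL _ sw) [yL ->]]]|/mapP [y y2 ->]].
    have sy := sP _ yL; have [-> _ _] := payE _ yL.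
    by move=> /asboolP /(padded_path_balanced hbal sy) /(accL2 _ sy); apply: map_f.
  have yL := sub2 _ y2; have sy := sP _ yL; split=> //; rewrite /W ok_enc //=.
  by have [-> _ _] := payE _ yL; apply/asboolP/(padded_path_balanced hbal sy)/accL2.
have hL'' := hL'; have hr'' := hr'; rewrite eL' in hL'' hr''.
have fL2' : f x = size (map enc L2) by rewrite size_map.
have [cl cf] := cluster_of_list hL'' hr'' Kacc' fL2'.
have sb : size (first_filler (m x)) == (m x).+1 by rewrite /= size_nseq.
have st : size (last_filler (m x)) == (m x).+1 by rewrite /= size_nseq.
exists h'; split=> //.
  exists (Tuple sb), (Tuple st); split=> //; apply/eqP.
    by rewrite (ranks_zeros hL' hr') hd.
  by rewrite (ranks_ones hL' hr') /L' !last_cat.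
move=> a b; rewrite (lexsucc_ranks hL' hr') prs ?size_tuple //.
have sa := size_tuple a; have sb' := size_tuple b.
have c0E w : size w = (m x).+1 ->
    ok x w && (y_ x (pay w) == y_ x (e1_ x (pay w))) = (w == enc y0).
  move=> sw; apply/andP/eqP => [[/(okP _ sw) [y yL ->]]|->].
    by have [-> -> _] := payE _ yL; rewrite /y_ te1 => /eqP ->.
  by have [-> -> _] := payE _ y0L; rewrite /y_ te1 ok_enc ?eqxx.
have c1E w : size w = (m x).+1 ->
    ok x w && (y_ x (pay w) == y_ x (e2_ x (pay w))) = (w == enc y1).
  move=> sw; apply/andP/eqP => [[/(okP _ sw) [y yL ->]]|->].
    by have [-> _ ->] := payE _ yL; rewrite /y_ te2 => /eqP ->.
  by have [-> _ ->] := payE _ y1L; rewrite /y_ te2 ok_enc ?eqxx.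
have chainE : ok x a && (ok x b && `[< R x (y_ x (pay a)) (y_ x (pay b)) >]) =
    ((val a, val b) \in pairs C).
  rewrite /C pairs_map; apply/and3P/mapP => [[/(okP _ sa) [y yL ea] /(okP _ sb') [z zL eb]]|].
    rewrite ea eb; have [-> _ _] := payE _ yL; have [-> _ _] := payE _ zL.
    by move/asboolP/(RL _ _ (sP _ yL) (sP _ zL)) => yz; exists (y, z); rewrite //= -ea -eb.
  move=> [[y z] yz [-> ->]]; have [yL /mem_behead zL] := pairs_mem yz.
  rewrite !ok_enc //; split=> //; have [-> _ _] := payE _ yL; have [-> _ _] := payE _ zL.
  by apply/asboolP/RL; rewrite ?sP.
by rewrite /R' c0E // c1E // chainE.
Qed.

(** * The cycle of implications *)

Local Open Scope classical_set_scope.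

Theorem theorem5p2 :
  [<-> UP = coUP; CLU_free = CLU; CLU_free `<=` CLU_circular].
Proof.
tfae.
- move=> eqUP; apply/seteqP; split; [exact: free_sub_CLU | exact: CLU_sub_free].
- by move=> ->; apply: CLU_sub_circular.
- move=> hcirc; apply/seteqP; split=> A hA; first exact: (compl_UP_of_circular hcirc).
  by rewrite -[A]setCK; apply: (compl_UP_of_circular hcirc).
Qed.
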